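(* Let $T$ be an EMR map with pressure function $P$ and critical value $s_\infty$ such that $P(s_{\infty})=\infty$. Then any compact perturbation $\tilde{T}$ of $T$ has a measure of maximal dimension.
   Context: EMR map: let $I=[0,1]$ and let $\{I_i\}_{i\in\mathbb{N}}$ be a countable collection of closed intervals $I_i=[a_i,b_i]\subset I$ with pairwise disjoint interiors. For a map $T:\bigcup_{n=1}^\infty I_n\to I$, its repeller is $\Lambda=\{x\in\bigcup_i I_i: T^n(x)\text{ is well defined for every }n\in\mathbb{N}\}$; put $\mathcal{O}=\bigcup_{k=0}^\infty T^{-k}\left(\bigcup_{i=1}^\infty\{a_i,b_i\}\right)$. The map $T$ is an EMR (expanding-Markov-Renyi) map if: (a) the only accumulation point of the endpoints of the intervals $[a_i,b_i]$ is $x=0$; (b) $T$ is $C^2$ on $\bigcup_{i=1}^\infty\mathrm{int}\, I_i$; (c) there exist $\xi>1$ and $N\in\mathbb{N}$ such that for every $x\in\bigcup_{i=1}^\infty I_i$ and $n\ge N$, $|(T^n)'(x)|>\xi^n$; (d) $T$ is Markov and can be coded by a full-shift on a countable alphabet: there is a homeomorphism $\pi:\Sigma\to\Lambda\setminus\mathcal{O}$ with $T\circ\pi=\pi\circ\sigma$, where $\Sigma=\mathbb{N}^{\mathbb{N}}$ has the topology generated by cylinder sets and $\sigma$ is the left shift; (e) (Renyi condition) there is $K>0$ with $\sup_{n\in\mathbb{N}}\sup_{x,y,z\in I_n}\frac{|T''(x)|}{|T'(y)||T'(z)|}\le K$. Pressure: for $t\in\mathbb{R}$, $P(t)=\lim_{n\to\infty}\frac1n\log\sum_{T^nx=x}\prod_{i=0}^{n-1}|T'(T^ix)|^{-t}$.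 The critical value $s_\infty$ is the number such that $P(t)=\infty$ for $t<s_\infty$ and $P(t)<\infty$ for $t>s_\infty$, i.e. $s_\infty=\inf\{t\in\mathbb{R}:P(t)<\infty\}$. Compact perturbation: let $T$ be an EMR map defined on the closed intervals $(I_n)_n$. A map $\tilde T$ is a compact perturbation of $T$ if (i) there exists a compact subset $K\subset(0,1]$ such that $\mathrm{int}\,I_n\cap K\ne\emptyset$ implies $I_n\subset K$, and $T(x)=\tilde T(x)$ for every $x\in\left(\bigcup_{i=1}^\infty I_i\right)\setminus K$; and (ii) $\tilde T$ is an EMR map. Measure of maximal dimension: for a Borel probability measure $\mu$, $\dim_H(\mu)=\inf\{\dim_H(Z):\mu(Z)=1\}$, with $\dim_H(Z)$ the Hausdorff dimension of $Z$. A measure of maximal dimension for an EMR map with repeller $\Lambda$ is an ergodic invariant probability measure $\nu$ of that map with $\dim_H\nu=\dim_H\Lambda$. *)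

(* Defs.v *)
From mathcomp Require Import all_boot all_order all_algebra.
From mathcomp Require Import all_classical all_reals all_analysis.
Import Order.TTheory GRing.Theory Num.Theory.
Import numFieldNormedType.Exports.

Set Implicit Arguments.
Unset Strict Implicit.
Unset Printing Implicit Defensive.

Local Open Scope ring_scope.
Local Open Scope classical_set_scope.

(* {0, 1, 2, ...}^nat with the product of the discrete topologies, i.e. the
   topology generated by the cylinder sets. *)
Notation full_shift := (prod_topology (fun _ : nat => nat)).

Definition shift (w : full_shift) : full_shift := fun n => w n.+1.

Definition homeomorphism_onto (S U : topologicalType) (f : S -> U)
    (A : set U) : Prop :=
  [/\ continuous f, range f = A &
      exists2 g : U -> S, cancel f g & {within A, continuous g}].

(* A partial map whose domain is the union of the closed intervals
   [lend i, rend i]. The values of imap outside the domain are irrelevant: all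
   notions below only look at orbits inside the domain, and at derivatives at
   interior points of the intervals. *)
Record interval_map (R : realType) := IntervalMap {
  lend : nat -> R;
  rend : nat -> R;
  imap :> R -> R }.

Definition dom (R : realType) (T : interval_map R) : set R :=
  \bigcup_i `[lend T i, rend T i]%classic.

Definition intdom (R : realType) (T : interval_map R) : set R :=
  \bigcup_i `]lend T i, rend T i[%classic.

Definition endpoints (R : realType) (T : interval_map R) : set R :=
  range (lend T) `|` range (rend T).

Definition repeller (R : realType) (T : interval_map R) : set R :=
  [set x | forall n, dom T (iter n T x)].

Definition pre_endpoints (R : realType) (T : interval_map R) : set R :=
  [set x | exists k, (forall j, (j < k)%N -> dom T (iter j T x)) /\
                     endpoints T (iter k T x)].

(* The symbol i of the coding stands for the i-th interval: pi w lies in the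
   interval of index w 0, hence T^k (pi w) in the interval of index w k. *)
Definition full_shift_coding (R : realType) (T : interval_map R)
    (pi : full_shift -> R) : Prop :=
  [/\ homeomorphism_onto pi (repeller T `\` pre_endpoints T),
      forall w, T (pi w) = pi (shift w) &
      forall w, `[lend T (w 0%N), rend T (w 0%N)]%classic (pi w)].

(* The derivative of T is only available in the interiors of the intervals, so
   expansion is required at the points whose first n iterates stay there (there
   (T^n)' is the ordinary derivative), and the Renyi suprema range over the
   interiors; T' <> 0 says that the quotient is well defined. *)
Record is_emr (R : realType) (T : interval_map R) : Prop := IsEMR {
  emr_itv : forall i, 0 <= lend T i /\ lend T i < rend T i /\ rend T i <= 1;
  emr_disjoint :
    trivIset setT (fun i => `]lend T i, rend T i[%classic : set R);
  emr_range : forall x, dom T x -> 0 <= T x <= 1;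
  emr_accumulation : limit_point (endpoints T) = [set 0];
  emr_C2 : forall x, intdom T x ->
    [/\ derivable T x 1, derivable (T^`()) x 1 & {for x, continuous (T^`(2))}];
  emr_expanding : exists (xi : R) (N : nat), 1 < xi /\
    forall x n, (N <= n)%N -> (forall k, (k < n)%N -> intdom T (iter k T x)) ->
      xi ^+ n < `|(iter n T)^`() x|;
  emr_coding : exists pi : full_shift -> R, full_shift_coding T pi;
  emr_renyi : exists K : R, 0 < K /\
    forall n (x y z : R),
      `]lend T n, rend T n[%classic x ->
      `]lend T n, rend T n[%classic y ->
      `]lend T n, rend T n[%classic z ->
      [/\ T^`() y != 0, T^`() z != 0 &
          `|T^`(2) x| / (`|T^`() y| * `|T^`() z|) <= K] }.

Definition weight (R : realType) (T : interval_map R) (t : R) (n : nat) (x : R)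
    : R :=
  \prod_(i < n) (`|derive1 T (iter i T x)| `^ (- t)).

(* The periodic points summed over are those at which the derivatives exist,
   namely the ones whose orbit avoids the endpoints. *)
Definition periodic_sum (R : realType) (T : interval_map R) (t : R) (n : nat)
    : \bar R :=
  (\esum_(x in [set x | (repeller T `\` pre_endpoints T) x /\ iter n T x = x])
     (weight T t n x)%:E)%E.

Definition pressure (R : realType) (T : interval_map R) (t : R) : \bar R :=
  limn (fun n => ((n%:R^-1)%:E * lne (periodic_sum T t n))%E).

Definition critical_value (R : realType) (T : interval_map R) : R :=
  inf [set t : R | (pressure T t < +oo)%E].

(* T' comes with its own family of intervals; away from K, T and T' coincide as
   partial maps, i.e. they have the same domain and the same values there. *)
Definition compact_perturbation (R : realType) (T T' : interval_map R) : Prop :=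
  (exists K : set R,
    [/\ compact K, K `<=` `]0, 1]%classic,
        (forall n, `]lend T n, rend T n[%classic `&` K !=set0 ->
                   `[lend T n, rend T n]%classic `<=` K),
        dom T' `\` K = dom T `\` K &
        forall x, (dom T `\` K) x -> T x = T' x]) /\
  is_emr T'.

Definition diam (R : realType) (U : set R) : \bar R :=
  ereal_sup [set e | exists x y, [/\ U x, U y & e = `|x - y|%:E]].

(* The empty set contributes 0, also for s = 0. *)
Definition diam_pow (R : realType) (s : R) (U : set R) : \bar R :=
  if U == set0 then 0%E else poweR (diam U) s.

Definition hausdorff_premeasure (R : realType) (s delta : R) (Z : set R)
    : \bar R :=
  ereal_inf [set e | exists U : nat -> set R,
    [/\ Z `<=` \bigcup_i U i,
        forall i, (diam (U i) <= delta%:E)%E &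
        e = (\sum_(0 <= i <oo) diam_pow s (U i))%E]].

Definition hausdorff_measure (R : realType) (s : R) (Z : set R) : \bar R :=
  ereal_sup [set hausdorff_premeasure s delta Z | delta in `]0, +oo[%classic].

Definition hausdorff_dim (R : realType) (Z : set R) : \bar R :=
  ereal_inf [set s%:E | s in [set s : R | 0 <= s /\ hausdorff_measure s Z = 0%E]].

Definition measure_dim (R : realType) (nu : probability (measurableTypeR R) R)
    : \bar R :=
  ereal_inf [set hausdorff_dim Z | Z in
    [set Z : set R | measurable (Z : set (measurableTypeR R)) /\ nu Z = 1%E]].

(* Probability measures of the dynamical system T : repeller T -> repeller T,
   seen as Borel measures on the line carried by the repeller. *)
Definition invariant_probability (R : realType) (T : interval_map R)
    (nu : probability (measurableTypeR R) R) : Prop :=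
  [/\ measurable (repeller T : set (measurableTypeR R)),
      nu (repeller T) = 1%E,
      measurable_fun (repeller T : set (measurableTypeR R))
        (T : measurableTypeR R -> measurableTypeR R) &
      forall A : set (measurableTypeR R), measurable A ->
        nu (repeller T `&` T @^-1` A) = nu A].

Definition ergodic (R : realType) (T : interval_map R)
    (nu : probability (measurableTypeR R) R) : Prop :=
  forall A : set (measurableTypeR R), measurable A -> A `<=` repeller T ->
    repeller T `&` T @^-1` A = A -> nu A = 0%E \/ nu A = 1%E.

Definition max_dim_measure (R : realType) (T : interval_map R)
    (nu : probability (measurableTypeR R) R) : Prop :=
  [/\ invariant_probability T nu, ergodic T nu &
      measure_dim nu = hausdorff_dim (repeller T)].

(* Main.v *)
(* Let d(w) be the diameter of the set of points of the repeller whose coding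
   starts with the word w.  By the Renyi condition d is multiplicative up to a
   constant factor, and d(w) decays exponentially in |w|.  The pressure of t is
   finite exactly when the sum of the |I_i|^t is, and a compact perturbation has
   the same short intervals as the original map; so P(s_oo) = oo implies that,
   for the perturbation, the set of the t with finite sum is open on the left.
   Hence there is an exponent s, with finite sums slightly to the left of s, such
   that the sums of d(w)^s over the words of length n stay between two positive
   constants.  Averaging along a Banach limit gives an invariant probability nu
   with nu[w] <= B d(w)^s and nu[uv] >= c nu[u] nu[v], which is therefore ergodic.
   Covering by cylinders yields dim Lambda <= s.  The finiteness of the sums to
   the left of s shows, by Borel-Cantelli, that with positive nu-probability no
   digit is extremely short compared with the preceding cylinder, and on these
   points a mass distribution argument yields dim nu >= s. *)

Require Import Defs.
From HB Require Import structures.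
From mathcomp Require Import all_boot all_order all_algebra.
From mathcomp Require Import all_classical all_reals all_analysis.
From mathcomp Require Import measurable_realfun ring lra.
Import Order.TTheory GRing.Theory Num.Theory.
Import numFieldNormedType.Exports.

Set Implicit Arguments.
Unset Strict Implicit.
Unset Printing Implicit Defensive.

Local Open Scope ring_scope.
Local Open Scope classical_set_scope.

(** * Sums over words *)

(** Consistency in the last letter turns a function on words into a measure, and consistency in the
    first letter makes that measure invariant. Powers of the diameters have neither. Each is
    produced by one Banach limit, and the second average keeps what the first one gained. For the
    lower bound the obstacle is the infinite alphabet. A set of diameter at most [r] is compared
    with the cylinders where the diameter drops from above [r] at level [m] to at most [r] at level
    [m.+1], so mass at level [m] has to be bounded by a diameter at level [m.+1], which may be far
    smaller. If the [n]-th digit has diameter at least [kappa * rho ^+ n], the loss is only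
    exponential in [n]; the exponential decay of [d] absorbs it once the exponent is lowered from
    [s] to some [q < s]. For the perturbation, the two maps come with unrelated families of
    intervals and agree near 0 only as partial maps. The intervals must be recovered from the
    domain, where adjacent ones touch and could merge into one interval of the other map; this is
    excluded because all branches take two common values. *)

Lemma esumZl (R : realType) (I : choiceType) (A : set I) (c : R)
    (f : I -> \bar R) : 0 <= c -> (forall i, A i -> (0 <= f i)%E) ->
  (\esum_(i in A) (c%:E * f i) = c%:E * \esum_(i in A) f i)%E.
Proof.
move=> c0 f0.
have le_c (k : R) g : 0 <= k -> (forall i, A i -> (0 <= g i)%E) ->
    (\esum_(i in A) (k%:E * g i) <= k%:E * \esum_(i in A) g i)%E.
  move=> k0 g0; apply: ge_ereal_sup => _ [F [finF FA] <-].
  rewrite fsbig_finite//= big_seq -ge0_sume_distrr; last first.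
    by move=> i; rewrite in_fset_set// inE => /FA/g0.
  rewrite -big_seq lee_wpmul2l// ?lee_fin//; apply: ereal_sup_ubound.
  by exists F => //; rewrite fsbig_finite.
have [->|cn0] := eqVneq c 0.
  by rewrite mul0e; apply: esum1 => i _; rewrite mul0e.
have cp : 0 < c by rewrite lt0r cn0.
apply/eqP; rewrite eq_le le_c//=.
(* The reverse inequality is [le_c] for [c^-1] and the scaled family. *)
have := le_c c^-1 (fun i => c%:E * f i)%E.
rewrite invr_ge0 => /(_ c0); rewrite (_ : (fun i => _) = f); last first.
  by apply/funext => i; rewrite muleA -EFinM mulVf// mul1e.
move=> H; rewrite -(@lee_pmul2l _ c^-1%:E) ?lte_fin ?invr_gt0//.
rewrite muleA -EFinM mulVf// mul1e H// => i Ai.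
by apply: mule_ge0; [rewrite lee_fin|exact: f0].
Qed.

Lemma esum_swap (R : realType) (I J : choiceType) (A : set I) (B : set J)
    (f : I -> J -> \bar R) : (forall i j, (0 <= f i j)%E) ->
  (\esum_(i in A) \esum_(j in B) f i j =
   \esum_(j in B) \esum_(i in A) f i j)%E.
Proof.
move=> f0; rewrite !esum_esum//.
apply: (@reindex_esum _ _ _ _ _ (fun k : J * I => (k.2, k.1))
  (fun k => f k.1 k.2)); split => /=.
- by move=> [j i] /= [].
- by move=> [j i] [j' i'] _ _ /= [-> ->].
- by move=> [i j] /= [Ai Bj]; exists (j, i).
Qed.

Lemma esum_ge1 (R : realType) (I : choiceType) (A : set I) (j : I)
    (f : I -> \bar R) : A j -> (forall i, (0 <= f i)%E) ->
  (f j <= \esum_(i in A) f i)%E.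
Proof.
move=> Aj f0; rewrite -[leLHS](@esum_set1 _ _ j f)//.
rewrite esum_mkcond [leRHS]esum_mkcond; apply: le_esum => i _.
case: ifPn => //; last by case: ifP.
by rewrite inE => ->; rewrite mem_set.
Qed.

(** Serves to compare sums over different index sets: periodic points with words, intervals of one
    map with those of another. *)
Lemma esum_inj_le (R : realType) (I J : choiceType) (A : set I) (B : set J)
    (phi : I -> J) (f : I -> \bar R) (g : J -> \bar R) :
  set_inj A phi -> (forall i, A i -> B (phi i)) ->
  (forall j, (0 <= g j)%E) -> (forall i, A i -> (f i <= g (phi i))%E) ->
  (\esum_(i in A) f i <= \esum_(j in B) g j)%E.
Proof.
move=> injphi AB g0 fg; apply: (le_trans (le_esum fg)).
rewrite -(@esum_image _ _ _ A phi g)// esum_mkcond [leRHS]esum_mkcond.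
apply: le_esum => j _; case: ifPn; last by case: ifP.
by rewrite inE => -[i Ai <-]; rewrite mem_set//; exact: AB.
Qed.

Definition words (n : nat) : set (seq nat) := [set w | size w = n].

Lemma esum_words_cat (R : realType) n m (f : seq nat -> \bar R) :
  (forall w, (0 <= f w)%E) ->
  (\esum_(w in words (n + m)) f w =
   \esum_(u in words n) \esum_(v in words m) f (u ++ v))%E.
Proof.
move=> f0; rewrite (@esum_esum _ _ _ _ _ (fun u v => f (u ++ v)))//.
apply: (@reindex_esum _ _ _ _ _ (fun k => k.1 ++ k.2) f); split => /=.
- by move=> [u v] /= [un vm]; rewrite /words/= size_cat un vm.
- move=> [u v] [u' v']; rewrite !inE /= => -[un vm] [un' vm'] /eqP.
  rewrite eqseq_cat; last by rewrite un un'.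
  by move=> /andP[/eqP -> /eqP ->].
- move=> w /= wnm; exists (take n w, drop n w); last by rewrite /= cat_take_drop.
  split; rewrite /words /= ?size_takel ?size_drop ?wnm ?leq_addr//.
  by rewrite addnC addnK.
Qed.

Lemma esum_words1 (R : realType) (f : seq nat -> \bar R) :
  (\esum_(w in words 1) f w = \esum_(i in [set: nat]) f [:: i])%E.
Proof.
apply: (@reindex_esum _ _ _ _ _ (fun i => [:: i]) f); split => //.
- by move=> i j _ _ [].
- by move=> [|i [|]]//= _; exists i.
Qed.

Lemma esum_words0 (R : realType) (f : seq nat -> \bar R) :
  (forall w, (0 <= f w)%E) -> (\esum_(w in words 0) f w = f [::])%E.
Proof.
move=> f0; rewrite (_ : words 0 = [set [::]]) ?esum_set1//.
by apply/seteqP; split => [w /= /size0nil|w ->].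
Qed.

Lemma esum_wordsS (R : realType) n (f : seq nat -> \bar R) :
  (forall w, (0 <= f w)%E) ->
  (\esum_(w in words n.+1) f w =
   \esum_(i in [set: nat]) \esum_(w in words n) f (i :: w))%E.
Proof.
by move=> f0; rewrite -add1n esum_words_cat//
  (@esum_words1 _ (fun u => \esum_(v in words n) f (u ++ v))%E).
Qed.

Lemma esum_wordsSr (R : realType) n (f : seq nat -> \bar R) :
  (forall w, (0 <= f w)%E) ->
  (\esum_(w in words n.+1) f w =
   \esum_(i in [set: nat]) \esum_(w in words n) f (rcons w i))%E.
Proof.
move=> f0; rewrite -addn1 esum_words_cat// esum_swap//.
rewrite (@esum_words1 _ (fun v => \esum_(u in words n) f (u ++ v))%E).
by apply: eq_esum => i _; apply: eq_esum => w _; rewrite cats1.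
Qed.

(** * Banach limits and Gibbs functions *)

Definition bounded_seq (R : realType) (a : nat -> R) :=
  exists M : R, forall n, `|a n| <= M.

Lemma bounded_seqD (R : realType) (a b : nat -> R) :
  bounded_seq a -> bounded_seq b -> bounded_seq (fun n => a n + b n).
Proof.
move=> [A HA] [B HB]; exists (A + B) => n.
by rewrite (le_trans (ler_normD _ _))// lerD.
Qed.

Record banach_limit (R : realType) (LIM : (nat -> R) -> R) : Prop := {
  banachD : forall a b, bounded_seq a -> bounded_seq b ->
    LIM (fun n => a n + b n) = LIM a + LIM b;
  banach_le : forall a b, bounded_seq a -> bounded_seq b ->
    (forall n, a n <= b n) -> LIM a <= LIM b;
  banach_cst : forall c, LIM (fun=> c) = c;
  banach_shift : forall a, bounded_seq a -> LIM (fun n => a n.+1) = LIM a }.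

(** The limit of the Cesaro averages along an ultrafilter refining [\oo]. The ultrafilter makes
    every bounded sequence converge; the averaging gives shift invariance, because a shift changes
    the [n]-th average by a bounded multiple of [harmonic n]. *)
Lemma banach_limit_exists (R : realType) :
  exists LIM : (nat -> R) -> R, banach_limit LIM.
Proof.
have [F [FU ooF]] := @ultraFilterLemma nat \oo _.
pose avg (a : nat -> R) n := (\sum_(i < n.+1) a i) / n.+1%:R.
have avg_bnd a (M : R) : (forall n, `|a n| <= M) -> forall n, `|avg a n| <= M.
  move=> aM n; rewrite /avg normrM normfV [X in _ / X]ger0_norm//.
  rewrite ler_pdivrMr ?ltr0n// (le_trans (ler_norm_sum _ _ _))//.
  apply: (@le_trans _ _ (\sum_(i < n.+1) M)); first by apply: ler_sum => i _.
  by rewrite sumr_const card_ord mulr_natr.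
have avg_cvg a : bounded_seq a -> exists l : R, avg a @ F --> l.
  move=> [M aM].
  have FM : F (avg a @^-1` `[- M, M]).
    by apply: filterS filterT => n _ /=; rewrite in_itv/= -ler_norml; exact: avg_bnd.
  (* By compactness there is a cluster point, and along an ultrafilter a cluster point is a
     limit. *)
  have [p [_ clp]] := @segment_compact R (- M) M (avg a @ F) _ FM.
  exists p => U pU; have [//|FU'] := in_ultra_setVsetC (avg a @^-1` U) FU.
  by have [x [/=]] := clp (~` U) U FU' pU.
exists (fun a => lim (avg a @ F)); split.
- move=> a b /avg_cvg[l al] /avg_cvg[l' bl'].
  rewrite (cvg_lim _ al)// (cvg_lim _ bl')//; apply/cvg_lim => //.
  rewrite (_ : avg _ = (fun n => avg a n + avg b n)); first exact: cvgD.
  by apply/funext => n; rewrite /avg big_split/= mulrDl.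
- move=> a b /avg_cvg[l al] /avg_cvg[l' bl'] ab.
  rewrite (cvg_lim _ al)// (cvg_lim _ bl')//.
  apply: (ler_cvg_to al bl'); apply: filterS filterT => n _.
  by rewrite /avg ler_wpM2r ?invr_ge0//; apply: ler_sum.
- move=> c; apply/cvg_lim => //.
  rewrite (_ : avg _ = fun=> c); first exact: cvg_cst.
  by apply/funext => n;
    rewrite /avg sumr_const card_ord -[c *+ _]mulr_natr mulfK// pnatr_eq0.
- move=> a ba; have [M aM] := ba.
  have [l al] := avg_cvg _ ba; rewrite (cvg_lim _ al)//; apply/cvg_lim => //.
  have -> : avg (fun n => a n.+1) =
      (fun n => avg a n + (a n.+1 - a 0%N) * harmonic n).
    apply/funext => n; rewrite /avg /= -mulrDl; congr (_ / _).
    rewrite big_ord_recr/= [in RHS]big_ord_recl/=.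
    by under [in RHS]eq_bigr do rewrite /bump/= add1n; lra.
  rewrite -[l]addr0; apply: cvgD => //.
  apply: (@cvg_trans _ ((fun n => (a n.+1 - a 0%N) * harmonic n) @ \oo)).
    by move=> U; exact: ooF.
  apply: (@squeeze_cvgr _ _ _ _ (fun n => - (2 * M) * harmonic n)
    (fun n => (2 * M) * harmonic n)).
  + near=> n; rewrite mulNr -ler_norml normrM [X in _ * X]ger0_norm ?harmonic_ge0//.
    rewrite ler_wpM2r ?harmonic_ge0// (le_trans (ler_normB _ _))//.
    by have := aM n.+1; have := aM 0%N; lra.
  + rewrite -[X in _ --> X](mulr0 (- (2 * M))); apply: cvgM; first exact: cvg_cst.
    exact: cvg_harmonic.
  + rewrite -[X in _ --> X](mulr0 (2 * M)); apply: cvgM; first exact: cvg_cst.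
    exact: cvg_harmonic.
Unshelve. all: by end_near. Qed.

Lemma banach_limit_range (R : realType) (LIM : (nat -> R) -> R) (a : nat -> R)
    (x y : R) : banach_limit LIM -> (forall n, x <= a n <= y) ->
  bounded_seq a /\ x <= LIM a <= y.
Proof.
move=> BL axy; have ba : bounded_seq a.
  exists (`|x| + `|y|) => n; have /andP[xa ay] := axy n.
  rewrite ler_norml; apply/andP; split.
    by have := ler_norm (- x); have := normr_ge0 y; rewrite normrN; lra.
  by have := ler_norm y; have := normr_ge0 x; lra.
split => //; rewrite -(banach_cst BL x) -(banach_cst BL y).
by apply/andP; split; apply: (banach_le BL) => // [|n];
  try (by exists `|x|); try (by exists `|y|); have /andP[] := axy n.
Qed.

Lemma banach_sum (R : realType) (LIM : (nat -> R) -> R) (I : Type)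
    (r : seq I) (f : nat -> I -> R) : banach_limit LIM ->
  (forall i, bounded_seq (f^~ i)) ->
  bounded_seq (fun n => \sum_(i <- r) f n i) /\
  LIM (fun n => \sum_(i <- r) f n i) = \sum_(i <- r) LIM (f^~ i).
Proof.
move=> BL bf; elim: r => [|i r [br IH]].
  under eq_fun do rewrite big_nil; split; first by exists 0 => n; rewrite normr0.
  by rewrite big_nil banach_cst.
under eq_fun do rewrite big_cons; split.
  have [[M1 H1] [M2 H2]] := (bf i, br).
  by exists (M1 + M2) => n; rewrite (le_trans (ler_normD _ _))// lerD.
by rewrite banachD// big_cons IH.
Qed.

(* Dominated convergence along a Banach limit. *)
Lemma banach_esum (R : realType) (LIM : (nat -> R) -> R) (I : choiceType)
    (f : nat -> I -> R) (M : I -> R) : banach_limit LIM ->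
  (forall n i, 0 <= f n i <= M i) ->
  (\esum_(i in [set: I]) (M i)%:E < +oo)%E ->
  (\esum_(i in [set: I]) (LIM (f^~ i))%:E =
   (LIM (fun n => fine (\esum_(i in [set: I]) (f n i)%:E)))%:E)%E.
Proof.
move=> BL fM sM.
have f0 n i : 0 <= f n i by have /andP[] := fM n i.
have fM' n i : f n i <= M i by have /andP[] := fM n i.
have M0 i : 0 <= M i by rewrite (le_trans (f0 0%N i)).
have bf i : bounded_seq (f^~ i).
  by exists (M i) => n; rewrite ger0_norm.
pose S n := (\esum_(i in [set: I]) (f n i)%:E)%E.
have S0 n : (0 <= S n)%E by apply: esum_ge0 => i _; rewrite lee_fin.
have SM n : (S n <= \esum_(i in [set: I]) (M i)%:E)%E.
  by apply: le_esum => i _; rewrite lee_fin.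
have Sfin n : S n \is a fin_num.
  by rewrite ge0_fin_numE// (le_lt_trans (SM n)).
have Mfin : (\esum_(i in [set: I]) (M i)%:E)%E \is a fin_num.
  by rewrite ge0_fin_numE// esum_ge0// => i _; rewrite lee_fin.
have [|bS _] := @banach_limit_range _ LIM (fun n => fine (S n)) 0
    (fine (\esum_(i in [set: I]) (M i)%:E)%E) BL.
  by move=> n; rewrite fine_ge0//= fine_le.
apply/eqP; rewrite eq_le; apply/andP; split.
  apply: ge_ereal_sup => _ [F [finF _] <-].
  rewrite fsbig_finite//= sumEFin lee_fin.
  have [bF <-] := @banach_sum _ LIM _ (finmap.enum_fset (fset_set F)) f BL bf.
  apply: (banach_le BL) => // n; rewrite -lee_fin (fineK (Sfin n)) -sumEFin.
  by apply: ereal_sup_ubound; exists F => //; rewrite fsbig_finite.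
apply/lee_addgt0Pr => e e0.
have : (\esum_(i in [set: I]) (M i)%:E - e%:E <
        \esum_(i in [set: I]) (M i)%:E)%E.
  by rewrite lteBlDr// lteDl// lte_fin.
move=> /ereal_sup_gt[_ [F [finF _] <-]].
rewrite lteBlDr// fsbig_finite//= sumEFin => MF.
(* The finite set [F] carries the sum of [M] up to [e], so outside [F] every [f n] contributes at
   most [e], uniformly in [n]. *)
have tail n : fine (S n) <= \sum_(i <- finmap.enum_fset (fset_set F)) f n i + e.
  have sumF (g : I -> R) : (forall i, 0 <= g i) -> (\esum_(i in [set: I] `&` F) (g i)%:E =
      (\sum_(i <- finmap.enum_fset (fset_set F)) g i)%:E)%E.
    move=> g0; rewrite setTI esum_fset//; first by rewrite fsbig_finite//= sumEFin.
    by move=> i _; rewrite lee_fin.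
  have := esumID F [set: I] (fun i => (f n i)%:E) (fun i _ => f0 n i).
  have := esumID F [set: I] (fun i => (M i)%:E) (fun i _ => M0 i).
  rewrite !sumF// -/(S n) => HM ->; move: MF; rewrite HM.
  rewrite -EFinD.
  have leC : (\esum_(i in [set: I] `&` ~` F) (f n i)%:E <=
       \esum_(i in [set: I] `&` ~` F) (M i)%:E)%E.
    by apply: le_esum => i _; rewrite lee_fin.
  have C0 : (0 <= \esum_(i in [set: I] `&` ~` F) (f n i)%:E)%E.
    by apply: esum_ge0 => i _; rewrite lee_fin.
  move: leC C0; move: (\esum_(i in _ `&` ~` F) (M i)%:E)%E => [m||];
    move: (\esum_(i in _ `&` ~` F) (f n i)%:E)%E => [k||]//=.
  by rewrite -!EFinD !lee_fin !lte_fin; lra.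
have [bF sF] := @banach_sum _ LIM _ (finmap.enum_fset (fset_set F)) f BL bf.
have be : bounded_seq (fun=> e) by exists `|e|.
apply: (@le_trans _ _ ((\sum_(i <- finmap.enum_fset (fset_set F)) LIM (f^~ i))%:E + e%:E)%E).
  rewrite -EFinD lee_fin -sF -(banach_cst BL e) -(banachD BL)//.
  by apply: (banach_le BL) => //; exact: (bounded_seqD bF be).
rewrite leeD2r//; apply: ereal_sup_ubound; exists F => //.
by rewrite fsbig_finite//= sumEFin.
Qed.

Definition word_sum (R : realType) (f : seq nat -> R) (n : nat) : \bar R :=
  (\esum_(w in words n) (f w)%:E)%E.

Lemma word_sum1E (R : realType) (f : seq nat -> R) :
  word_sum f 1 = (\esum_(i in [set: nat]) (f [:: i])%:E)%E.
Proof. exact: (esum_words1 (fun w => (f w)%:E)). Qed.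

(* The Gibbs function is obtained by averaging the weights of the extensions of
   a word first to the right and then to the left. *)
Lemma gibbs_function (R : realType) (L : seq nat -> R) (c : R) : 0 < c ->
  (forall w, 0 < L w) ->
  (forall u v, L (u ++ v) <= L u * L v) ->
  (forall u v, c * (L u * L v) <= L (u ++ v)) ->
  (forall n, 1 <= word_sum L n)%E ->
  (forall n, word_sum L n <= c^-1%:E)%E ->
  exists (nu : seq nat -> R) (b : R),
  [/\ 0 < b, nu [::] = 1,
      (forall w, (\esum_(i in [set: nat]) (nu (rcons w i))%:E = (nu w)%:E)%E),
      (forall w, (\esum_(i in [set: nat]) (nu (i :: w))%:E = (nu w)%:E)%E) &
      forall w, b * L w <= nu w <= b^-1 * L w].
Proof.
move=> c0 L0 Lsub Lsup Z1 Zc; have [LIM BL] := banach_limit_exists R.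
have ci0 : 0 < c^-1 by rewrite invr_gt0.
(* Common to both averages: [cat'] attaches [u] to [w] on the right or on the left. As the word sums
   of [L] lie between [1] and [c^-1], the total weight of the extensions of [w] is comparable to
   [L w]. *)
have avg (m : seq nat -> R) (e E : R) (cat' : seq nat -> seq nat -> seq nat) n w :
    0 < e -> 0 < E -> (forall u, 0 <= m (cat' w u)) ->
    (forall u, e * (L w * L u) <= m (cat' w u) <= E * (L w * L u)) ->
    (\esum_(u in words n) (m (cat' w u))%:E \is a fin_num)%E /\
    e * L w <= fine (\esum_(u in words n) (m (cat' w u))%:E)%E <= E * c^-1 * L w.
  move=> e0 E0 m0 mE; set S := (\esum_(u in _) _)%E.
  have S0 : (0 <= S)%E by apply: esum_ge0 => u _; rewrite lee_fin.
  have SE : (S <= (E * c^-1 * L w)%:E)%E.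
    apply: (@le_trans _ _ (\esum_(u in words n) ((E * L w)%:E * (L u)%:E))%E).
      apply: le_esum => u _; rewrite -EFinM lee_fin -mulrA.
      by have /andP[] := mE u.
    rewrite esumZl; last 2 first.
      by rewrite mulr_ge0// ltW.
      by move=> u _; rewrite lee_fin ltW.
    rewrite mulrAC [leRHS]EFinM lee_wpmul2l//; last exact: Zc.
    by rewrite lee_fin mulr_ge0// ltW.
  have Se : ((e * L w)%:E <= S)%E.
    apply: (@le_trans _ _ (\esum_(u in words n) ((e * L w)%:E * (L u)%:E))%E).
      rewrite esumZl; last 2 first.
        by rewrite mulr_ge0// ltW.
        by move=> u _; rewrite lee_fin ltW.
      rewrite -[leLHS]mule1 lee_wpmul2l//; last exact: Z1.
      by rewrite lee_fin mulr_ge0// ltW.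
    apply: le_esum => u _; rewrite -EFinM lee_fin -mulrA.
    by have /andP[] := mE u.
  have Sfin : S \is a fin_num by rewrite ge0_fin_numE// (le_lt_trans SE) ?ltry.
  by split => //; rewrite -!lee_fin fineK// Se SE.
(* Summability of the dominating families in the applications of [banach_esum] below. *)
have Lsum K w : (\esum_(i in [set: nat]) (K * L w * L [:: i])%:E < +oo)%E.
  have [K0|K0] := leP 0 K; last first.
    rewrite (@le_lt_trans _ _ 0%E) ?ltry//.
    apply: ge_ereal_sup => _ [F [finF _] <-].
    apply: fsume_le0 => i _.
    by rewrite lee_fin !mulr_le0_ge0 ?(ltW K0) ?(ltW (L0 _)).
  under eq_esum do rewrite EFinM.
  rewrite esumZl; last 2 first.
    by rewrite mulr_ge0// ltW.
    by move=> u _; rewrite lee_fin ltW.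
  rewrite -word_sum1E.
  apply: (@le_lt_trans _ _ ((K * L w)%:E * c^-1%:E)%E).
    by rewrite lee_wpmul2l// lee_fin mulr_ge0// ltW.
  by rewrite -EFinM ltry.
pose r n w := fine (\esum_(v in words n) (L (w ++ v))%:E)%E.
have rP n w : (\esum_(v in words n) (L (w ++ v))%:E \is a fin_num)%E /\
    c * L w <= r n w <= c^-1 * L w.
  rewrite -[c^-1]mul1r; apply: (avg L c 1 cat) => //.
    by move=> u; rewrite ltW.
  by move=> u; rewrite Lsup mul1r Lsub.
have r0 n w : 0 <= r n w.
  by apply: fine_ge0; apply: esum_ge0 => v _; rewrite lee_fin ltW.
pose m w := LIM (r^~ w).
have mP w : bounded_seq (r^~ w) /\ c * L w <= m w <= c^-1 * L w.
  by apply: (banach_limit_range BL) => n; have [] := rP n w.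
have m0 w : 0 <= m w.
  have [_ /andP[+ _]] := mP w; apply: le_trans.
  by rewrite mulr_ge0// ltW.
have msum w : (\esum_(i in [set: nat]) (m (rcons w i))%:E = (m w)%:E)%E.
  rewrite (@banach_esum _ LIM _ (fun n i => r n (rcons w i))
    (fun i => c^-1 * L w * L [:: i]))//; last first.
    move=> n i; rewrite r0/=; have [_ /andP[_ /le_trans]] := rP n (rcons w i).
    by apply; rewrite -mulrA ler_pM2l// -cats1.
  (* Summing over the next letter replaces [n] by [n.+1], which a Banach limit does not see. *)
  congr EFin; have [bw _] := mP w; rewrite /m -(banach_shift BL bw).
  congr LIM; apply/funext => n; rewrite /r; congr fine.
  rewrite esum_wordsS; last by move=> v; rewrite lee_fin ltW.
  apply: eq_esum => i _; rewrite fineK; last by have [] := rP n (rcons w i).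
  by apply: eq_esum => v _; rewrite cat_rcons.
pose l n w := fine (\esum_(u in words n) (m (u ++ w))%:E)%E.
have lP n w : (\esum_(u in words n) (m (u ++ w))%:E \is a fin_num)%E /\
    c * c * L w <= l n w <= c^-1 * c^-1 * L w.
  apply: (avg m (c * c) c^-1 (fun w u => u ++ w)) => //; first exact: mulr_gt0.
  move=> u; have [_ /andP[m1 m2]] := mP (u ++ w); apply/andP; split.
    by apply: le_trans m1; rewrite -mulrA ler_pM2l// [L w * _]mulrC.
  by apply: (le_trans m2); rewrite ler_pM2l// [L w * _]mulrC.
have l0 n w : 0 <= l n w.
  by apply: fine_ge0; apply: esum_ge0 => v _; rewrite lee_fin.
pose nu w := LIM (l^~ w).
have nuP w : bounded_seq (l^~ w) /\ c * c * L w <= nu w <= c^-1 * c^-1 * L w.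
  by apply: (banach_limit_range BL) => n; have [] := lP n w.
(* Attaching words on the left commutes with appending a letter, so the consistency of [m] survives
   the second average. *)
have nusum w : (\esum_(i in [set: nat]) (nu (rcons w i))%:E = (nu w)%:E)%E.
  rewrite (@banach_esum _ LIM _ (fun n i => l n (rcons w i))
    (fun i => c^-1 * c^-1 * L w * L [:: i]))//; last first.
    move=> n i; rewrite l0/=; have [_ /andP[_ /le_trans]] := lP n (rcons w i).
    by apply; rewrite -[leRHS]mulrA ler_pM2l ?mulr_gt0// -cats1.
  congr EFin; congr LIM; apply/funext => n; rewrite /l; congr fine.
  under eq_esum => i _ do (rewrite fineK; last by have [] := lP n (rcons w i)).
  rewrite esum_swap; last by move=> ? ?; rewrite lee_fin.
  apply: eq_esum => u _; rewrite -msum.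
  by apply: eq_esum => i _; rewrite -rcons_cat.
have nusum' w : (\esum_(i in [set: nat]) (nu (i :: w))%:E = (nu w)%:E)%E.
  rewrite (@banach_esum _ LIM _ (fun n i => l n (i :: w))
    (fun i => c^-1 * c^-1 * L w * L [:: i]))//; last first.
    move=> n i; rewrite l0/=; have [_ /andP[_ /le_trans]] := lP n (i :: w).
    apply; rewrite -[leRHS]mulrA ler_pM2l ?mulr_gt0// mulrC.
    exact: (Lsub [:: i] w).
  congr EFin; have [bw _] := nuP w; rewrite /nu -(banach_shift BL bw).
  congr LIM; apply/funext => n; rewrite /l; congr fine.
  rewrite esum_wordsSr; last by move=> v; rewrite lee_fin.
  apply: eq_esum => i _; rewrite fineK; last by have [] := lP n (i :: w).
  by apply: eq_esum => v _; rewrite cat_rcons.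
pose z := nu [::].
have z0 : 0 < z.
  have [_ /andP[+ _]] := nuP [::]; apply: lt_le_trans.
  by rewrite !mulr_gt0.
have scale (g : nat -> seq nat) w : (forall i, 0 <= nu (g i)) ->
    (\esum_(i in [set: nat]) (nu (g i))%:E = (nu w)%:E)%E ->
    (\esum_(i in [set: nat]) (nu (g i) / z)%:E = (nu w / z)%:E)%E.
  move=> g0 H; under eq_esum do rewrite mulrC EFinM.
  rewrite (@esumZl _ _ _ z^-1 (fun i => (nu (g i))%:E)) ?H; last 2 first.
    by rewrite invr_ge0 ltW.
    by move=> i _; rewrite lee_fin.
  by rewrite -EFinM mulrC.
have nu0 w : 0 <= nu w.
  have [_ /andP[+ _]] := nuP w; apply: le_trans.
  by rewrite !mulr_ge0// ltW.
(* The first entry serves the lower bound of [nu w / z], the second one the upper bound. *)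
pose b := Num.min (c * c / z) (c * c * z).
have cc0 : 0 < c * c by rewrite mulr_gt0.
have b0 : 0 < b by rewrite lt_min divr_gt0//= mulr_gt0.
exists (fun w => nu w / z), b; split => //.
- by rewrite divff// gt_eqF.
- by move=> w; exact: scale.
- by move=> w; exact: scale.
- move=> w; have [_ /andP[n1 n2]] := nuP w; apply/andP; split.
    rewrite ler_pdivlMr//; apply: le_trans n1; rewrite mulrAC.
    rewrite ler_pM2r// -ler_pdivlMr//.
    by rewrite ge_min lexx.
  rewrite ler_pdivrMr//; apply: (le_trans n2); rewrite [leRHS]mulrAC ler_pM2r//.
  rewrite -invfM -ler_pdivrMr// -invfM lef_pV2 ?posrE ?mulr_gt0//.
  by rewrite ge_min lexx orbT.
Qed.

(** * Measures on coded sets *)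

Definition cyl (w : seq nat) : set (nat -> nat) :=
  [set a | mkseq a (size w) = w].

Lemma cyl0 : cyl [::] = setT.
Proof. by apply/seteqP; split. Qed.

Lemma mkseqS_rcons (a : nat -> nat) n : mkseq a n.+1 = rcons (mkseq a n) (a n).
Proof. by rewrite /mkseq -addn1 iotaD map_cat/= cats1. Qed.

Lemma cyl_mkseq (a : nat -> nat) n : cyl (mkseq a n) a.
Proof. by rewrite /cyl/= size_mkseq. Qed.

Lemma cyl_rcons w i a : cyl (rcons w i) a <-> cyl w a /\ a (size w) = i.
Proof.
rewrite /cyl/= size_rcons mkseqS_rcons; split=> [/rcons_inj[-> ->]//|[-> ->]//].
Qed.

Lemma measurable_bigcup_words d (T : sigmaRingType d) (D : set (seq nat))
    (F : seq nat -> set T) :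
  (forall w, D w -> measurable (F w)) -> measurable (\bigcup_(w in D) F w).
Proof.
move=> mF; rewrite bigcup_mkcond; apply: countable_bigcupT_measurable => [|w].
  exact: countableP.
by case: ifPn => // /[!inE]; exact: mF.
Qed.

(** * Random words on the unit interval *)

Section unit_interval.
Context {R : realType}.

Let I01 : set (measurableTypeR R) := `[0%R, 1%R[%classic.

Let mI01 : measurable I01. Proof. exact: measurable_itv. Qed.

Definition lebesgue01 := mrestr (@lebesgue_measure R) mI01.

HB.instance Definition _ := Measure.on lebesgue01.

Let lebesgue01_setT : lebesgue01 setT = 1%E.
Proof.
rewrite /lebesgue01 /mrestr setTI /I01.
by rewrite lebesgue_measure_itv/= lte01 sube0.
Qed.

HB.instance Definition _ := Measure_isProbability.Build _ _ _
  lebesgue01 lebesgue01_setT.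

End unit_interval.

Lemma pushforward_unit_interval (R : realType)
    (phi : measurableTypeR R -> measurableTypeR R) : measurable_fun setT phi ->
  exists P : probability (measurableTypeR R) R,
    forall A, P A = lebesgue_measure (phi @^-1` A `&` `[0%R, 1%R[%classic).
Proof.
move=> mphi.
pose m := isMeasurableFun.Build _ _ _ _ _ mphi.
pose phi' : {mfun _ >-> _} := HB.pack phi m.
by exists (distribution (@lebesgue01 R) phi').
Qed.
Lemma esum_partition_point (R : realType) (a : nat -> R) (s y : R) :
  (forall j, 0 <= a j) -> (\esum_(j in [set: nat]) (a j)%:E = s%:E)%E ->
  0 <= y < s -> exists i, \sum_(j < i) a j <= y < \sum_(j < i.+1) a j.
Proof.
move=> a0 sE /andP[y0 ys].
have [n yn] : exists n, y < \sum_(j < n) a j.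
  apply/not_existsP => H; move: ys; apply/negP; rewrite -leNgt -lee_fin -sE.
  rewrite -nneseries_esumT; last by move=> n; rewrite lee_fin.
  apply: lime_le; first by apply: is_cvg_nneseries => n _ _; rewrite lee_fin.
  near=> n; rewrite sumEFin lee_fin big_mkord leNgt; exact/negP.
have ex : exists n, y < \sum_(j < n) a j by exists n.
have {n yn} [[|i] yi mini] := ex_minnP ex.
  by move: yi; rewrite big_ord0 ltNge y0.
exists i; rewrite yi andbT leNgt; apply/negP => /mini.
by rewrite ltnn.
Unshelve. all: by end_near. Qed.

Lemma esum_partial_le (R : realType) (a : nat -> R) (s : R) n :
  (forall j, 0 <= a j) -> (\esum_(j in [set: nat]) (a j)%:E = s%:E)%E ->
  \sum_(j < n) a j <= s.
Proof.
move=> a0 sE; rewrite -lee_fin -sE.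
rewrite -nneseries_esumT; last by move=> k; rewrite lee_fin.
rewrite -sumEFin -(big_mkord xpredT (fun j => (a j)%:E)).
by apply: nneseries_lim_ge => k _ _; rewrite lee_fin.
Qed.

(* A consistent function on words is realised by a random sequence on [0, 1[
   under the Lebesgue measure: the words of length n cut [0, 1[ into intervals,
   each of which is cut again by the words of length n + 1. *)
Section random_word.
Context {R : realType}.
Variable nu : seq nat -> R.
Hypothesis nu_ge0 : forall w, 0 <= nu w.
Hypothesis nu_nil : nu [::] = 1.
Hypothesis nu_sum : forall w,
  (\esum_(i in [set: nat]) (nu (rcons w i))%:E = (nu w)%:E)%E.

(** The offset of the interval of [p ++ w] inside that of [p]: at each level, the masses of the
    smaller siblings are skipped. The prefix [p] is carried along because [nu] needs the whole
    word. *)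
Fixpoint word_left (p w : seq nat) : R :=
  if w is i :: w' then \sum_(j < i) nu (rcons p j) + word_left (rcons p i) w'
  else 0.

Let left w := word_left [::] w.

Let left_rcons w i : left (rcons w i) = left w + \sum_(j < i) nu (rcons w j).
Proof.
suff gen p : word_left p (rcons w i) =
    word_left p w + \sum_(j < i) nu (rcons (p ++ w) j) by exact: gen.
elim: w p => [|k w IH] p /=; first by rewrite cats0 add0r addr0.
by rewrite IH addrA cat_rcons.
Qed.

(** Half-open, so that the intervals of the one-letter extensions tile it exactly; it is empty when
    [nu w] vanishes. *)
Definition word_itv w : set R := `[left w, left w + nu w[%classic.

Lemma word_itv_nil : word_itv [::] = `[0, 1[%classic.
Proof. by rewrite /word_itv /left/= nu_nil add0r. Qed.

Lemma word_itv_sub w i : word_itv (rcons w i) `<=` word_itv w.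
Proof.
move=> x; rewrite /word_itv/= !in_itv/= left_rcons => /andP[x1 x2].
have /= := esum_partial_le i (fun j => nu_ge0 (rcons w j)) (nu_sum w).
have := esum_partial_le i.+1 (fun j => nu_ge0 (rcons w j)) (nu_sum w).
rewrite big_ord_recr/= => h1 h2.
have : 0 <= \sum_(j < i) nu (rcons w j) by apply: sumr_ge0.
by move=> h3; apply/andP; split; lra.
Qed.

Lemma word_itv_ex w x : word_itv w x -> exists i, word_itv (rcons w i) x.
Proof.
rewrite /word_itv/= in_itv/= => /andP[x1 x2].
have [|i] := esum_partition_point (fun j => nu_ge0 (rcons w j)) (nu_sum w) (y := x - left w).
  by apply/andP; split; lra.
rewrite big_ord_recr/= => /andP[h1 h2]; exists i.
by rewrite in_itv/= left_rcons; apply/andP; split; lra.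
Qed.

Lemma word_itv_uniq w i j x :
  word_itv (rcons w i) x -> word_itv (rcons w j) x -> i = j.
Proof.
wlog ij : i j / (i < j)%N => [H xi xj|].
  by have [ij|ij|//] := ltngtP i j; [exact: H|apply/esym; exact: H].
rewrite /word_itv/= !in_itv/= !left_rcons => /andP[_ x1] /andP[x2 _].
have : \sum_(k < i) nu (rcons w k) + nu (rcons w i) <= \sum_(k < j) nu (rcons w k).
  rewrite -(big_mkord xpredT (fun k => nu (rcons w k))).
  rewrite -(big_mkord xpredT (fun k => nu (rcons w k))).
  rewrite -big_nat_recr//= (big_cat_nat (n := i.+1) (p := j))//=.
  by rewrite lerDl; apply: sumr_ge0.
by move=> ?; exfalso; lra.
Qed.

(** Along the prefixes of [x] the default digit is only used outside [[0, 1[]: inside, each prefix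
    interval contains [x] and hence has a child containing [x]. *)
Let digit w x := xget 0%N [set i | word_itv (rcons w i) x].

Let prefix (x : R) := fix prefix n :=
  if n is n'.+1 then rcons (prefix n') (digit (prefix n') x) else [::].

Definition random_word (x : R) : nat -> nat := fun n => digit (prefix x n) x.

Let mkseq_random_word x n : mkseq (random_word x) n = prefix x n.
Proof. by elim: n => // n IH; rewrite mkseqS_rcons IH. Qed.

Lemma word_itvP w x : `[0, 1[%classic x ->
  word_itv w x <-> cyl w (random_word x).
Proof.
rewrite -word_itv_nil => x01; have pre n : word_itv (prefix x n) x.
  elim: n => //= n /word_itv_ex ex.
  exact: (@xgetPex _ 0%N [set i | word_itv (rcons (prefix x n) i) x]).
split.
  elim/last_ind: w => [|w i IH] wx; first by rewrite cyl0.
  apply/cyl_rcons; have cw := IH (word_itv_sub wx); split => //.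
  apply: (@word_itv_uniq w _ _ x) => //.
  move: cw; rewrite /cyl/= mkseq_random_word => cw.
  by have := pre (size w).+1; rewrite /= /random_word cw.
by rewrite /cyl/= mkseq_random_word => <-.
Qed.

Lemma lebesgue_word_itv w : lebesgue_measure (word_itv w) = (nu w)%:E.
Proof.
rewrite /word_itv lebesgue_measure_itv/= lte_fin ltrDl.
have [n0|n0] := ltP 0 (nu w); first by rewrite -EFinD addrAC subrr add0r.
by congr EFin; apply/eqP; rewrite eq_le nu_ge0 n0.
Qed.

Lemma word_itv_sub01 w : word_itv w `<=` `[0, 1[%classic.
Proof.
rewrite -word_itv_nil; elim/last_ind: w => // w i IH.
exact: subset_trans (@word_itv_sub w i) IH.
Qed.

End random_word.

Definition cyl_union (R : realType) (pi : (nat -> nat) -> R)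
    (D : set (seq nat)) : set (measurableTypeR R) :=
  \bigcup_(w in D) (pi @` cyl w).

(** [P] is the image of Lebesgue measure under [pi \o random_word nu]. The approximation by
    cylinders comes from outer regularity on [[0, 1[]: the word intervals contained in an open set
    cover its part in [[0, 1[], since their lengths tend to 0 uniformly. *)
Lemma coded_probability (R : realType) (pi : (nat -> nat) -> R)
    (nu : seq nat -> R) : injective pi ->
  (forall a (e : R), 0 < e -> exists n, forall b,
    cyl (mkseq a n) b -> `|pi a - pi b| < e) ->
  (forall w, measurable (pi @` cyl w : set (measurableTypeR R))) ->
  (forall w, 0 <= nu w) -> nu [::] = 1 ->
  (forall w, (\esum_(i in [set: nat]) (nu (rcons w i))%:E = (nu w)%:E)%E) ->
  (forall e : R, 0 < e -> exists n, forall w, size w = n -> nu w < e) ->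
  exists P : probability (measurableTypeR R) R,
    (forall w, P (pi @` cyl w) = (nu w)%:E) /\
    (forall A (e : R), measurable A -> 0 < e -> exists D,
      P (A `\` cyl_union pi D) = 0%E /\ (P (cyl_union pi D `\` A) < e%:E)%E).
Proof.
move=> pi_inj pi_cont mpi nu_ge0 nu_nil nu_sum nu_small.
pose J w := word_itv nu w; pose X := random_word nu.
have JP w x : `[0, 1[%classic x -> J w x <-> cyl w (X x).
  exact: word_itvP.
have J01 w : J w `<=` `[0, 1[%classic by exact: word_itv_sub01.
pose phi (x : measurableTypeR R) : measurableTypeR R :=
  if x \in `[0, 1[%R then pi (X x) else pi (fun=> 0%N).
have phiE x : `[0, 1[%classic x -> phi x = pi (X x) by rewrite /phi/= => ->.
have phiN x : ~ `[0, 1[%classic x -> phi x = pi (fun=> 0%N).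
  by rewrite /phi/= => /negP/negbTE ->.
have mJ w : measurable (J w : set (measurableTypeR R)) by exact: measurable_itv.
have mphi : measurable_fun setT phi.
  apply: (measurability _ (measurable_realfun.RGenOpens.measurableE R)).
  move=> _ [_ [a [b ->] <-]]; rewrite setTI.
  set U : set R := `]a, b[%classic.
  (* On [[0, 1[] the continuity of the coding makes the preimage a union of word intervals;
     elsewhere [phi] is constant. *)
  rewrite (_ : _ @^-1` _ =
    (if `[< U (pi (fun=> 0%N)) >] then ~` `[0, 1[%classic else set0) `|`
    \bigcup_(w in [set w | pi @` cyl w `<=` U]) J w).
    apply: measurableU.
      by case: ifP => // _; apply: measurableC; exact: measurable_itv.
    exact: measurable_bigcup_words.
  apply/seteqP; split=> x.
    have [x01|x01] := pselect (`[0, 1[%classic x); last first.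
      rewrite /preimage/= phiN// => Ux; left.
      by case: asboolP.
    rewrite /preimage/= phiE// => Ux; right.
    have : nbhs (pi (X x)) U by apply: open_nbhs_nbhs; split => //; exact: interval_open.
    rewrite -nbhs_ballE => -[e /= e0 eU].
    have [n Hn] := pi_cont (X x) e e0.
    exists (mkseq (X x) n); last by apply/JP => //; exact: cyl_mkseq.
    by move=> _ [c cn <-]; apply: eU; exact: Hn.
  move=> [|[w /= wU Jx]].
    case: asboolP => // U0 x01.
    by rewrite /preimage/= phiN.
  have x01 := J01 _ _ Jx.
  rewrite /preimage/= phiE//; apply: wU; exists (X x) => //.
  exact/JP.
have [P PE] := pushforward_unit_interval mphi.
have phiJ w x : `[0, 1[%classic x -> (pi @` cyl w) (phi x) <-> J w x.
  move=> x01; rewrite phiE// JP//; split => [[c cw /pi_inj <-]//|cw].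
  by exists (X x).
exists P; split.
  move=> w; rewrite PE -(lebesgue_word_itv nu_ge0 w).
  congr lebesgue_measure; apply/seteqP; split => [x [h x01]|x Jx].
    exact/phiJ.
  by have x01 := J01 _ _ Jx; split => //; exact/phiJ.
move=> A e mA e0.
pose B := (phi @^-1` A `&` `[0, 1[%classic).
have mB : measurable B.
  apply: measurableI; last exact: measurable_itv.
  by rewrite -[X in measurable X]setTI; exact: mphi.
have Bfin : (lebesgue_measure B < +oo)%E.
  by rewrite /B -PE (le_lt_trans (probability_le1 P mA)) ?ltry.
have [V [oV BV VB]] := lebesgue_regularity_outer mB Bfin e0.
exists [set w | J w `<=` V]; split.
  rewrite PE (_ : _ `&` _ = set0) ?measure0//.
  apply/seteqP; split => // x [[Ax nU] x01]; apply: nU.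
  have Vx : V x by apply: BV.
  have : nbhs x V by apply: open_nbhs_nbhs.
  rewrite -nbhs_ballE => -[r /= r0 rV].
  have [n Hn] := nu_small r r0.
  pose w := mkseq (X x) n.
  have Jx : J w x by apply/JP => //; exact: cyl_mkseq.
  exists w; last exact/phiJ.
  move=> y Jy; apply: rV; have := Hn w (size_mkseq _ _).
  move: Jx Jy; rewrite /J /word_itv/= !in_itv/= => /andP[h1 h2] /andP[h3 h4] h5.
  by rewrite /ball/= ltr_norml; apply/andP; split; lra.
rewrite PE; apply: le_lt_trans VB; apply: le_measure; rewrite ?inE.
- apply: measurableI; last exact: measurable_itv.
  rewrite -[X in measurable X]setTI; apply: mphi => //.
  apply: measurableD => //; exact: measurable_bigcup_words.
- by apply: measurableD => //; exact: open_measurable.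
- move=> x [[[w wV wx] nA] x01]; split; last by move=> [].
  by apply: wV; apply/phiJ.
Qed.

Lemma measure_bigcup_words d (T : measurableType d) (R : realType)
    (mu : {measure set T -> \bar R}) (D : set (seq nat))
    (F : seq nat -> set T) :
  (forall w, D w -> measurable (F w)) -> trivIset D F ->
  mu (\bigcup_(w in D) F w) = (\esum_(w in D) mu (F w))%E.
Proof.
move=> mF tF; pose G n := F (odflt [::] (unpickle n)).
have GE w : G (pickle w) = F w by rewrite /G pickleK.
have -> : \bigcup_(w in D) F w = \bigcup_(n in pickle @` D) G n.
  by rewrite bigcup_image; apply: eq_bigcupr => w _; rewrite GE.
rewrite measure_bigcup; first last.
- move=> _ _ [u Du <-] [v Dv <-]; rewrite !GE => /tF uv.
  by rewrite uv.
- by move=> _ [w Dw <-]; rewrite GE; exact: mF.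
rewrite nneseries_esum//.
rewrite set_mem_set (@esum_image _ _ _ D pickle (fun n => mu (G n))).
  by apply: eq_esum => w _; rewrite GE.
by move=> u v _ _; exact: (pcan_inj pickleK).
Qed.

Lemma cyl_cat u v a : cyl (u ++ v) a <->
  cyl u a /\ cyl v (fun n => a (size u + n)%N).
Proof.
rewrite /cyl/= size_cat /mkseq iotaD map_cat add0n -{2}[size u]addn0 iotaDl -map_comp.
split => [/eqP|[-> ->]//].
by rewrite eqseq_cat ?size_map ?size_iota// => /andP[/eqP ? /eqP ?]; split.
Qed.

Lemma cyl_prefix u v a : cyl u a -> cyl v a -> (size u <= size v)%N ->
  u = take (size u) v.
Proof.
rewrite /cyl/= => ua va suv.
by rewrite -va /mkseq -map_take take_iota (minn_idPl suv) -[LHS]ua.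
Qed.

(** Prefix-free sets: distinct members have disjoint cylinders, so the measure of the union is a sum
    over words. *)
Definition antichain (D : set (seq nat)) :=
  forall u v, D u -> D v -> prefix u v -> u = v.

Lemma trivIset_cyl (R : realType) (pi : (nat -> nat) -> R) D :
  injective pi -> antichain D -> trivIset D (fun w => pi @` cyl w).
Proof.
move=> pi_inj acD u v Du Dv [_ [[a ua <-] [b vb /pi_inj ab]]].
move: ua; rewrite -ab => ub; wlog suv : u v Du Dv vb ub / (size u <= size v)%N.
  move=> H; have [/H|/ltnW /H] := leqP (size u) (size v); first exact.
  by move=> vu; apply/esym; exact: vu.
by apply: acD => //; rewrite prefixE -(cyl_prefix ub vb suv).
Qed.

Lemma cyl_sub u v : prefix u v -> cyl v `<=` cyl u.
Proof.
move=> /prefixP[s ->] a /cyl_cat[]//.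
Qed.

(** Keep the minimal words: a point of the union lies in the cylinder of a shortest word of [D], and
    that word is minimal. *)
Lemma cyl_union_antichain (R : realType) (pi : (nat -> nat) -> R) D :
  exists2 D', antichain D' & D' `<=` D /\ cyl_union pi D' = cyl_union pi D.
Proof.
exists [set w | D w /\ forall u, D u -> prefix u w -> u = w].
  by move=> u v [Du _] [_ H] /(H _ Du).
split; first by move=> w [].
apply/seteqP; split => [x [w [Dw _] xw]|_ [w Dw [a aw <-]]]; first by exists w.
have ex : exists n, `[< exists2 u, D u /\ cyl u a & size u = n >].
  by exists (size w); apply/asboolP; exists w.
have [n /asboolP[u [Du ua] su] min] := ex_minnP ex.
exists u; last by exists a.
split => // v Dv vu; have va := cyl_sub vu ua.
have sle : (size u <= size v)%N.
  by rewrite su; apply: min; apply/asboolP; exists v.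
have svu : (size v <= size u)%N by move/prefixP: vu => [s ->]; rewrite size_cat leq_addr.
rewrite [LHS](cyl_prefix va ua svu) take_oversize//.
Qed.

Lemma measure_cyl_union (R : realType) (pi : (nat -> nat) -> R)
    (mu : {measure set (measurableTypeR R) -> \bar R}) D :
  injective pi ->
  (forall w, measurable (pi @` cyl w : set (measurableTypeR R))) ->
  antichain D -> mu (cyl_union pi D) = (\esum_(w in D) mu (pi @` cyl w))%E.
Proof.
move=> pi_inj mpi acD; apply: measure_bigcup_words => //.
exact: trivIset_cyl.
Qed.

(** Images of cylinders only see the range of [pi], so the generating class is that of the bounded
    open intervals. The trace of such an interval on the range is a union of cylinders, which may be
    taken disjoint. *)
Lemma cyl_measure_unique (R : realType) (pi : (nat -> nat) -> R)
    (m1 m2 : {measure set (measurableTypeR R) -> \bar R}) :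
  injective pi ->
  (forall a (e : R), 0 < e -> exists n, forall b,
    cyl (mkseq a n) b -> `|pi a - pi b| < e) ->
  (forall w, measurable (pi @` cyl w : set (measurableTypeR R))) ->
  (m1 setT < +oo)%E ->
  m1 (~` range pi) = 0%E -> m2 (~` range pi) = 0%E ->
  (forall w, m1 (pi @` cyl w) = m2 (pi @` cyl w)) ->
  forall A, measurable A -> m1 A = m2 A.
Proof.
move=> pi_inj pi_cont mpi m1T m1r m2r m12 A mA.
have mr : measurable (range pi : set (measurableTypeR R)).
  by have := mpi [::]; rewrite cyl0.
pose g n : set (measurableTypeR R) := `](- n%:R)%R, n%:R[%classic.
apply: (@measure_unique _ R (measurableTypeR R) (@measurable_realfun.RGenOpens.G R) g _ _ _ _ m1 m2) => //.
- exact: measurable_realfun.RGenOpens.measurableE.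
- move=> _ _ [a [b ->]] [c [d ->]].
  exists (Num.max a c), (Num.min b d).
  apply/seteqP; split => x /=; rewrite !in_itv/= gt_max lt_min.
    by move=> [/andP[-> ->] /andP[-> ->]].
  by move=> /andP[/andP[-> ->] /andP[-> ->]].
- by move=> n; exists (- n%:R), n%:R.
- apply/seteqP; split => // x _; exists (Num.bound `|x|) => //.
  rewrite /g/= in_itv/= -ltr_norml.
  exact: archi_boundP.
- move=> _ [a [b ->]]; set U : set (measurableTypeR R) := `]a, b[%classic.
  have mU : measurable U by exact: measurable_itv.
  have UE (m : {measure set (measurableTypeR R) -> \bar R}) :
      m (~` range pi) = 0%E -> m U = m (U `&` range pi).
    move=> mr0; rewrite (measureDI m mU mr) [X in (X + _)%E](_ : _ = 0%E) ?add0e//.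
    apply/eqP; rewrite eq_le measure_ge0 andbT -mr0.
    apply: le_measure; rewrite ?inE; [exact: measurableD|exact: measurableC|].
    by move=> x [].
  rewrite (UE m1)// (UE m2)//.
  have -> : U `&` range pi = cyl_union pi [set w | pi @` cyl w `<=` U].
    apply/seteqP; split => [x [+ [c _ cx]]|x [w wU xw]]; last first.
      by split; [exact: wU|case: xw => c _ <-; exists c].
    rewrite -cx => Ux; have : nbhs (pi c : R) U by apply: open_nbhs_nbhs; split => //; exact: interval_open.
    rewrite -nbhs_ballE => -[e /= e0 eU].
    have [n Hn] := pi_cont c e e0.
    exists (mkseq c n); last by exists c => //; exact: cyl_mkseq.
    by move=> _ [c' cn <-]; apply: eU; exact: Hn.
  have [D' acD' [_ <-]] := cyl_union_antichain pi [set w | pi @` cyl w `<=` U].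
  by rewrite !measure_cyl_union//; apply: eq_esum.
- move=> n; apply: le_lt_trans m1T; apply: le_measure; rewrite ?inE//.
  exact: measurable_itv.
Qed.

(** * Invariance and ergodicity *)

Section shift_invariance.
Context {R : realType}.
Variables (pi : (nat -> nat) -> R) (nu : seq nat -> R).
Variable P : probability (measurableTypeR R) R.
Variables (S : set (measurableTypeR R)).
Variable f : measurableTypeR R -> measurableTypeR R.
Hypothesis pi_inj : injective pi.
Hypothesis pi_cont : forall a (e : R), 0 < e -> exists n, forall b,
    cyl (mkseq a n) b -> `|pi a - pi b| < e.
Hypothesis mpi : forall w, measurable (pi @` cyl w : set (measurableTypeR R)).
Hypothesis nu_ge0 : forall w, 0 <= nu w.
Hypothesis nu_nil : nu [::] = 1.
Hypothesis nu_suml : forall w,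
  (\esum_(i in [set: nat]) (nu (i :: w))%:E = (nu w)%:E)%E.
Hypothesis PE : forall w, P (pi @` cyl w) = (nu w)%:E.
Hypothesis P_approx : forall A (e : R), measurable A -> 0 < e -> exists D,
      P (A `\` cyl_union pi D) = 0%E /\ (P (cyl_union pi D `\` A) < e%:E)%E.
Hypothesis mS : measurable S.
Hypothesis mf : measurable_fun S f.
Hypothesis piS : range pi `<=` S.
Hypothesis fpi : forall a, f (pi a) = pi (fun n => a n.+1).

Let mr : measurable (range pi : set (measurableTypeR R)).
Proof. by have := mpi [::]; rewrite cyl0. Qed.

Let mU D : measurable (cyl_union pi D).
Proof. exact: measurable_bigcup_words. Qed.

Let P_DI A B : measurable A -> measurable B ->
  P A = (P (A `\` B) + P (A `&` B))%E.
Proof. exact: measureDI. Qed.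

Let P_le A B : measurable A -> measurable B -> A `<=` B -> (P A <= P B)%E.
Proof. by move=> mA mB; apply: le_measure; rewrite inE. Qed.

Let P_union D : antichain D -> P (cyl_union pi D) = (\esum_(w in D) (nu w)%:E)%E.
Proof.
move=> acD; apply: etrans (measure_cyl_union P _ _ acD) _ => //.
by apply: eq_esum => w _; exact: PE.
Qed.

Let P_unionI D A : antichain D -> measurable A ->
  P (cyl_union pi D `&` A) = (\esum_(w in D) P (pi @` cyl w `&` A))%E.
Proof.
move=> acD mA; rewrite /cyl_union setI_bigcupl; apply: measure_bigcup_words.
- by move=> w _; exact: measurableI.
- exact/trivIset_setIr/trivIset_cyl.
Qed.

Lemma prob_range : P (range pi) = 1%E.
Proof. by rewrite -cyl0 PE nu_nil. Qed.

Lemma prob_range_setC : P (~` range pi) = 0%E.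
Proof. by rewrite probability_setC// prob_range subee. Qed.

Let P_null (A : set (measurableTypeR R)) : measurable A -> A `<=` ~` range pi -> P A = 0%E.
Proof.
move=> mA Ar; apply/eqP; rewrite eq_le measure_ge0 andbT -prob_range_setC.
by apply: le_measure; rewrite ?inE//; exact: measurableC.
Qed.

Let P_range (A : set (measurableTypeR R)) : measurable A ->
  P A = P (A `&` range pi).
Proof.
move=> mA; rewrite {1}(measureDI P mA mr) [X in (X + _)%E](_ : _ = 0%E) ?add0e//.
by apply: P_null; [exact: measurableD|move=> x []].
Qed.

(** The complement of the range is null, so only the coded points count. *)
Let P_eq (A B : set (measurableTypeR R)) : measurable A -> measurable B ->
  (forall a, A (pi a) <-> B (pi a)) -> P A = P B.
Proof.
move=> mA mB AB.
rewrite (P_range mA) (P_range mB).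
congr (P _); apply/seteqP; split => x [+ [a _ ax]]; rewrite -ax => /AB ?;
  by split => //; exists a.
Qed.

Lemma prob_domain : P S = 1%E.
Proof.
rewrite -prob_range; apply: P_eq => // a.
by split => _; [exists a|apply: piS; exists a].
Qed.

Let preim (A : set (measurableTypeR R)) := S `&` f @^-1` A.

Let mpreim A : measurable A -> measurable (preim A).
Proof. by move=> mA; exact: mf. Qed.

(** By [cyl_measure_unique], it is enough to compare [P] with its image under [f] on cylinders,
    where the equality is [nu_suml]. *)
Lemma prob_invariant A : measurable A -> P (S `&` f @^-1` A) = P A.
Proof.
move=> mA.
(* [f] is only known to be measurable on [S]; extended by a constant it has an image measure, and
   the complement of [S] is null. *)
pose g : measurableTypeR R -> measurableTypeR R := f \_ S.
have mg : measurable_fun setT g by apply/(measurable_restrictT f mS).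
pose m := isMeasurableFun.Build _ _ _ _ _ mg.
pose g' : {mfun _ >-> _} := HB.pack g m.
pose Q := distribution P g'.
have QE B : measurable B -> Q B = P (preim B).
  move=> mB; apply: P_eq; first by rewrite -[X in measurable X]setTI; exact: (mg measurableT).
    exact: mpreim.
  move=> a; have Sa : S (pi a) by apply: piS; exists a.
  by rewrite /preim/= /g /patch mem_set//; split => [|[]].
rewrite -/(preim A) -QE//; apply/esym.
apply: (@cyl_measure_unique _ pi P Q) => //.
- by rewrite (le_lt_trans (probability_le1 P _)) ?ltry.
- exact: prob_range_setC.
- apply: etrans (QE _ (measurableC mr)) _.
  apply: P_null; first by apply: mpreim; exact: measurableC.
  by move=> x [_ nx] [a _ ax]; apply: nx; rewrite -ax fpi; eexists.
- move=> w; apply: etrans (PE w) (etrans _ (esym (QE _ (mpi w)))).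
  rewrite -nu_suml; apply/esym.
  (* At coded points, the preimage of the cylinder of [w] is the disjoint union of the cylinders of
     the words [i :: w]. *)
  transitivity (P (cyl_union pi [set v | exists i, v = i :: w])); last first.
    rewrite measure_cyl_union//; last first.
      move=> _ _ [i ->] [j ->] /prefixP[s] [-> /(congr1 size)].
      rewrite size_cat => /eqP; rewrite -{1}[size w]addn0 eqn_add2l eq_sym.
      by rewrite size_eq0 => _.
    transitivity (\esum_(v in [set v | exists i, v = i :: w]) (nu v)%:E)%E.
      by apply: eq_esum => v _; exact: PE.
    apply: (@reindex_esum _ _ _ _ _ (fun i => i :: w)
         (fun v => (nu v)%:E)); split => //=.
    - by move=> i _; exists i.
    - by move=> i j _ _ [].
    - by move=> _ [i ->]; exists i.
  apply: P_eq => //; first exact: mpreim.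
  move=> a; split; last first.
    move=> [_ [i ->] [b bw /pi_inj <-]].
    split; first by apply: piS; exists b.
    rewrite /= fpi; eexists; last reflexivity.
    by have /cyl_cat[] : cyl ([:: i] ++ w) b by [].
  move=> [_ /=]; rewrite fpi => -[b bw /pi_inj ba].
  exists (a 0%N :: w); first by exists (a 0%N).
  exists a => //; apply/(@cyl_cat [:: a 0%N] w); split => //.
  by rewrite -/(cyl w _) -ba.
Qed.

Let iterpre n A := iter n preim A.

Let miterpre n A : measurable A -> measurable (iterpre n A).
Proof. by move=> mA; elim: n => //= n; exact: mpreim. Qed.

Let P_iterpre n A : measurable A -> P (iterpre n A) = P A.
Proof.
move=> mA; elim: n => //= n <-; exact: prob_invariant (miterpre n mA).
Qed.

Let iterpre_pi n A a : iterpre n A (pi a) <-> A (pi (fun k => a (n + k)%N)).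
Proof.
elim: n a => [|n IH] a //=; rewrite /preim/= fpi IH; split => [[]//|].
by split => //; apply: piS; exists a.
Qed.

Variable c : R.
Hypothesis c_gt0 : 0 < c.
Hypothesis nu_quasi : forall u v, c * (nu u * nu v) <= nu (u ++ v).

(** Approximate [A] from outside by a union [U] of disjoint cylinders. Prefixing their words with
    [u] multiplies the mass by at least [c * nu u]. The points gained outside [A] are mapped by the
    [size u]-th iterate into the difference of [U] and [A], which has mass below [e]. *)
Let P_cyl_invariant A u : measurable A ->
  (forall a, A (pi a) <-> A (pi (fun n => a n.+1))) ->
  ((c * nu u)%:E * P A <= P (pi @` cyl u `&` A))%E.
Proof.
move=> mA Ainv; apply/lee_addgt0Pr => e e0.
have [D0 [AU UA]] := P_approx mA e0.
have [D acD [_ UD]] := cyl_union_antichain pi D0.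
rewrite -{D0}UD in AU UA; set U := cyl_union pi D in AU UA.
have PAU : (P A <= P U)%E.
  rewrite (P_DI mA (mU D)) AU add0e.
  by apply: P_le; [exact: measurableI|exact: mU|exact: subIsetr].
pose D' := [set w | exists2 v, D v & w = u ++ v].
have acD' : antichain D'.
  move=> _ _ [v Dv ->] [v' Dv' ->]; rewrite prefix_catr// eqxx.
  by move=> vv'; rewrite (acD v v' Dv Dv' vv').
have PU' : ((c * nu u)%:E * P U <= P (cyl_union pi D'))%E.
  rewrite !P_union// -esumZl; last 2 first.
  - by rewrite mulr_ge0// ltW.
  - by move=> w _; rewrite lee_fin.
  rewrite [leRHS](_ : _ = \esum_(v in D) (nu (u ++ v))%:E)%E; last first.
    apply: (@reindex_esum _ _ _ _ _ (fun v => u ++ v)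
       (fun w => (nu w)%:E)); split => //=.
    - by move=> v Dv; exists v.
    - by move=> v v' _ _ /eqP; rewrite eqseq_cat// eqxx => /eqP.
    - by move=> _ [v Dv ->]; exists v.
  by apply: le_esum => v _; rewrite -EFinM lee_fin -mulrA.
have incl : cyl_union pi D' `<=`
    (pi @` cyl u `&` A) `|` iterpre (size u) (U `\` A).
  move=> _ [_ [v Dv ->] [a /cyl_cat[au av] <-]].
  have [Aa|nAa] := pselect (A (pi a)); first by left; split => //; exists a.
  right; apply/iterpre_pi; split; first by exists v => //; eexists.
  suff H n b : A (pi (fun k => b (n + k)%N)) -> A (pi b) by move=> /H.
  by elim: n b => // n IH b h; apply/Ainv; apply: IH.
apply: (@le_trans _ _ ((c * nu u)%:E * P U)%E).
  by rewrite lee_wpmul2l// lee_fin mulr_ge0// ltW.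
apply: (le_trans PU').
have mUA : measurable (iterpre (size u) (U `\` A)).
  by apply: miterpre; apply: measurableD => //; exact: mU.
have muA : measurable (pi @` cyl u `&` A).
  by apply: measurableI => //; exact: mpi.
apply: (@le_trans _ _ (P ((pi @` cyl u `&` A) `|` iterpre (size u) (U `\` A)))).
  by apply: P_le => //; exact: measurableU.
apply: le_trans (measureU2 P muA mUA) _.
have Piter : P (iterpre (size u) (U `\` A)) = P (U `\` A).
  by apply: P_iterpre; apply: measurableD => //; exact: mU.
by apply: leeD2l; rewrite [leLHS]Piter ltW.
Qed.

(** Cover the complement of [A] by a union [U] of disjoint cylinders with little excess. By
    [P_cyl_invariant], [A] occupies at least the fraction [c * p] of each of them, but [U] meets [A]
    in mass below [e]; hence [c * p * (1 - p) <= 0]. *)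
Lemma prob_ergodic A : measurable A -> S `&` f @^-1` A = A ->
  P A = 0%E \/ P A = 1%E.
Proof.
move=> mA Ainv0.
have Ainv a : A (pi a) <-> A (pi (fun n => a n.+1)).
  rewrite -{1}Ainv0 /= fpi; split => [[]//|?]; split => //.
  by apply: piS; exists a.
have [p pE] : exists p : R, P A = p%:E.
  by exists (fine (P A)); rewrite fineK// fin_num_measure.
have p0 : 0 <= p by rewrite -lee_fin -pE measure_ge0.
have p1 : p <= 1 by rewrite -lee_fin -pE probability_le1.
have : c * p * (1 - p) <= 0.
  apply/ler_addgt0Pr => e e0; rewrite add0r.
  have [D0 [AU UA]] := P_approx (measurableC mA) e0.
  have [D acD [_ UD]] := cyl_union_antichain pi D0.
  rewrite -{D0}UD in AU UA; set U := cyl_union pi D in AU UA.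
  have PAU : ((1 - p)%:E <= P U)%E.
    rewrite EFinB -pE -probability_setC// (P_DI (measurableC mA) (mU D)).
    rewrite AU add0e.
    apply: P_le; [|exact: mU|exact: subIsetr].
    by apply: measurableI; [exact: measurableC|exact: mU].
  rewrite -lee_fin; apply: (@le_trans _ _ ((c * p)%:E * P U)%E).
    by rewrite EFinM lee_wpmul2l// lee_fin mulr_ge0// ltW.
  apply: ltW; apply: le_lt_trans UA.
  rewrite setDE setCK P_union// P_unionI// -esumZl; last 2 first.
  - by rewrite mulr_ge0// ltW.
  - by move=> w _; rewrite lee_fin.
  apply: le_esum => w _; rewrite -EFinM.
  by have := P_cyl_invariant w mA Ainv; rewrite pE -EFinM mulrAC.
have [p00|pn0] := eqVneq p 0; first by left; rewrite pE p00.
move=> H; right; rewrite pE; congr EFin; apply/eqP; rewrite eq_le p1/=.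
have cp : 0 < c * p by rewrite mulr_gt0// lt0r pn0.
by rewrite -subr_le0 -(pmulr_rle0 _ cp).
Qed.

End shift_invariance.

(** * The critical exponent *)

(** Averaging the tangent inequality of the exponential at the intermediate exponent [m] over [x]
    and [y] cancels the linear terms. *)
Lemma powR_convex (R : realType) (a x y l : R) : 0 < a -> 0 <= l <= 1 ->
  a `^ (l * x + (1 - l) * y) <= l * a `^ x + (1 - l) * a `^ y.
Proof.
move=> a0 /andP[l0 l1]; rewrite /powR gt_eqF//.
set m := l * x + (1 - l) * y; set E := expR (m * ln a).
have E0 : 0 < E by exact: expR_gt0.
have tangent z : E * (1 + (z - m) * ln a) <= expR (z * ln a).
  have -> : z * ln a = m * ln a + (z - m) * ln a by ring.
  by rewrite expRD ler_pM2l// expR_ge1Dx.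
have := ler_wpM2l l0 (tangent x).
have l1' : 0 <= 1 - l by lra.
have := ler_wpM2l l1' (tangent y).
move=> h1 h2; apply: le_trans (lerD h2 h1).
by rewrite le_eqVlt; apply/orP; left; apply/eqP; rewrite /m; ring.
Qed.

Lemma word_sum_ge0 (R : realType) (f : seq nat -> R) n :
  (forall w, 0 <= f w) -> (0 <= word_sum f n)%E.
Proof. by move=> f0; apply: esum_ge0 => w _; rewrite lee_fin. Qed.

Lemma le_word_sum (R : realType) (f g : seq nat -> R) n :
  (forall w, size w = n -> f w <= g w) -> (word_sum f n <= word_sum g n)%E.
Proof. by move=> fg; apply: le_esum => w wn; rewrite lee_fin fg. Qed.

Lemma word_sumZ (R : realType) (f : seq nat -> R) n c :
  0 <= c -> (forall w, 0 <= f w) ->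
  (word_sum (fun w => c * f w)%R n = c%:E * word_sum f n)%E.
Proof.
move=> c0 f0; rewrite /word_sum -esumZl//.
by move=> w _; rewrite lee_fin.
Qed.

Lemma word_sumD_split (R : realType) (f : seq nat -> R) n m :
  (forall w, 0 <= f w) ->
  (word_sum f (n + m) =
   \esum_(u in words n) word_sum (fun v => f (u ++ v)) m)%E.
Proof.
move=> f0; rewrite /word_sum esum_words_cat// => w; by rewrite lee_fin.
Qed.

(** Complements [esumZl]: here the constant factor is a word sum, which may be infinite. *)
Lemma esumZr (R : realType) (I : choiceType) (A : set I) (z : \bar R)
    (f : I -> R) : (0 <= z)%E -> (forall i, 0 < f i) ->
  (\esum_(i in A) ((f i)%:E * z) <= (\esum_(i in A) (f i)%:E) * z)%E.
Proof.
move=> z0 f0; case: z z0 => [z z0||//].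
  under eq_esum do rewrite muleC.
  by rewrite esumZl// 1?muleC// => i _; rewrite lee_fin ltW.
move=> _; have [->|/set0P[i Ai]] := eqVneq A set0; first by rewrite !esum_set0 mul0e.
rewrite gt0_muley ?leey//; apply: (@lt_le_trans _ _ (f i)%:E); first by rewrite lte_fin.
by apply: (esum_ge1 (f := fun i => (f i)%:E)) => // j; rewrite lee_fin ltW.
Qed.

Lemma word_sum_sub (R : realType) (f : seq nat -> R) n m :
  (forall w, 0 < f w) -> (forall u v, f (u ++ v) <= f u * f v) ->
  (word_sum f (n + m) <= word_sum f n * word_sum f m)%E.
Proof.
move=> f0 fM; rewrite word_sumD_split; last by move=> w; exact: ltW.
apply: (@le_trans _ _ (\esum_(u in words n) ((f u)%:E * word_sum f m))%E).
  apply: le_esum => u _; rewrite -word_sumZ; [|exact: ltW|by move=> w; exact: ltW].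
  by apply: le_word_sum => v _; exact: fM.
by apply: esumZr => //; apply: word_sum_ge0 => w; exact: ltW.
Qed.

Lemma word_sum_super (R : realType) (f : seq nat -> R) n m (z : R) :
  (forall w, 0 < f w) -> (forall u v, f u * f v <= f (u ++ v)) ->
  0 <= z -> (z%:E <= word_sum f m)%E ->
  (word_sum f n * z%:E <= word_sum f (n + m))%E.
Proof.
move=> f0 fM z0 zm; rewrite word_sumD_split; last by move=> w; exact: ltW.
rewrite muleC {1}/word_sum -esumZl//; last by move=> w _; rewrite lee_fin ltW.
apply: le_esum => u _.
apply: (@le_trans _ _ ((f u)%:E * word_sum f m)%E).
  by rewrite muleC lee_wpmul2l// lee_fin ltW.
rewrite -word_sumZ; [|exact: ltW|by move=> w; exact: ltW].
by apply: le_word_sum => v _; exact: fM.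
Qed.

Lemma word_sum_sub_iter (R : realType) (f : seq nat -> R) n k (z : R) :
  (forall w, 0 < f w) -> (forall u v, f (u ++ v) <= f u * f v) -> 0 <= z ->
  (word_sum f n <= z%:E)%E -> (word_sum f (k.+1 * n) <= (z ^+ k.+1)%:E)%E.
Proof.
move=> f0 fM z0 fz; elim: k => [|k IH]; first by rewrite mul1n expr1.
rewrite mulSn; apply: (le_trans (word_sum_sub _ _ f0 fM)).
rewrite exprS EFinM lee_pmul//; apply: word_sum_ge0 => w; exact: ltW.
Qed.

Lemma word_sum_super_iter (R : realType) (f : seq nat -> R) n k :
  (forall w, 0 < f w) -> (forall u v, f u * f v <= f (u ++ v)) ->
  (1 <= word_sum f n)%E -> (1 <= word_sum f (k.+1 * n))%E.
Proof.
move=> f0 fM f1; elim: k => [|k IH]; first by rewrite mul1n.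
rewrite mulSn; apply: le_trans (word_sum_super _ _ _ ler01 IH) => //.
by rewrite mule1.
Qed.

(** A finite subsum [A] already exceeds [M], and as a function of the exponent it lies above its
    tangent at [s], of slope [B]. The step [t - s] is chosen so that the tangent loses less than
    [A - M]. *)
Lemma esum_powR_right (R : realType) (f : seq nat -> R) n (s M : R) :
  (forall w, 0 < f w) -> (M%:E < word_sum (fun w => f w `^ s)%R n)%E ->
  exists2 t, s < t & (M%:E < word_sum (fun w => f w `^ t)%R n)%E.
Proof.
move=> f0 /ereal_sup_gt[_ [F [finF FS] <-]].
rewrite fsbig_finite//= sumEFin lte_fin => MF.
pose A := \sum_(w <- finmap.enum_fset (fset_set F)) f w `^ s.
pose B := \sum_(w <- finmap.enum_fset (fset_set F)) f w `^ s * ln (f w).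
pose t := s + (A - M) / (2 * (`|B| + 1)).
have B1 : 0 < 2 * (`|B| + 1) by have := normr_ge0 B; lra.
have AM : 0 < A - M by rewrite subr_gt0.
have h0 : 0 < (A - M) / (2 * (`|B| + 1)) by rewrite divr_gt0.
exists t; first by rewrite /t ltrDl.
apply: (@lt_le_trans _ _ (\sum_(w <- finmap.enum_fset (fset_set F)) f w `^ t)%:E); last first.
  rewrite -sumEFin; apply: ereal_sup_ubound; exists F => //.
  by rewrite fsbig_finite.
rewrite lte_fin; apply: (@lt_le_trans _ _ (A + (t - s) * B)).
  rewrite /t addrAC subrr add0r.
  have : - ((A - M) / (2 * (`|B| + 1)) * B) < A - M.
    apply: (@le_lt_trans _ _ ((A - M) / (2 * (`|B| + 1)) * `|B|)).
      rewrite -mulrN; apply: ler_wpM2l; first exact: ltW.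
      by rewrite -normrN ler_norm.
    rewrite mulrAC ltr_pdivrMr// ltr_pM2l//.
    by have := normr_ge0 B; lra.
  by lra.
rewrite /A /B mulr_sumr -big_split/=; apply: ler_sum => w _.
have -> : f w `^ t = f w `^ s * f w `^ (t - s).
  rewrite -powRD; last by rewrite (gt_eqF (f0 w)) implybT.
  by congr (_ `^ _); ring.
rewrite -[X in X + _]mulr1 mulrCA -mulrDr.
rewrite ler_pM2l ?powR_gt0//.
by rewrite [X in _ <= X]/powR gt_eqF// expR_ge1Dx.
Qed.

Lemma powR_le (R : realType) (a b t : R) :
  0 <= t -> 0 <= a -> a <= b -> a `^ t <= b `^ t.
Proof.
move=> t0 a0 ab; apply: ge0_ler_powR => //.
by rewrite nnegrE (le_trans a0).
Qed.

Lemma exprn_small (R : realType) (th r : R) : 0 < th < 1 -> 0 < r ->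
  exists m, forall n, (m <= n)%N -> th ^+ n <= r.
Proof.
move=> /andP[th0 th1] r0.
have := @cvg_expr R th; rewrite ger0_norm ?ltW// => /(_ th1).
move=> /cvgrPdist_lt /(_ _ r0) [m _ H]; exists m => n mn.
have := H n mn; rewrite /= sub0r normrN => /ltW; apply: le_trans.
exact: ler_norm.
Qed.

Lemma powR_mul_sub (R : realType) (d : seq nat -> R) t : 0 <= t ->
  (forall w, 0 < d w) -> (forall u v, d (u ++ v) <= d u * d v) ->
  forall u v, d (u ++ v) `^ t <= d u `^ t * d v `^ t.
Proof.
move=> t0 d0 dM u v; rewrite -powRM ?(ltW (d0 _))//.
by apply: powR_le => //; exact: ltW.
Qed.

Lemma powR_mul_super (R : realType) (d : seq nat -> R) t : 0 <= t ->
  (forall w, 0 < d w) -> (forall u v, d u * d v <= d (u ++ v)) ->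
  forall u v, d u `^ t * d v `^ t <= d (u ++ v) `^ t.
Proof.
move=> t0 d0 dM u v; rewrite -powRM ?(ltW (d0 _))//.
by apply: powR_le => //; rewrite mulr_ge0 ?(ltW (d0 _)).
Qed.

(* The exponent is the infimum of the t for which the sums over words of a given
   length decay; at the infimum they are bounded above because finite subsums
   are continuous in t, and bounded below by convexity, because the sums stay
   finite a little to the left. *)
Lemma bowen_exponent (R : realType) (d : seq nat -> R) (C th : R) :
  1 <= C -> 0 < th < 1 -> (forall w, 0 < d w) ->
  (forall u v, d (u ++ v) <= C * (d u * d v)) ->
  (forall u v, d u * d v <= C * d (u ++ v)) ->
  (forall w, d w <= C * th ^+ size w) ->
  (word_sum d 1 < +oo)%E ->
  (forall t, 0 <= t -> (word_sum (fun w => d w `^ t)%R 1 < +oo)%E ->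
    exists2 t', 0 <= t' < t & (word_sum (fun w => d w `^ t')%R 1 < +oo)%E) ->
  exists s s0, [/\ 0 <= s0 < s, (word_sum (fun w => d w `^ s0)%R 1 < +oo)%E,
    (forall n, 1 <= word_sum (fun w => (C * d w) `^ s)%R n)%E &
    (forall n, word_sum (fun w => (C * d w) `^ s)%R n <= ((C ^+ 2) `^ s)%:E)%E].
Proof.
move=> C1 th01 d0 dsub dsup dth d1 dopen.
have C0 : 0 < C by lra.
have CC0 : 0 < C ^+ 2 by rewrite exprn_gt0.
(* The constant is absorbed in two ways: [e] is submultiplicative, [f] is supermultiplicative, and
   they differ by the factor [C ^+ 2]. *)
pose e w := C * d w; pose f w := d w / C.
have e0 w : 0 < e w by rewrite mulr_gt0.
have f0 w : 0 < f w by rewrite divr_gt0.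
have esub u v : e (u ++ v) <= e u * e v.
  rewrite /e (_ : C * d u * (C * d v) = C * (C * (d u * d v))); last by ring.
  by rewrite ler_pM2l.
have fsup u v : f u * f v <= f (u ++ v).
  rewrite /f (_ : d u / C * (d v / C) = (d u * d v) / C / C); last by ring.
  by rewrite ler_pM2r ?invr_gt0// ler_pdivrMr// [leRHS]mulrC.
have fe w : f w <= e w.
  by rewrite /f /e ler_pdivrMr// mulrAC ler_peMl ?mulr_ege1// ltW.
have eE w : e w = C ^+ 2 * f w.
  by rewrite /e /f; field; rewrite gt_eqF.
pose Z t := word_sum (fun w => e w `^ t).
have Zpos t n : (0 <= Z t n)%E by apply: word_sum_ge0 => w; exact: powR_ge0.
have et0 t w : 0 < e w `^ t by exact: powR_gt0.
have ft0 t w : 0 < f w `^ t by exact: powR_gt0.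
have Z0 t : 0 <= t -> (1 <= Z t 0%N)%E.
  move=> t0; rewrite /Z /word_sum esum_words0; last by move=> w; rewrite lee_fin ltW.
  have -> : 1%E = (1 `^ t)%:E :> \bar R by rewrite powR1.
  rewrite lee_fin; apply: powR_le => //.
  by have := esub [::] [::]; rewrite -{1}[e _]mulr1 ler_pM2l.
have small (r : R) : 0 < r -> exists m, forall w, (m <= size w)%N -> e w <= r.
  move=> r0; have cC : 0 < r / C ^+ 2 by rewrite divr_gt0.
  have [m Hm] := exprn_small th01 cC; exists m => w /Hm.
  rewrite ler_pdivlMr// /e => H; apply: le_trans H.
  by rewrite [leRHS]mulrC expr2 -mulrA ler_pM2l.
pose S := [set t : R | 0 <= t /\ exists n, (Z t n < 1)%E].
have S_iter t n : 0 <= t -> (Z t n < 1)%E -> forall k, (Z t (k.+1 * n)%N < 1)%E.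
  move=> t0 Zn k.
  have zfin : Z t n \is a fin_num by rewrite ge0_fin_numE// (lt_trans Zn) ?ltry.
  have z0 : 0 <= fine (Z t n) by rewrite fine_ge0.
  apply: (@le_lt_trans _ _ (fine (Z t n) ^+ k.+1)%:E).
    apply: word_sum_sub_iter => //; first exact: powR_mul_sub.
    by rewrite fineK.
  by rewrite lte_fin exprn_ilt1// -lte_fin fineK.
have S_pos t n : 0 <= t -> (Z t n < 1)%E -> (0 < n)%N.
  by move=> t0; case: n => // /lt_geF; rewrite Z0.
have S_up t t' : S t -> t <= t' -> S t'.
  move=> [t0 [n Zn]] tt'; split; first exact: le_trans tt'.
  have n0 := S_pos _ _ t0 Zn.
  have [m Hm] := small _ ltr01.
  exists (m.+1 * n)%N; apply: le_lt_trans (S_iter _ _ t0 Zn m).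
  apply: le_word_sum => w wn; apply: ger_powR => //.
  by rewrite e0/= Hm// wn; case: n n0 {Zn wn} => // n _; rewrite mulnS (leq_trans _ (leq_addr _ _)).
have S_ne : S !=set0.
  have Z1 : (Z 1%R 1%N < +oo)%E.
    rewrite (_ : Z 1%R 1%N = (C%:E * word_sum d 1)%E).
      by rewrite lte_mul_pinfty// lee_fin ltW.
    rewrite -word_sumZ ?ltW//; last by move=> w; exact: ltW.
    by apply: eq_esum => w _; rewrite powRr1// ltW.
  have Zfin : Z 1%R 1%N \is a fin_num by rewrite ge0_fin_numE.
  have z0 : 0 <= fine (Z 1%R 1%N) by rewrite fine_ge0.
  (* The sum over words of length [m.+1] is at most [y] at exponent 1. These words have [e w <= h],
     so raising the exponent by [j] gains the factor [h ^+ j], which beats [y]. *)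
  pose h : R := 2^-1; have h0 : 0 < h by rewrite invr_gt0.
  have h01 : 0 < h < 1 by rewrite h0 invf_lt1 ?ltr1n.
  have [m Hm] := small _ h0.
  have := @word_sum_sub_iter R (fun w => e w `^ 1) 1 m (fine (Z 1%R 1%N)) (et0 1)
    (powR_mul_sub ler01 e0 esub) z0.
  rewrite -/(Z 1) fineK// lexx => /(_ isT); rewrite muln1.
  set y := fine (Z 1%R 1%N) ^+ m.+1 => Zy.
  have y0 : 0 <= y by rewrite exprn_ge0.
  have y1 : 0 < (y + 1)^-1 by rewrite invr_gt0; lra.
  have [j Hj] := exprn_small h01 y1.
  exists (1 + j%:R); split; first by rewrite addr_ge0.
  exists m.+1; apply: (@le_lt_trans _ _ ((h ^+ j)%:E * Z 1%R m.+1)%E).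
    rewrite -word_sumZ; [|by rewrite exprn_ge0 ?ltW|by move=> w; exact: ltW].
    apply: le_word_sum => w wm.
    rewrite powRD; last by rewrite (gt_eqF (e0 w)) implybT.
    rewrite mulrC ler_pM2r// powR_mulrn ?(ltW (e0 _))//.
    by rewrite lerXn2r ?nnegrE ?(ltW (e0 _)) ?(ltW h0)// Hm// wm.
  apply: (@le_lt_trans _ _ ((h ^+ j)%:E * y%:E)%E).
    by rewrite lee_wpmul2l// lee_fin exprn_ge0// ltW.
  rewrite -EFinM lte_fin; apply: (@le_lt_trans _ _ ((y + 1)^-1 * y)).
    by rewrite ler_wpM2r// Hj.
  by rewrite mulrC ltr_pdivrMr; lra.
have S_lb : lbound S 0 by move=> t [].
have hS : has_inf S by split => //; exists 0.
pose s := inf S.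
have s0 : 0 <= s by exact: lb_le_inf.
have S_gt t : s < t -> S t.
  move=> st; have : 0 < t - s by rewrite subr_gt0.
  move=> /inf_adherent /(_ hS) [t1 St1]; rewrite addrC subrK => /ltW.
  exact: S_up.
(* If the sum of the [f w] at [s] exceeded 1, it would do so at some [t > s], and by
   supermultiplicativity at all multiples of the length. But [t] is in [S], so the larger sum of the
   [e w] is below 1 at all multiples of another length; a common multiple is contradictory. *)
have Y1 n : (word_sum (fun w => f w `^ s)%R n <= 1)%E.
  rewrite leNgt; apply/negP => /(esum_powR_right f0)[t st Yt].
  have [t0 [m Zm]] := S_gt _ st; have m0 := S_pos _ _ t0 Zm.
  have Yn k : (1 <= word_sum (fun w => f w `^ t)%R (k.+1 * n))%E.
    by apply: word_sum_super_iter => //; [exact: powR_mul_super|exact: ltW].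
  have n0 : (0 < n)%N.
    case: n Yt {Yn} => // ; rewrite ltNge => /negP[].
    rewrite /word_sum esum_words0; last by move=> w; rewrite lee_fin ltW.
    have -> : 1%E = (1 `^ t)%:E :> \bar R by rewrite powR1.
    rewrite lee_fin; apply: powR_le => //; first exact: ltW.
    by have := fsup [::] [::]; rewrite -{3}[f _]mulr1 ler_pM2l.
  have := S_iter _ _ t0 Zm n.-1; rewrite prednK// ltNge => /negP[].
  have := Yn m.-1; rewrite prednK// mulnC => /le_trans; apply.
  by apply: le_word_sum => w _; apply: powR_le => //; exact: ltW.
have Zle n : (Z s n <= ((C ^+ 2) `^ s)%:E)%E.
  rewrite (_ : Z s n = ((C ^+ 2) `^ s)%:E * word_sum (fun w => f w `^ s)%R n)%E.
    rewrite -[leRHS]mule1 lee_wpmul2l// lee_fin powR_ge0//.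
  rewrite -word_sumZ ?powR_ge0//; last by move=> w; exact: ltW.
  by apply: eq_esum => w _; rewrite eE powRM ?(ltW (f0 w)) ?(ltW CC0).
have Zd t n : word_sum (fun w => e w `^ t)%R n =
    ((C `^ t)%:E * word_sum (fun w => d w `^ t)%R n)%E.
  rewrite -word_sumZ ?powR_ge0//; last by move=> w; exact: powR_ge0.
  by apply: eq_esum => w _; rewrite powRM ?ltW.
have ds : (word_sum (fun w => d w `^ s)%R 1 < +oo)%E.
  have := Zle 1%N; rewrite /Z Zd => /le_lt_trans /(_ (ltry _)).
  case: (word_sum _ _) => [r _|/=|_]; [exact: ltry| |by []].
  by rewrite gt0_muley// lte_fin powR_gt0.
have [t0 /andP[t00 t0s] dt0] := dopen _ s0 ds.
have Zt0 n : (Z t0 n < +oo)%E.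
  case: n => [|n].
    by rewrite /Z /word_sum esum_words0 ?ltry// => w; rewrite lee_fin ltW.
  have Zfin : Z t0 1%N \is a fin_num.
    by rewrite ge0_fin_numE// /Z Zd lte_mul_pinfty// lee_fin powR_ge0.
  have := @word_sum_sub_iter R (fun w => e w `^ t0) 1 n (fine (Z t0 1%N)) (et0 t0)
    (powR_mul_sub t00 e0 esub).
  rewrite fine_ge0// => /(_ isT); rewrite fineK// lexx => /(_ isT).
  by rewrite muln1 => /le_lt_trans -> //; rewrite ltry.
exists s, t0; split => //; first by rewrite t00.
(* If [Z s n < 1], convexity between [t0], where the sum is finite, and [s] keeps the sum below 1 at
   an exponent less than [s = inf S]. The weight [l] makes the contribution of [t0] at most half of
   the gap [1 - z]. *)
move=> n; rewrite leNgt; apply/negP => Zlt.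
have zfin : Z s n \is a fin_num by rewrite ge0_fin_numE// (lt_trans Zlt) ?ltry.
have z'fin : Z t0 n \is a fin_num by rewrite ge0_fin_numE.
pose z := fine (Z s n); pose z' := fine (Z t0 n).
have z1 : z < 1 by rewrite -lte_fin fineK.
have z'0 : 0 <= z' by rewrite fine_ge0.
have z0 : 0 <= z by rewrite fine_ge0.
pose l := (1 - z) / (2 * (z' + 1)).
have l0 : 0 < l by rewrite divr_gt0; lra.
have l1 : l <= 1 by rewrite ler_pdivrMr; lra.
pose t := l * t0 + (1 - l) * s.
have ts : t < s.
  have : 0 < l * (s - t0) by rewrite mulr_gt0// subr_gt0.
  by rewrite /t; lra.
have t_ge0 : 0 <= t.
  by rewrite addr_ge0// mulr_ge0//; lra.
suff : S t by move=> /(ge_inf hS.2); rewrite leNgt ts.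
split => //; exists n.
apply: (@le_lt_trans _ _ (l%:E * Z t0 n + (1 - l)%:E * Z s n)%E).
  rewrite -!word_sumZ; [|lra|by move=> w; exact: ltW|lra|by move=> w; exact: ltW].
  rewrite /word_sum -esumD; [|by move=> w _; rewrite lee_fin mulr_ge0 ?(ltW l0) ?powR_ge0
    |by move=> w _; rewrite lee_fin mulr_ge0 ?powR_ge0//; lra].
  apply: le_esum => w _; rewrite -EFinD lee_fin; apply: powR_convex => //.
  by rewrite l1 ltW.
rewrite -(fineK zfin) -(fineK z'fin) -/z -/z' -!EFinM -EFinD lte_fin.
have : l * z' <= (1 - z) / 2.
  rewrite /l -mulrA ler_pM2l; last by lra.
  rewrite invfM -mulrA ler_piMr ?invr_ge0//.
  by rewrite mulrC ler_pdivrMr; lra.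
have : 0 <= l * z by rewrite mulr_ge0// ltW.
by lra.
Qed.

(** All that the dimension estimates need to know of the map. [gc_dist] and [gc_sup] together
    characterise [d w] as the diameter of the coded cylinder; [gc_convex] lets the order of the line
    be used on cylinders. *)
Record geometric_coding (R : realType) (pi : (nat -> nat) -> R)
    (d : seq nat -> R) (C th : R) : Prop := {
  gc_inj : injective pi;
  gc_C : 1 <= C;
  gc_th : 0 < th < 1;
  gc_dist : forall w a b, cyl w a -> cyl w b -> `|pi a - pi b| <= d w;
  gc_sup : forall w r,
    (forall a b, cyl w a -> cyl w b -> `|pi a - pi b| <= r) -> d w <= r;
  gc_convex : forall w a b c, cyl w a -> cyl w b -> pi a <= pi c <= pi b ->
    cyl w c;
  gc_gt0 : forall w, 0 < d w;
  gc_sub : forall u v, d (u ++ v) <= C * (d u * d v);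
  gc_super : forall u v, d u * d v <= C * d (u ++ v);
  gc_decay : forall w, d w <= C * th ^+ size w }.

Lemma gc_small (R : realType) (pi : (nat -> nat) -> R) (d : seq nat -> R) C th
    (e : R) : geometric_coding pi d C th -> 0 < e ->
  exists n, forall w, (n <= size w)%N -> d w < e.
Proof.
move=> gc e0; have C0 : 0 < C by have := gc_C gc; lra.
have h0 : 0 < e / (2 * C) by rewrite divr_gt0// mulr_gt0.
have [n Hn] := exprn_small (gc_th gc) h0; exists n => w /Hn.
rewrite ler_pdivlMr ?mulr_gt0// => H; apply: (le_lt_trans (gc_decay gc w)).
by lra.
Qed.

Lemma gc_continuous (R : realType) (pi : (nat -> nat) -> R) d C th :
  geometric_coding pi d C th ->
  forall a (e : R), 0 < e -> exists n, forall b,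
    cyl (mkseq a n) b -> `|pi a - pi b| < e.
Proof.
move=> gc a e e0; have [n Hn] := gc_small gc e0; exists n => b ab.
apply: le_lt_trans (gc_dist gc (cyl_mkseq a n) ab) (Hn _ _).
by rewrite size_mkseq.
Qed.

(** * Hausdorff dimension *)

Lemma diam_le (R : realType) (U : set R) (r : R) :
  (forall x y, U x -> U y -> `|x - y| <= r) -> (diam U <= r%:E)%E.
Proof.
by move=> Ur; apply: ge_ereal_sup => _ [x [y [Ux Uy ->]]]; rewrite lee_fin Ur.
Qed.

Lemma diam_ge0 (R : realType) (U : set R) x : U x -> (0 <= diam U)%E.
Proof.
move=> Ux; apply: ereal_sup_ubound; exists x, x; split => //.
by rewrite subrr normr0.
Qed.

Lemma le_diam (R : realType) (U : set R) x y : U x -> U y ->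
  (`|x - y|%:E <= diam U)%E.
Proof. by move=> Ux Uy; apply: ereal_sup_ubound; exists x, y. Qed.

Lemma diam_pow_ge0 (R : realType) (t : R) (U : set R) : (0 <= diam_pow t U)%E.
Proof. by rewrite /diam_pow; case: ifP => // _; exact: poweR_ge0. Qed.

Lemma diam_pow_le (R : realType) (t r : R) (U : set R) : 0 <= t -> 0 <= r ->
  (forall x y, U x -> U y -> `|x - y| <= r) ->
  (diam_pow t U <= (r `^ t)%:E)%E.
Proof.
move=> t0 r0 Ur; rewrite /diam_pow; case: ifPn => [_|/set0P[x Ux]].
  by rewrite lee_fin powR_ge0.
have := diam_ge0 Ux; have := diam_le Ur.
case: (diam U) => [z||]//; rewrite !lee_fin => zr z0.
by rewrite powR_le.
Qed.

Lemma hausdorff_premeasure_ge0 (R : realType) (s e : R) (Z : set R) :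
  (0 <= hausdorff_premeasure s e Z)%E.
Proof.
apply: le_ereal_inf_tmp => _ [U [_ _ ->]].
by apply: nneseries_ge0 => n _ _; exact: diam_pow_ge0.
Qed.

Lemma hausdorff_measure_eq0 (R : realType) (s : R) (Z : set R) :
  (forall e eta : R, 0 < e -> 0 < eta -> exists U : nat -> set R,
    [/\ Z `<=` \bigcup_i U i, forall i, (diam (U i) <= e%:E)%E &
        (\sum_(0 <= i <oo) diam_pow s (U i) <= eta%:E)%E]) ->
  hausdorff_measure s Z = 0%E.
Proof.
move=> H; apply/eqP; rewrite eq_le; apply/andP; split.
  apply: ge_ereal_sup => _ [e /= + <-]; rewrite in_itv/= andbT => e0.
  apply/lee_addgt0Pr => eta eta0; rewrite add0e.
  have [U [ZU Ue Ueta]] := H _ _ e0 eta0.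
  by apply: ge_ereal_inf; exists (\sum_(0 <= i <oo) diam_pow s (U i))%E => //; exists U.
apply: (@le_trans _ _ (hausdorff_premeasure s 1 Z)).
  exact: hausdorff_premeasure_ge0.
by apply: ereal_sup_ubound; exists 1 => //=; rewrite in_itv/= ltr01.
Qed.

(** The cylinders of one length cover the range, and the excess [t - s] of the exponent makes their
    sum small. The countable rest is covered by singletons, which cost nothing because [t > 0]. *)
Lemma hausdorff_measure_range (R : realType) (pi : (nat -> nat) -> R) d C th
    (s t B : R) (N : set R) : geometric_coding pi d C th ->
  0 <= s < t -> countable N ->
  (forall n, word_sum (fun w => d w `^ s)%R n <= B%:E)%E ->
  hausdorff_measure t (range pi `|` N) = 0%E.
Proof.
move=> gc /andP[s0 st] cN dB; have t0 : 0 < t by apply: le_lt_trans st.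
have B0 : 0 <= B.
  rewrite -lee_fin; apply: le_trans (dB 0%N); apply: word_sum_ge0 => w.
  exact: powR_ge0.
apply: hausdorff_measure_eq0 => e eta e0 eta0.
(* With all diameters at most [r], the sum at exponent [t] is at most [B * eta / (B + 1)], hence at
   most [eta]. *)
pose r := (eta / (B + 1)) `^ (t - s)^-1.
have r0 : 0 < r by apply: powR_gt0; rewrite divr_gt0// ltr_wpDl.
have er0 : 0 < Num.min e r by rewrite lt_min e0.
have [n Hn] := gc_small gc er0.
have [g gN] : exists g : nat -> set R, (forall k, g k = set0 \/ exists x, g k = [set x]) /\
    N `<=` \bigcup_k g k.
  have /countable_injP[f finj] := cN.
  exists (fun k => [set x | N x /\ f x = k]); split => [k|x Nx]; last first.
    by exists (f x).
  have [[x [Nx fx]]|H] := pselect (exists x, N x /\ f x = k).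
    right; exists x; apply/seteqP; split => [y [Ny fy]|_ ->]//.
    by apply: finj; rewrite ?inE// fx fy.
  by left; apply/seteqP; split => // y [Ny fy]; apply: H; exists y.
case: gN => g1 gN.
(* One sequence lists both covers, by the encoding of the disjoint sum of words and indices. *)
pose U k : set R := match (pickle_inv k : option (seq nat + nat)) with
  | Some (inl w) => if size w == n then pi @` cyl w else set0
  | Some (inr j) => g j
  | None => set0 end.
have dle w (x y : R) : (pi @` cyl w) x -> (pi @` cyl w) y -> `|x - y| <= d w.
  by move=> [a aw <-] [b bw <-]; exact: (gc_dist gc).
have gle j (z : R) : 0 <= z -> forall x y : R, g j x -> g j y -> `|x - y| <= z.
  move=> z0 x y; have [->//|[v ->]] := g1 j; move=> -> ->.
  by rewrite subrr normr0.
exists U; split.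
- move=> x [[a _ <-]|Nx].
    exists (pickle (inl (mkseq a n) : seq nat + nat)); first exact: I.
    by rewrite /U pickleK_inv size_mkseq eqxx; exists a => //; exact: cyl_mkseq.
  have [k _ gk] := gN _ Nx.
  exists (pickle (inr k : seq nat + nat)); first exact: I.
  by rewrite /U pickleK_inv.
- move=> k; rewrite /U; case: pickle_inv => [[w|j]|]; last by apply: diam_le.
    case: eqP => wn; last by apply: diam_le.
    apply: (le_trans (diam_le (dle w))); rewrite lee_fin.
    have /ltW : d w < Num.min e r by apply: Hn; rewrite wn.
    by rewrite le_min => /andP[].
  by apply: diam_le; apply: gle; exact: ltW.
- rewrite nneseries_esumT; last by move=> k; exact: diam_pow_ge0.
  apply: (@le_trans _ _ (word_sum (fun w => d w `^ t)%R n)).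
    rewrite (_ : esum _ _ = \esum_(k in (fun w => pickle (inl w : seq nat + nat)) @` words n) diam_pow t (U k))%E.
      rewrite esum_image; last first.
        by move=> u v _ _ /(pcan_inj pickleK)[].
      apply: le_esum => w wn; apply: diam_pow_le; [exact: ltW|exact/ltW/(gc_gt0 gc)|].
      by rewrite /U pickleK_inv wn eqxx; exact: dle.
    rewrite [RHS]esum_mkcond; apply: eq_esum => k _; case: ifPn => //.
    rewrite notin_setE => nk.
    suff U0 : forall x y : R, U k x -> U k y -> `|x - y| <= 0.
      apply/eqP; rewrite eq_le diam_pow_ge0 andbT.
      by apply: (le_trans (diam_pow_le (ltW t0) (lexx _) U0)); rewrite powR0// gt_eqF.
    move: nk; rewrite /U; have := @pickle_invK (seq nat + nat)%type k.
    case: pickle_inv => [[w|j]|]//= <-; last by move=> _; exact: gle.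
    by case: eqP => // wn []; exists w.
  apply: (@le_trans _ _ (\esum_(w in words n) ((r `^ (t - s))%:E * (d w `^ s)%:E))%E).
    apply: le_esum => w wn; rewrite -EFinM lee_fin.
    have /ltW : d w < Num.min e r by apply: Hn; rewrite wn.
    rewrite le_min => /andP[_ dr].
    have {1}-> : t = (t - s) + s by ring.
    rewrite powRD; last by rewrite (gt_eqF (gc_gt0 gc w)) implybT.
    rewrite ler_wpM2r ?powR_ge0//; apply: powR_le => //.
      by rewrite subr_ge0 ltW.
    exact/ltW/(gc_gt0 gc).
  rewrite esumZl ?powR_ge0//; last by move=> w _; rewrite lee_fin powR_ge0.
  rewrite /r -powRrM mulVf; last by rewrite subr_eq0 gt_eqF.
  rewrite powRr1; last by rewrite ltW// divr_gt0// ltr_wpDl.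
  apply: (@le_trans _ _ ((eta / (B + 1))%:E * B%:E)%E).
    by rewrite lee_wpmul2l ?dB// lee_fin ltW// divr_gt0// ltr_wpDl.
  rewrite -EFinM lee_fin mulrAC ler_pdivrMr ?ltr_wpDl// ler_pM2l//; lra.
Qed.

Lemma cyl_mkseqP (a b : nat -> nat) n : cyl (mkseq a n) b <->
  mkseq b n = mkseq a n.
Proof. by rewrite /cyl/= size_mkseq. Qed.

Lemma cyl_mkseqC (a b : nat -> nat) n :
  cyl (mkseq a n) b -> cyl (mkseq b n) a.
Proof. by move/cyl_mkseqP => ab; apply/cyl_mkseqP. Qed.

Lemma cyl_mkseq_le (a b : nat -> nat) m n : (m <= n)%N ->
  cyl (mkseq a n) b -> cyl (mkseq a m) b.
Proof.
move=> mn; apply: cyl_sub; apply/prefixP; exists (drop m (mkseq a n)).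
rewrite -{1}(cat_take_drop m (mkseq a n)); congr (_ ++ _).
by rewrite /mkseq -map_take take_iota (minn_idPl mn).
Qed.

Lemma nneseries_geometric_le (R : realType) (x A : R) : 0 <= A -> 0 < x < 1 ->
  (\sum_(0 <= n <oo) (A * x ^+ n)%:E <= (A / (1 - x))%:E)%E.
Proof.
move=> A0 /andP[x0 x1].
have t0 n : 0 <= A * x ^+ n by rewrite mulr_ge0// exprn_ge0// ltW.
apply: lime_le; first by apply: is_cvg_nneseries => n _ _; rewrite lee_fin.
near=> n; rewrite sumEFin lee_fin -mulr_sumr ler_wpM2l//.
rewrite big_mkord -[leRHS]mul1r ler_pdivlMr ?subr_gt0//.
have := subrX1 x n; rewrite -opprB => /(congr1 -%R); rewrite opprK.
rewrite mulrC -mulrN opprB => H; rewrite -H.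
by rewrite lerBlDr lerDl exprn_ge0// ltW.
Unshelve. all: by end_near. Qed.

Section lower_dimension.
Context {R : realType}.
Variables (pi : (nat -> nat) -> R) (d : seq nat -> R) (C th : R).
Hypothesis gc : geometric_coding pi d C th.

(* An interval of length r meets at most two of the disjoint cylinders of
   diameter > r. *)
Lemma two_cylinders (G : set (nat -> nat)) (stop : (nat -> nat) -> nat -> Prop)
    (r : R) :
  (forall a, G a -> exists m, stop a m) ->
  (forall a m, G a -> stop a m -> r < d (mkseq a m)) ->
  (forall a b, G a -> G b -> `|pi a - pi b| <= r) ->
  G = set0 \/ exists a1 m1 a2 m2, [/\ G a1, stop a1 m1, G a2, stop a2 m2 &
    G `<=` cyl (mkseq a1 m1) `|` cyl (mkseq a2 m2)].
Proof.
move=> Gstop stop_r Gr.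
have minstop (E : set (nat -> nat)) : E `<=` G -> E !=set0 ->
    exists a m, [/\ E a, stop a m & forall b k, E b -> stop b k -> (m <= k)%N].
  move=> EG [a0 Ea0]; have [m0 sm0] := Gstop _ (EG _ Ea0).
  have ex : exists m, `[< exists2 a, E a & stop a m >].
    by exists m0; apply/asboolP; exists a0.
  have [m /asboolP[a Ea sa] minm] := ex_minnP ex.
  exists a, m; split => // b k Eb sb; apply: minm; apply/asboolP.
  by exists b.
have [->|/set0P G0] := eqVneq G set0; [by left|right].
(* The two cylinders are picked greedily with the shortest stopping lengths. A third point outside
   both would give three points, none in the cylinder chosen at another. *)
have [a1 [m1 [G1 s1 min1]]] := minstop G (@subset_refl _ G) G0.
have [|/set0P E0] := eqVneq (G `\` cyl (mkseq a1 m1)) set0.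
  move=> E0; exists a1, m1, a1, m1; split => // a Ga; left.
  by apply: contrapT => na; have : (G `\` cyl (mkseq a1 m1)) a by []; rewrite E0.
have EG : G `\` cyl (mkseq a1 m1) `<=` G by move=> a [].
have [a2 [m2 [[G2 n12] s2 min2]]] := minstop _ EG E0.
exists a1, m1, a2, m2; split => // a3 G3; apply: contrapT => /not_orP[n13 n23].
have [m3 s3] := Gstop _ G3.
have m12 : (m1 <= m2)%N by exact: min1 s2.
have m23 : (m2 <= m3)%N by apply: min2 s3.
have n21 : ~ cyl (mkseq a2 m2) a1.
  by move=> H; apply: n12; apply: cyl_mkseqC; exact: cyl_mkseq_le H.
have n31 : ~ cyl (mkseq a3 m3) a1.
  move=> H; apply: n13; apply: cyl_mkseqC.
  exact: cyl_mkseq_le (leq_trans m12 m23) H.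
have n32 : ~ cyl (mkseq a3 m3) a2.
  by move=> H; apply: n23; apply: cyl_mkseqC; exact: cyl_mkseq_le H.
(* The cylinder at the middle point omits the outer two, so by convexity it lies between them and
   has diameter at most [r], against the stopping rule. *)
have middle x y z k : G x -> G y -> G z -> stop y k ->
    ~ cyl (mkseq y k) x -> ~ cyl (mkseq y k) z -> pi x <= pi y <= pi z -> False.
  move=> Gx Gy Gz sy nx nz /andP[xy yz].
  have := stop_r _ _ Gy sy; rewrite ltNge => /negP; apply.
  apply: (gc_sup gc) => b c yb yc; have := Gr _ _ Gx Gz; apply: le_trans.
  have yy := cyl_mkseq y k.
  have inside e : cyl (mkseq y k) e -> pi x <= pi e <= pi z.
    move=> ye; apply/andP; split; rewrite leNgt; apply/negP => /ltW h.
      by apply: nx; apply: (gc_convex gc ye yy); rewrite h.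
    by apply: nz; apply: (gc_convex gc yy ye); rewrite yz.
  have /andP[b1 b2] := inside _ yb; have /andP[c1 c2] := inside _ yc.
  rewrite ler_norml distrC; have := ler_norm (pi z - pi x).
  by move=> h; apply/andP; split; lra.
have [h12|h12] := leP (pi a1) (pi a2); have [h23|h23] := leP (pi a2) (pi a3);
  have [h13|h13] := leP (pi a1) (pi a3).
- by apply: (middle a1 a2 a3 m2) => //; rewrite h12.
- by apply: (middle a1 a2 a3 m2) => //; rewrite h12.
- by apply: (middle a1 a3 a2 m3) => //; rewrite h13 ltW.
- by apply: (middle a3 a1 a2 m1) => //; rewrite h12 ltW.
- by apply: (middle a2 a1 a3 m1) => //; rewrite h13 ltW.
- by apply: (middle a2 a3 a1 m3) => //; rewrite h23 ltW.
- by apply: (middle a3 a2 a1 m2) => //; rewrite !ltW.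
- by apply: (middle a3 a2 a1 m2) => //; rewrite !ltW.
Qed.

End lower_dimension.

(** * Lower bound for the dimension of the measure *)

Section lower_bound.
Context {R : realType}.
Variables (pi : (nat -> nat) -> R) (d : seq nat -> R) (C th : R).
Hypothesis gc : geometric_coding pi d C th.
Variables (nu : seq nat -> R) (B s s0 : R).
Variable P : probability (measurableTypeR R) R.
Hypothesis s0s : 0 <= s0 < s.
Hypothesis sum_s0 : (word_sum (fun w => d w `^ s0)%R 1 < +oo)%E.
Hypothesis mpi : forall w, measurable (pi @` cyl w : set (measurableTypeR R)).
Hypothesis nu_ge0 : forall w, 0 <= nu w.
Hypothesis nu_suml : forall w,
  (\esum_(i in [set: nat]) (nu (i :: w))%:E = (nu w)%:E)%E.
Hypothesis PE : forall w, P (pi @` cyl w) = (nu w)%:E.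
Hypothesis P_range : P (range pi) = 1%E.
Hypothesis B_gt0 : 0 < B.
Hypothesis nu_le : forall w, nu w <= B * d w `^ s.

Let C_gt0 : 0 < C. Proof. by have := gc_C gc; lra. Qed.

Let d_gt0 := gc_gt0 gc.

Let mr : measurable (range pi : set (measurableTypeR R)).
Proof. by have := mpi [::]; rewrite cyl0. Qed.

Let mU D : measurable (cyl_union pi D).
Proof. exact: measurable_bigcup_words. Qed.

Lemma esum_words_invariant n w :
  (\esum_(u in words n) (nu (u ++ w))%:E = (nu w)%:E)%E.
Proof.
elim: n w => [|n IH] w.
  by rewrite esum_words0// => u; rewrite lee_fin.
rewrite esum_wordsSr; last by move=> u; rewrite lee_fin.
rewrite -nu_suml; apply: eq_esum => i _; rewrite -IH.
by apply: eq_esum => u _; rewrite cat_rcons.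
Qed.

Lemma prob_cyl_union_le D :
  (P (cyl_union pi D) <= \esum_(w in D) (nu w)%:E)%E.
Proof.
have [D' acD' [D'D <-]] := cyl_union_antichain pi D.
apply: (@le_trans _ _ (\esum_(w in D') (nu w)%:E)%E).
  rewrite [leLHS](measure_cyl_union _ (gc_inj gc) mpi acD').
  by apply: le_esum => w _; rewrite -PE.
rewrite esum_mkcond [leRHS]esum_mkcond; apply: le_esum => w _.
case: ifPn => [/[!inE] /D'D Dw|_]; first by rewrite mem_set.
by case: ifP => // _; rewrite lee_fin.
Qed.

Definition small_letters (kappa rho : R) : set (seq nat) :=
  [set v | exists w i, v = rcons w i /\ d [:: i] < kappa * rho ^+ size w].

(* A Borel-Cantelli estimate, which uses that the sums over the letters still
   converge at the exponent s0 < s. *)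
Lemma small_letters_prob (rho : R) : 0 < rho < 1 ->
  exists2 kappa : R, 0 < kappa <= 1 &
    (P (cyl_union pi (small_letters kappa rho)) < 1)%E.
Proof.
move=> /andP[rho0 rho1]; have /andP[s00 ss] := s0s.
have sp : 0 < s - s0 by rewrite subr_gt0.
pose W := fine (word_sum (fun w => d w `^ s0)%R 1).
have Wfin : (word_sum (fun w => d w `^ s0)%R 1 \is a fin_num)%E.
  by rewrite ge0_fin_numE//; apply: word_sum_ge0 => w; exact: powR_ge0.
have W0 : 0 <= W by rewrite fine_ge0//; apply: word_sum_ge0 => w; exact: powR_ge0.
pose x := rho `^ (s - s0).
have x0 : 0 < x by exact: powR_gt0.
have x1 : x < 1.
  have := @gt0_ltr_powR _ (s - s0) sp rho 1.
  by rewrite !nnegrE ltW// ler01 powR1 => /(_ isT isT rho1).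
pose K := B * W / (1 - x).
have K0 : 0 <= K by rewrite divr_ge0 ?mulr_ge0 ?subr_ge0 ?(ltW B_gt0) ?(ltW x1).
(* The masses of the levels add up to at most the [(s - s0)]-th power of [kappa] times [K], by a
   geometric series of ratio [x]; this [kappa] brings the total below 1. *)
pose kappa := Num.min 1 ((K + 1)^-1 `^ (s - s0)^-1).
have kappa0 : 0 < kappa by rewrite lt_min ltr01/= powR_gt0// invr_gt0 ltr_wpDl.
have kappa1 : kappa <= 1 by rewrite ge_min lexx.
have kK : kappa `^ (s - s0) * K < 1.
  have : kappa `^ (s - s0) <= (K + 1)^-1.
    have -> : (K + 1)^-1 = ((K + 1)^-1 `^ (s - s0)^-1) `^ (s - s0).
      rewrite -powRrM mulVf ?gt_eqF// powRr1// invr_ge0; lra.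
    by apply: powR_le; [exact: ltW|exact: ltW|rewrite ge_min lexx orbT].
  move=> /(ler_wpM2r K0) h; apply: le_lt_trans h _.
  by rewrite mulrC ltr_pdivrMr; lra.
exists kappa; first by rewrite kappa0.
apply: le_lt_trans (prob_cyl_union_le _) _.
pose D n := [set v | exists w i, [/\ size w = n, v = rcons w i &
  d [:: i] < kappa * rho ^+ n]].
rewrite (_ : small_letters _ _ = \bigcup_(n in [set: nat]) D n); last first.
  apply/seteqP; split => [_ [w [i [-> h]]]|_ [n _ [w [i [wn -> h]]]]].
    by exists (size w) => //; exists w, i.
  by exists w, i; split => //; rewrite wn.
rewrite esum_bigcupT; last 2 first.
- move=> m n _ _ [_ [[w [i [<- -> _]]] [w' [i' [<- + _]]]]].
  by move=> /(congr1 size); rewrite !size_rcons => -[].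
- by move=> w; rewrite lee_fin.
rewrite -nneseries_esumT; last by move=> n; apply: esum_ge0 => w _; rewrite lee_fin.
apply: (@le_lt_trans _ _ (\sum_(0 <= n <oo) (B * kappa `^ (s - s0) * W * x ^+ n)%:E)%E); last first.
  apply: le_lt_trans (nneseries_geometric_le _ _) _.
  - by rewrite !mulr_ge0 ?powR_ge0// ltW.
  - by rewrite x0.
  rewrite lte_fin (_ : _ / _ = kappa `^ (s - s0) * K)//.
  by rewrite /K; field; lra.
apply: lee_nneseries => [n _ _|n _]; first by apply: esum_ge0 => w _; rewrite lee_fin.
rewrite esum_mkcond.
apply: (@le_trans _ _ (\esum_(v in words n.+1) (if v \in D n then (nu v)%:E else 0))%E).
  rewrite [leRHS]esum_mkcond; apply: le_esum => v _; case: ifPn => vD; last first.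
    by case: ifP => // _; rewrite (negbTE vD).
  rewrite mem_set//; move: vD; rewrite inE => -[w [i [<- -> _]]].
  by rewrite /words/= size_rcons.
have D0 v : (0 <= if v \in D n then (nu v)%:E else 0)%E.
  by case: ifP => // _; rewrite lee_fin.
rewrite esum_wordsSr//.
apply: (@le_trans _ _ (\esum_(i in [set: nat])
    ((B * kappa `^ (s - s0) * x ^+ n)%:E * (d [:: i] `^ s0)%:E))%E); last first.
  rewrite esumZl; [|by rewrite !mulr_ge0 ?powR_ge0 ?exprn_ge0// ltW
    |by move=> i _; rewrite lee_fin powR_ge0].
  rewrite -(word_sum1E (fun w => d w `^ s0)) -(fineK Wfin) -EFinM lee_fin.
  by rewrite mulrAC.
apply: le_esum => i _.
have [di|di] := ltP (d [:: i]) (kappa * rho ^+ n); last first.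
  rewrite esum1; last first.
    move=> w wn; case: ifPn => //; rewrite inE => -[w' [i' [_ /rcons_inj[_ <-]]]].
    by rewrite ltNge di.
  by rewrite -EFinM lee_fin !mulr_ge0 ?powR_ge0 ?exprn_ge0// ltW.
(* By invariance the letter [i] has mass [nu [:: i]] at every position. In [d [:: i]] to the power
   [s], the part of exponent [s - s0] is controlled by the threshold and the part of exponent [s0]
   is summable over [i]. *)
apply: (@le_trans _ _ (\esum_(w in words n) (nu (w ++ [:: i]))%:E)%E).
  apply: le_esum => w _; rewrite cats1; case: ifP => // _.
  by rewrite lee_fin.
rewrite esum_words_invariant -EFinM lee_fin; apply: (le_trans (nu_le _)).
have -> : s = (s - s0) + s0 by ring.
rewrite powRD; last by rewrite (gt_eqF (d_gt0 _)) implybT.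
rewrite -!mulrA ler_pM2l// mulrA ler_wpM2r ?powR_ge0//.
rewrite addrK -powR_mulrn ?(ltW x0)// /x powRAC powR_mulrn ?(ltW rho0)//.
rewrite -powRM ?(ltW kappa0) ?exprn_ge0 ?(ltW rho0)//.
by apply: powR_le; [exact: ltW|exact/ltW/d_gt0|exact: ltW].
Qed.

(** The digit bound gives [d (mkseq a n) * th' ^+ n <= C / kappa * d (mkseq a n.+1)]. Split the
    exponent as [(s - q) + q]: the decay of [d] on the first part supplies the [q]-th power of
    [th' ^+ n], which is where the formula for [th'] comes from. *)
Lemma good_word_bound (kappa th' q : R) a n : 0 < kappa -> 0 < q < s ->
  th' = th `^ ((s - q) / q) ->
  ~ cyl_union pi (small_letters kappa th') (pi a) ->
  d (mkseq a n) `^ s <= C `^ (s - q) * (C / kappa) `^ q * d (mkseq a n.+1) `^ q.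
Proof.
move=> kappa0 /andP[q0 qs] th'E good; have /andP[th0 th1] := gc_th gc.
have th'0 : 0 < th' by rewrite th'E powR_gt0.
have sq : 0 < s - q by rewrite subr_gt0.
have letter : kappa * th' ^+ n <= d [:: a n].
  rewrite leNgt; apply/negP => h; apply: good.
  exists (mkseq a n.+1); last by exists a => //; exact: cyl_mkseq.
  by exists (mkseq a n), (a n); rewrite mkseqS_rcons size_mkseq.
have step : d (mkseq a n) * th' ^+ n <= C / kappa * d (mkseq a n.+1).
  rewrite (_ : C / kappa * d (mkseq a n.+1) = C * d (mkseq a n.+1) / kappa); last by ring.
  rewrite ler_pdivlMr// -(mulrA (d _)) [_ * kappa]mulrC.
  apply: (@le_trans _ _ (d (mkseq a n) * d [:: a n])); first by rewrite ler_pM2l.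
  by have := gc_super gc (mkseq a n) [:: a n]; rewrite cats1 -mkseqS_rcons.
have {step} : (d (mkseq a n) * th' ^+ n) `^ q <= (C / kappa * d (mkseq a n.+1)) `^ q.
  by apply: powR_le; [exact: ltW|rewrite mulr_ge0 ?exprn_ge0 ?(ltW th'0) ?(ltW (d_gt0 _))|].
rewrite powRM ?exprn_ge0 ?(ltW th'0) ?(ltW (d_gt0 _))//.
rewrite powRM ?divr_ge0 ?(ltW kappa0) ?(ltW C_gt0) ?(ltW (d_gt0 _))//.
move=> step.
have -> : s = (s - q) + q by ring.
rewrite powRD; last by rewrite (gt_eqF (d_gt0 _)) implybT.
rewrite addrK -mulrA.
apply: (@le_trans _ _ (C `^ (s - q) * (d (mkseq a n) `^ q * (th' ^+ n) `^ q))); last first.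
  by rewrite ler_pM2l ?powR_gt0.
rewrite mulrA mulrAC ler_wpM2r ?powR_ge0//.
have -> : (th' ^+ n) `^ q = (th ^+ n) `^ (s - q).
  rewrite -(powR_mulrn n (ltW th'0)) -(powR_mulrn n (ltW th0)) th'E.
  rewrite -!powRrM; congr (_ `^ _); field; exact: lt0r_neq0.
rewrite -powRM ?exprn_ge0 ?(ltW th0) ?(ltW C_gt0)//.
apply: powR_le; [exact: ltW|exact/ltW/d_gt0|].
by have := gc_decay gc (mkseq a n); rewrite size_mkseq.
Qed.

(** Mass distribution principle with an exponent [q] strictly between [t] and [s], applied to the
    part of [Z] made of coded points whose digits are never too small; that part has positive
    mass. *)
Lemma mass_lower_bound (Z : set (measurableTypeR R)) (t : R) : measurable Z ->
  P Z = 1%E -> 0 <= t -> hausdorff_measure t Z = 0%E -> s <= t.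
Proof.
move=> mZ PZ t0 HZ; rewrite leNgt; apply/negP => ts.
have /andP[th0 th1] := gc_th gc.
pose q := (t + s) / 2.
have tq : t < q by rewrite /q; lra.
have qs : q < s by rewrite /q; lra.
have q0 : 0 < q by apply: le_lt_trans tq.
have sq : 0 < s - q by rewrite subr_gt0.
pose rho := th `^ ((s - q) / q).
have rho01 : 0 < rho < 1.
  rewrite powR_gt0//=.
  have e0 : 0 < (s - q) / q by rewrite divr_gt0.
  have := @gt0_ltr_powR _ _ e0 th 1.
  by rewrite !nnegrE (ltW th0) ler01 powR1 => /(_ isT isT th1).
have [kappa /andP[kappa0 _] Pbad] := small_letters_prob rho01.
pose Bad := cyl_union pi (small_letters kappa rho).
pose G : set (nat -> nat) := [set a | ~ Bad (pi a)].
pose K := B * (C `^ (s - q) * (C / kappa) `^ q).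
have K0 : 0 < K by rewrite !mulr_gt0 ?powR_gt0// divr_gt0.
have K2 : 0 < 2 * K by rewrite pmulr_rgt0.
have word a n : G a -> nu (mkseq a n) <= K * d (mkseq a n.+1) `^ q.
  move=> Ga; apply: (le_trans (nu_le _)); rewrite /K -mulrA ler_pM2l//.
  by apply: good_word_bound => //; rewrite q0.
(* A point stops at the last level before its cylinder diameter becomes at most [r]. Two such
   cylinders suffice, and on good points each has mass at most [K] times the [q]-th power of [r].
   The bound [r < d [::]] keeps the stopping level defined. *)
have cover (U : set R) (r : R) : 0 < r < d [::] ->
    (forall x y, U x -> U y -> `|x - y| <= r) ->
    exists V : set (measurableTypeR R), [/\ measurable V,
      U `&` (range pi `\` Bad) `<=` V & (P V <= (2 * K * r `^ q)%:E)%E].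
  move=> /andP[r0 rd] Ur.
  pose E := [set a | U (pi a) /\ G a].
  pose stop (a : nat -> nat) m := r < d (mkseq a m) /\ d (mkseq a m.+1) <= r.
  have [||//|E0|] := @two_cylinders _ _ _ _ _ gc E stop r.
  - move=> a _; have [n Hn] := gc_small gc r0.
    have ex : exists n, d (mkseq a n) <= r.
      by exists n; rewrite ltW// Hn// size_mkseq.
    have [[|m] dm minm] := ex_minnP ex.
      by move: dm; rewrite leNgt rd.
    exists m; split => //; rewrite ltNge; apply/negP => /minm.
    by rewrite ltnn.
  - by move=> a m _ [].
  - by move=> a b [Ua _] [Ub _]; exact: Ur.
  - exists set0; split => //; last first.
      by rewrite measure0 lee_fin !mulr_ge0 ?powR_ge0// ltW.
    move=> x [Ux [[a _ ax] nb]]; have : E a by split; rewrite /G/= ax.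
    by rewrite E0.
  - move=> [a1 [m1 [a2 [m2 [[_ G1] [_ s1] [_ G2] [_ s2] EU]]]]].
    exists (pi @` cyl (mkseq a1 m1) `|` pi @` cyl (mkseq a2 m2)); split.
    + exact: measurableU.
    + move=> x [Ux [[a _ ax] nb]].
      have : E a by split; rewrite /G/= ax.
      by move=> /EU[h|h]; [left|right]; exists a.
    + apply: (le_trans (measureU2 _ (mpi _) (mpi _))).
      have le a m : G a -> d (mkseq a m.+1) <= r -> nu (mkseq a m) <= K * r `^ q.
        move=> Ga dr; apply: (le_trans (word _ _ Ga)); rewrite ler_pM2l//.
        by apply: powR_le => //; [exact: ltW|exact/ltW/d_gt0].
      rewrite [leLHS](_ : _ = (nu (mkseq a1 m1) + nu (mkseq a2 m2))%:E)%E; last first.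
        by rewrite EFinD; congr (_ + _)%E; exact: PE.
      rewrite lee_fin; have := le _ _ G1 s1; have := le _ _ G2 s2; lra.
have mG : measurable (Z `&` (range pi `\` Bad)).
  by apply: measurableI => //; apply: measurableD => //; exact: mU.
have PG : (0 < P (Z `&` (range pi `\` Bad)))%E.
  have mZC := measurableC mZ; have mrC := measurableC mr.
  have PC : P (~` (Z `&` (range pi `\` Bad))) = P Bad.
    have -> : ~` (Z `&` (range pi `\` Bad)) = Bad `|` (~` Z `|` ~` range pi).
      apply/seteqP; split => x.
        move=> nx; have [Bx|Bx] := pselect (Bad x); first by left.
        right; have [Zx|Zx] := pselect (Z x); last by left.
        by right => rx; apply: nx.
      by move=> [Bx [_ [_ ]]|[nz [zx _]|nr [_ []]]].
    rewrite [LHS]measureU0//; [exact: mU|exact: measurableU|].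
    apply: etrans (measureU0 mZC mrC _) _.
      by rewrite [LHS]probability_setC// P_range subee.
    by rewrite [LHS]probability_setC// PZ subee.
  have := probability_setC P mG; rewrite PC => PBE.
  rewrite lt_neqAle measure_ge0 andbT; apply/eqP => P0.
  by move: Pbad; rewrite -/Bad PBE -P0 sube0 ltxx.
pose p := fine (P (Z `&` (range pi `\` Bad))).
have pE : P (Z `&` (range pi `\` Bad)) = p%:E by rewrite fineK// fin_num_measure.
have p0 : 0 < p by rewrite -lte_fin -pE.
(* Twice [e] will enter with the factor [2 * K]: the cover has total at most [e], and the extra
   terms of the series add another [e]. This yields [p <= p / 2]. *)
pose e := p / (8 * K).
have e0 : 0 < e by rewrite divr_gt0// pmulr_rgt0.
pose delta := Num.min 1 (d [::] / 2).
have delta0 : 0 < delta by rewrite lt_min ltr01 divr_gt0//; exact: d_gt0.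
have : (hausdorff_premeasure t delta Z < e%:E)%E.
  apply: (@le_lt_trans _ _ (hausdorff_measure t Z)); last by rewrite HZ lte_fin.
  by apply: ereal_sup_ubound; exists delta => //=; rewrite in_itv/= andbT.
move=> /ereal_inf_lt[_ [U [ZU Ud ->]] Ue].
have delta_d r : r <= delta -> r < d [::].
  by rewrite le_min => /andP[_]; have := d_gt0 [::]; lra.
have ex i : exists V : set (measurableTypeR R), [/\ measurable V,
    U i `&` (range pi `\` Bad) `<=` V &
    (P V <= (2 * K)%:E * (diam_pow t (U i) + (e / (2 ^ i.+1)%:R)%:E))%E].
  have ei0 : 0 < e / (2 ^ i.+1)%:R by rewrite divr_gt0// ltr0n expn_gt0.
  have [->|/set0P[x Ux]] := eqVneq (U i) set0.
    exists set0; rewrite set0I; split => //.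
    rewrite measure0; apply: mule_ge0.
      by rewrite lee_fin ltW.
    by apply: adde_ge0; [exact: diam_pow_ge0|rewrite lee_fin ltW].
  have := Ud i; have := diam_ge0 Ux; have := @le_diam _ (U i).
  rewrite /diam_pow (negbTE (introN eqP _)); last first.
    by move=> U0; rewrite U0 in Ux.
  case: (diam (U i)) => [r||]//= Ur; rewrite !lee_fin => r0 rdelta.
  have {}Ur x' y' : U i x' -> U i y' -> `|x' - y'| <= r.
    by move=> h1 h2; have := Ur _ _ h1 h2; rewrite lee_fin.
  have [rp|rn] := ltP 0 r.
    have [|V [mV UV PV]] := cover (U i) r _ Ur; first by rewrite rp delta_d.
    exists V; split => //; apply: (le_trans PV).
    rewrite -EFinD -EFinM lee_fin (ler_pM2l K2).
    apply: (@le_trans _ _ (r `^ t)); last by rewrite lerDl ltW.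
    apply: ger_powR; last exact: ltW.
    rewrite rp/=; apply: (le_trans rdelta); by rewrite ge_min lexx.
  (* [cover] needs a positive radius. A set of diameter 0 gets one small enough for its bound to fit
     into the [i]-th extra term. *)
  pose r' := Num.min delta ((e / (2 ^ i.+1)%:R) `^ q^-1).
  have r'0 : 0 < r' by rewrite lt_min delta0 powR_gt0.
  have [||V [mV UV PV]] := cover (U i) r'.
  - by rewrite r'0 delta_d// ge_min lexx.
  - move=> x' y' h1 h2; apply: (le_trans (Ur _ _ h1 h2)).
    by apply: (le_trans rn); exact: ltW.
  exists V; split => //; apply: (le_trans PV).
  rewrite -EFinD -EFinM lee_fin (ler_pM2l K2).
  apply: (@le_trans _ _ (e / (2 ^ i.+1)%:R)); last by rewrite lerDr powR_ge0.
  have -> : e / (2 ^ i.+1)%:R = ((e / (2 ^ i.+1)%:R) `^ q^-1) `^ q.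
    by rewrite -powRrM mulVf ?gt_eqF// powRr1// ltW.
  by apply: powR_le; [exact: ltW|exact: ltW|rewrite ge_min lexx orbT].
have /choice[V HV] := ex.
have : (p%:E <= (2 * K)%:E * (e%:E + e%:E))%E.
  rewrite -pE; apply: (@le_trans _ _ (\sum_(0 <= i <oo) P (V i))%E).
    apply: measure_sigma_subadditive => //; first by move=> i; have [] := HV i.
    move=> x [/ZU[i _ Ux] Gx]; exists i => //; have [_ + _] := HV i.
    by apply; split.
  apply: (@le_trans _ _ (\sum_(0 <= i <oo) (2 * K)%:E * (diam_pow t (U i) + (e / (2 ^ i.+1)%:R)%:E))%E).
    by apply: lee_nneseries => [i _ _|i _]; [exact: measure_ge0|have [] := HV i].
  rewrite nneseriesZl; last first.
    move=> i _; apply: adde_ge0; first exact: diam_pow_ge0.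
    by rewrite lee_fin divr_ge0// ltW.
  rewrite lee_wpmul2l ?lee_fin ?(ltW K2)//.
  apply: le_trans (epsilon_trick _ _ (ltW e0)) _; first by move=> i; exact: diam_pow_ge0.
  by apply: leeD2r; exact: ltW.
rewrite -EFinD -EFinM lee_fin leNgt => /negP; apply.
rewrite (_ : _ * (e + e) = p / 2); first by lra.
by rewrite /e; field; exact: lt0r_neq0.
Qed.

End lower_bound.

(** * Geometry of the coding *)

Section branches.
Context {R : realType}.
Variable T : interval_map R.
Hypothesis hT : is_emr T.

Definition branch i : set R := `]lend T i, rend T i[%classic.

Lemma branch_uniq i j x : branch i x -> branch j x -> i = j.
Proof. by move=> xi xj; apply: (emr_disjoint hT) => //; exists x. Qed.

Lemma branch_intdom i x : branch i x -> intdom T x.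
Proof. by exists i. Qed.

Lemma branch_dom i x : branch i x -> dom T x.
Proof.
move=> xi; exists i => //; move: xi; rewrite /branch/= !in_itv/=.
by move=> /andP[/ltW -> /ltW ->].
Qed.

Lemma branch_range i x : branch i x -> 0 <= T x <= 1.
Proof. by move=> /branch_dom; exact: (emr_range hT). Qed.

Lemma branch_between i x y z : branch i x -> branch i y -> x <= z <= y ->
  branch i z.
Proof.
rewrite /branch/= !in_itv/= => /andP[x1 _] /andP[_ y2] /andP[xz zy].
by rewrite (lt_le_trans x1 xz) (le_lt_trans zy y2).
Qed.

Lemma branch_derive i x : branch i x -> is_derive x 1 T (T^`() x).
Proof.
move=> /branch_intdom/(emr_C2 hT)[dT _ _].
by rewrite derive1E; exact/derivableP.
Qed.

Lemma branch_derive2 i x : branch i x -> is_derive x 1 (T^`()) (T^`(2) x).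
Proof.
move=> /branch_intdom/(emr_C2 hT)[_ dT _].
by rewrite /derive1n/= derive1E; exact/derivableP.
Qed.

Lemma branch_derive_neq0 i x : branch i x -> T^`() x != 0.
Proof. by have [K [_ HK]] := emr_renyi hT => xi; have [] := HK i x x x xi xi xi. Qed.

Lemma branch_continuous i : {within branch i, continuous T}.
Proof.
apply: (@derivable_within_continuous _ _ T) => x xi.
by have [dT _ _] := emr_C2 hT (branch_intdom xi).
Qed.

Lemma branch_MVT (g dg : R -> R) i x y : branch i x -> branch i y -> x < y ->
  (forall z, branch i z -> is_derive z 1 g (dg z)) ->
  exists2 c, x < c < y & g y - g x = dg c * (y - x).
Proof.
move=> xi yi xy g'.
have inside z : x <= z <= y -> branch i z by exact: branch_between.
have der z : z \in `]x, y[%R -> is_derive z 1 g (dg z).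
  by rewrite in_itv/= => /andP[/ltW xz /ltW zy]; apply/g'/inside; rewrite xz.
have cont : {within `[x, y], continuous g}.
  apply: derivable_within_continuous => z; rewrite in_itv/= => /inside /g'.
  by case.
have [c + E] := MVT xy der cont.
by rewrite in_itv/= => cxy; exists c.
Qed.

Lemma branch_inj i x y : branch i x -> branch i y -> T x = T y -> x = y.
Proof.
move=> xi yi Txy; apply/eqP; rewrite eq_le !leNgt; apply/andP; split; apply/negP.
  move=> yx; have [c /andP[/ltW c1 /ltW c2]] := branch_MVT yi xi yx (@branch_derive i).
  rewrite Txy subrr => /esym/eqP; rewrite mulf_eq0 subr_eq0 (gt_eqF yx) orbF.
  by apply/negP/(@branch_derive_neq0 i)/(branch_between yi xi); rewrite c1.
move=> xy; have [c /andP[/ltW c1 /ltW c2]] := branch_MVT xi yi xy (@branch_derive i).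
rewrite Txy subrr => /esym/eqP; rewrite mulf_eq0 subr_eq0 (gt_eqF xy) orbF.
by apply/negP/(@branch_derive_neq0 i)/(branch_between xi yi); rewrite c1.
Qed.

Lemma branch_monotone i : {in branch i &, {mono T : x y / x <= y}} \/
  {in branch i &, {mono T : x y /~ x <= y}}.
Proof.
have inj : {in branch i &, injective T}.
  by move=> x y; rewrite !inE; exact: branch_inj.
have [_ [lr _]] := emr_itv hT i.
pose p := lend T i + (rend T i - lend T i) / 3.
pose q := lend T i + 2 * (rend T i - lend T i) / 3.
have pi : p \in `]lend T i, rend T i[%R by rewrite in_itv/=; apply/andP; split; rewrite /p; lra.
have qi : q \in `]lend T i, rend T i[%R by rewrite in_itv/=; apply/andP; split; rewrite /q; lra.
have pq : p < q by rewrite /p /q; lra.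
have inj' : {in `]lend T i, rend T i[%R &, injective T}.
  by move=> x y xi yi; exact: (@branch_inj i x y xi yi).
have [h|/ltW h] := leP (T p) (T q); [left|right] => x y; rewrite !inE => xi yi.
  apply: (@itv_continuous_inj_le _ T `]lend T i, rend T i[%R) => //; last exact: branch_continuous.
  by exists p, q.
apply: (@itv_continuous_inj_ge _ T `]lend T i, rend T i[%R) => //; last exact: branch_continuous.
by exists p, q.
Qed.

Lemma branch_between_image i x y z : branch i x -> branch i y -> x <= z <= y ->
  (T x <= T z <= T y) \/ (T y <= T z <= T x).
Proof.
move=> xi yi xzy; have zi := branch_between xi yi xzy.
by have [m|m] := branch_monotone i; [left|right]; rewrite !m ?inE// andbC.
Qed.

(* Cauchy's mean value theorem for ln (T' ^ 2) against T: by the Renyi condition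
   the quotient of the derivatives is bounded. *)
Lemma branch_distortion : exists2 K : R, 0 < K & forall i x y,
  branch i x -> branch i y ->
  `|T^`() x| <= expR (K * `|T x - T y|) * `|T^`() y|.
Proof.
have [K [K0 HK]] := emr_renyi hT; exists K => // i.
(* The square stands for the absolute value, so the sign of the derivative is immaterial and the
   chain rule applies directly. *)
pose G z := ln (derive1 T z * derive1 T z).
have pos (z : R) : branch i z -> 0 < derive1 T z * derive1 T z.
  by move=> /branch_derive_neq0 h; rewrite -expr2 lt0r sqrf_eq0 h sqr_ge0.
have G' (z : R) : branch i z -> is_derive z 1 G (2 * derive1n 2 T z / derive1 T z).
  move=> zi; have n0 := branch_derive_neq0 zi.
  have dX := is_deriveM (branch_derive2 zi) (branch_derive2 zi).
  have dl := is_derive1_ln (pos _ zi).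
  have dG := is_derive1_comp (g := derive1 T * derive1 T) dl dX.
  apply: (is_derive_eq (df := _) dG).
  by rewrite /GRing.scale/=; field.
suff main x y : branch i x -> branch i y -> x < y ->
    `|G x - G y| <= 2 * K * `|T x - T y|.
  move=> x y xi yi.
  have {main} : `|G x - G y| <= 2 * K * `|T x - T y|.
    have [xy|yx|->] := ltgtP x y; first exact: main.
      by rewrite distrC (distrC (T x)); exact: main.
    by rewrite !subrr !normr0 mulr0.
  rewrite ler_norml => /andP[_]; rewrite lerBlDr -ler_expR expRD.
  rewrite /G !lnK ?posrE ?(pos _ xi) ?(pos _ yi)// -mulrA expRM_natl.
  rewrite -!expr2 -real_normK ?num_real// -[X in _ * X]real_normK ?num_real// -exprMn.
  by rewrite ler_sqr// ?nnegrE// mulr_ge0// expR_ge0.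
move=> xi yi xy.
(* [F] has equal values at [x] and [y]. At the mean value point the increments of [G] and [T] are in
   the ratio of their derivatives, bounded by [2 * K]. *)
pose F z := (T y - T x) * G z - (G y - G x) * T z.
have F' (z : R) : branch i z -> is_derive z 1 F
    ((T y - T x) * (2 * derive1n 2 T z / derive1 T z) - (G y - G x) * derive1 T z).
  move=> zi.
  exact: (is_deriveB (is_deriveZ (T y - T x) (G' _ zi))
    (is_deriveZ (G y - G x) (branch_derive zi))).
have [c /andP[/ltW c1 /ltW c2]] := branch_MVT xi yi xy F'.
have ci : branch i c by apply: (branch_between xi yi); rewrite c1.
have -> : F y - F x = 0 by rewrite /F; ring.
move=> /esym/eqP; rewrite mulf_eq0 [y - x == 0]subr_eq0 (gt_eqF xy) orbF subr_eq0 => /eqP E.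
have n0 := branch_derive_neq0 ci.
have [_ _ HKc] := HK i c c c ci ci ci.
have -> : G x - G y = (2 * derive1n 2 T c / (derive1 T c * derive1 T c)) * (T x - T y).
  have -> : G x - G y = - ((G y - G x) * derive1 T c / derive1 T c) by field.
  by rewrite -E; field.
rewrite normrM ler_wpM2r// normrM normfV [X in X / _]normrM (ger0_norm (ler0n _ 2)) normrM.
by rewrite -mulrA ler_pM2l.
Qed.

End branches.

(** * Cylinders and their diameters *)

Section coding.
Context {R : realType}.
Variable T : interval_map R.
Hypothesis hT : is_emr T.
Variable pi : (nat -> nat) -> R.
Hypothesis hpi : full_shift_coding T (pi : full_shift -> R).

Lemma coding_inj : injective pi.
Proof. by have [[_ _ [g piK _]] _ _] := hpi; exact: can_inj piK. Qed.

Lemma coding_range : range pi = repeller T `\` pre_endpoints T.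
Proof. by have [[_ + _] _ _] := hpi. Qed.

Lemma coding_step a : T (pi a) = pi (fun n => a n.+1).
Proof. by have [_ + _] := hpi => /(_ a). Qed.

Lemma coding_iter k a : iter k T (pi a) = pi (fun n => a (k + n)%N).
Proof.
elim: k => [//|k IH]; rewrite iterS IH coding_step; congr pi.
by apply/funext => n; rewrite addSnnS.
Qed.

(** Coded points avoid the endpoints, so the closed interval in the coding can be replaced by its
    interior, where derivatives exist. *)
Lemma coding_branch a : branch T (a 0%N) (pi a).
Proof.
have [_ _ /(_ a)] := hpi; rewrite /branch/= !in_itv/= => /andP[h1 h2].
have [_ ne] : (repeller T `\` pre_endpoints T) (pi a) by rewrite -coding_range; exists a.
have nend : ~ endpoints T (pi a) by move=> e; apply: ne; exists 0%N.
rewrite !lt_neqAle h1 h2 !andbT; apply/andP; split; apply/eqP => e; apply: nend.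
  by left; exists (a 0%N).
by right; exists (a 0%N).
Qed.

Lemma coding_branch_iter k a : branch T (a k) (iter k T (pi a)).
Proof. by rewrite coding_iter; have := coding_branch (fun n => a (k + n)%N); rewrite addn0. Qed.

Lemma coding_01 a : 0 <= pi a <= 1.
Proof.
have := coding_branch a; rewrite /branch/= in_itv/= => /andP[h1 h2].
have [l0 [_ r1]] := emr_itv hT (a 0%N).
by rewrite (le_trans l0 (ltW h1)) (le_trans (ltW h2) r1).
Qed.

Lemma cyl_cons i w a : cyl (i :: w) a <-> a 0%N = i /\ cyl w (fun n => a n.+1).
Proof.
by rewrite -cat1s cyl_cat /cyl /mkseq/=; split => [[[] ? ?]|[-> ?]].
Qed.

(** Induction on the word: an open interval is convex, and a branch is monotone, so it preserves or
    reverses betweenness. *)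
Lemma coding_convex w a b c : cyl w a -> cyl w b -> pi a <= pi c <= pi b ->
  cyl w c.
Proof.
elim: w a b c => [|i w IH] a b c; first by rewrite cyl0.
move=> /cyl_cons[a0 aw] /cyl_cons[b0 bw] acb.
have ai : branch T i (pi a) by rewrite -a0; exact: coding_branch.
have bi : branch T i (pi b) by rewrite -b0; exact: coding_branch.
apply/cyl_cons; split.
  apply: (branch_uniq hT (coding_branch c)).
  exact: (branch_between ai bi acb).
by have [] := branch_between_image hT ai bi acb; rewrite !coding_step; exact: IH.
Qed.

Definition cyl_diam w : R :=
  sup [set r | exists a b, [/\ cyl w a, cyl w b & r = `|pi a - pi b|]].

Definition word_seq (w : seq nat) (a : nat -> nat) : nat -> nat :=
  fun n => if (n < size w)%N then nth 0%N w n else a (n - size w)%N.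

Lemma cyl_word_seq w a : cyl w (word_seq w a).
Proof.
rewrite /cyl/=; apply: (@eq_from_nth _ 0%N); first by rewrite size_mkseq.
by move=> i; rewrite size_mkseq => iw; rewrite nth_mkseq// /word_seq iw.
Qed.

Lemma word_seq_shift w a : (fun n => word_seq w a (size w + n)%N) = a.
Proof.
by apply/funext => n; rewrite /word_seq ltnNge leq_addr/= addKn.
Qed.

Lemma coding_dist1 a b : `|pi a - pi b| <= 1.
Proof.
have /andP[a0 a1] := coding_01 a; have /andP[b0 b1] := coding_01 b.
by rewrite ler_norml; apply/andP; split; lra.
Qed.

Lemma cyl_diam_has_sup w :
  has_sup [set r | exists a b, [/\ cyl w a, cyl w b & r = `|pi a - pi b|]].
Proof.
split.
  exists `|pi (word_seq w id) - pi (word_seq w id)|.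
  by exists (word_seq w id), (word_seq w id); split => //; exact: cyl_word_seq.
by exists 1 => _ [a [b [_ _ ->]]]; exact: coding_dist1.
Qed.

Lemma cyl_diam_dist w a b : cyl w a -> cyl w b -> `|pi a - pi b| <= cyl_diam w.
Proof.
move=> aw bw; apply: sup_upper_bound; first exact: cyl_diam_has_sup.
by exists a, b.
Qed.

Lemma cyl_diam_le w r :
  (forall a b, cyl w a -> cyl w b -> `|pi a - pi b| <= r) -> cyl_diam w <= r.
Proof.
move=> H; apply: ge_sup; first by have [] := cyl_diam_has_sup w.
by move=> _ [a [b [aw bw ->]]]; exact: H.
Qed.

(** Two different continuations of [w] have different codes, and [pi] is injective. *)
Lemma cyl_diam_gt0 w : 0 < cyl_diam w.
Proof.
have := @cyl_diam_dist w (word_seq w (fun=> 0%N)) (word_seq w (fun=> 1%N))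
  (cyl_word_seq _ _) (cyl_word_seq _ _).
apply: lt_le_trans; rewrite normr_gt0 subr_eq0; apply/eqP => /coding_inj.
move=> /(congr1 (fun a => (fun n => a (size w + n)%N))).
by rewrite !word_seq_shift => /(congr1 (fun a => a 0%N)).
Qed.

Lemma cyl_diam_le1 w : cyl_diam w <= 1.
Proof. by apply: cyl_diam_le => a b _ _; exact: coding_dist1. Qed.

Lemma iter_derivable n x : (forall k, (k < n)%N -> intdom T (iter k T x)) ->
  derivable (iter n T) x 1.
Proof.
suff H : (forall k, (k < n)%N -> intdom T (iter k T x)) ->
    exists df, is_derive x 1 (iter n T) df by move=> /H[df []].
elim: n => [|n IH] dx; first by exists 1; exact: is_derive_id.
have [k kn|df hdf] := IH; first by apply: dx; rewrite ltnS ltnW.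
have [i _ ni] := dx n (ltnSn n).
exists (derive1 T (iter n T x) * df).
exact: (is_derive1_comp (branch_derive hT ni) hdf).
Qed.

(** Here [x] need not be a coded point: the mean value theorem for an iterate requires the whole
    segment to follow the word. *)
Lemma cyl_convex_branch w a b x : cyl w a -> cyl w b -> pi a <= x <= pi b ->
  forall k, (k < size w)%N -> branch T (nth 0%N w k) (iter k T x).
Proof.
elim: w a b x => [//|i w IH] a b x /cyl_cons[a0 aw] /cyl_cons[b0 bw] axb.
have ai : branch T i (pi a) by rewrite -a0; exact: coding_branch.
have bi : branch T i (pi b) by rewrite -b0; exact: coding_branch.
case=> [|k]; first by move=> _; exact: (branch_between ai bi axb).
rewrite ltnS iterSr => kw /=.
by have [] := branch_between_image hT ai bi axb; rewrite !coding_step => h;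
  apply: IH h _ kw.
Qed.

(** The iterate of order [size w] maps two points of a cylinder to points at distance at most 1,
    with derivative above [xi ^+ size w] in between. For words shorter than [N] the factor [xi ^+ N]
    makes the bound trivial. *)
Lemma cyl_diam_decay : exists C th : R,
  [/\ 1 <= C, 0 < th < 1 & forall w, cyl_diam w <= C * th ^+ size w].
Proof.
have [xi [N [xi1 Hxi]]] := emr_expanding hT.
have xi0 : 0 < xi by lra.
have Xge1 n : 1 <= xi ^+ n by rewrite exprn_ege1// ltW.
exists (xi ^+ N), xi^-1; split => //.
  by rewrite invr_gt0 xi0 invf_lt1.
move=> w; have [Nw|wN] := leqP N (size w); last first.
  apply: (le_trans (cyl_diam_le1 w)).
  rewrite exprVn ler_pdivlMr ?exprn_gt0// mul1r.
  by rewrite ler_eXn2l// ltnW.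
apply: (@le_trans _ _ (xi^-1 ^+ size w)); last first.
  by rewrite ler_peMl// exprn_ge0// invr_ge0 ltW.
apply: cyl_diam_le.
suff main a b : cyl w a -> cyl w b -> pi a < pi b ->
    `|pi a - pi b| <= xi^-1 ^+ size w.
  move=> a b aw bw; have [ab|ba|->] := ltgtP (pi a) (pi b); first exact: main.
    by rewrite distrC; exact: main.
  by rewrite subrr normr0 exprn_ge0// invr_ge0 ltW.
move=> aw bw ab.
have inside x : pi a <= x <= pi b ->
    forall k, (k < size w)%N -> intdom T (iter k T x).
  by move=> axb k kw; exists (nth 0%N w k) => //; exact: (cyl_convex_branch aw bw axb).
have der x : x \in `]pi a, pi b[%R ->
    is_derive x 1 (iter (size w) T) (derive1 (iter (size w) T) x).
  rewrite in_itv/= => /andP[/ltW c1 /ltW c2]; rewrite derive1E; apply: derivableP.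
  by apply: iter_derivable; apply: inside; rewrite c1.
have cont : {within `[pi a, pi b], continuous (iter (size w) T)}.
  apply: derivable_within_continuous => x; rewrite in_itv/= => axb.
  by apply: iter_derivable; exact: inside.
have [c + E] := MVT ab der cont.
rewrite in_itv/= => /andP[/ltW c1 /ltW c2].
have cab : pi a <= c <= pi b by rewrite c1.
have := Hxi c _ Nw (inside _ cab).
move: E; rewrite !coding_iter => E /ltW H.
have := coding_dist1 (fun n => b (size w + n)%N) (fun n => a (size w + n)%N).
rewrite E normrM => D.
rewrite exprVn -[leRHS]mul1r ler_pdivlMr ?exprn_gt0// distrC mulrC.
by apply: le_trans D; rewrite ler_wpM2r.
Qed.

End coding.

(** * Bounded distortion along words *)

Section coding_geometry.
Context {R : realType}.
Variable T : interval_map R.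
Hypothesis hT : is_emr T.
Variable pi : (nat -> nat) -> R.
Hypothesis hpi : full_shift_coding T (pi : full_shift -> R).

Let d := cyl_diam pi.

(** The position of [T c] is recorded because the distortion of a branch is measured by distances of
    images, here [T c] and [T c'] for two pairs of points. *)
Lemma branch_MVT_abs i x y : branch T i x -> branch T i y ->
  exists c, [/\ branch T i c, `|T x - T y| = `|derive1 T c| * `|x - y| &
    (T x <= T c <= T y) \/ (T y <= T c <= T x)].
Proof.
wlog : x y / x <= y => [H xi yi|].
  have [xy|/ltW yx] := leP x y; first exact: H.
  have [c [ci E b]] := H _ _ yx yi xi; exists c; split => //.
    by rewrite distrC E distrC.
  by case: b; [right|left].
rewrite le_eqVlt => /predU1P[<-|xy] xi yi.
  by exists x; split => //; [rewrite !subrr normr0 mulr0|left; rewrite lexx].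
have [c /andP[/ltW c1 /ltW c2] E] := branch_MVT xi yi xy (@branch_derive _ _ hT i).
have xcy : x <= c <= y by rewrite c1.
exists c; split; first exact: (branch_between xi yi xcy).
  by rewrite distrC E normrM [`|x - y|]distrC.
exact: (branch_between_image hT xi yi xcy).
Qed.

Lemma hull_dist w a b a' b' p q : cyl w a -> cyl w b -> cyl w a' -> cyl w b' ->
  (pi a <= p <= pi b) \/ (pi b <= p <= pi a) ->
  (pi a' <= q <= pi b') \/ (pi b' <= q <= pi a') -> `|p - q| <= d w.
Proof.
wlog ab : a b / pi a <= p <= pi b => [H aw bw a'w b'w [h|h] h'|].
- by apply: (H a b) => //; left.
- by apply: (H b a) => //; left.
wlog a'b' : a' b' / pi a' <= q <= pi b' => [H aw bw a'w b'w h [h'|h']|].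
- by apply: (H a' b') => //; left.
- by apply: (H b' a') => //; left.
move=> aw bw a'w b'w _ _; have /andP[p1 p2] := ab; have /andP[q1 q2] := a'b'.
have h1 := cyl_diam_dist hT hpi bw a'w; have h2 := cyl_diam_dist hT hpi b'w aw.
rewrite ler_norml -/d; apply/andP; split.
  by have := ler_norm (pi b' - pi a); rewrite /d; lra.
by have := ler_norm (pi b - pi a'); rewrite /d; lra.
Qed.

Let dist (a b : nat -> nat) : R := `|pi a - pi b|.
Let sh n (a : nat -> nat) : nat -> nat := fun k => a (n + k)%N.

(* Bounded distortion along a word, expressed with difference quotients instead
   of derivatives of the iterates; the logarithms of the distortions of the
   successive branches are dominated by a geometric series. *)
Lemma ratio_distortion : exists2 D : R, 0 < D & forall u a b a' b',
  cyl u a -> cyl u b -> cyl u a' -> cyl u b' ->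
  dist (sh (size u) a) (sh (size u) b) * dist a' b' <=
  D * (dist a b * dist (sh (size u) a') (sh (size u) b')).
Proof.
have [K K0 HK] := branch_distortion hT.
have [C [th [C1 /andP[th0 th1] dth]]] := cyl_diam_decay hT hpi.
have C0 : 0 <= C by lra.
exists (expR (K * (C / (1 - th)))); first exact: expR_gt0.
suff main u a b a' b' : cyl u a -> cyl u b -> cyl u a' -> cyl u b' ->
  dist (sh (size u) a) (sh (size u) b) * dist a' b' <=
  expR (K * \sum_(j < size u) C * th ^+ j) *
  (dist a b * dist (sh (size u) a') (sh (size u) b')).
  move=> u a b a' b' ua ub ua' ub'; apply: (le_trans (main _ _ _ _ _ ua ub ua' ub')).
  rewrite ler_wpM2r ?mulr_ge0 ?normr_ge0// ler_expR ler_pM2l//.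
  rewrite -mulr_sumr ler_wpM2l// -[leRHS]mul1r ler_pdivlMr ?subr_gt0//.
  have := subrX1 th (size u) => H.
  rewrite mulrC -opprB mulNr -H opprB.
  by rewrite lerBlDr lerDl exprn_ge0// ltW.
elim: u a b a' b' => [|i v IH] a b a' b'.
  by move=> _ _ _ _; rewrite big_ord0 mulr0 expR0 mul1r mulrC.
move=> /cyl_cons[a0 av] /cyl_cons[b0 bv] /cyl_cons[a'0 a'v] /cyl_cons[b'0 b'v].
have sh1 e : sh (size v) (fun n => e n.+1) = sh (size (i :: v)) e.
  by apply/funext => k; rewrite /sh /= addSn.
have := IH _ _ _ _ av bv a'v b'v; rewrite !sh1 => {IH}.
have bi e : e 0%N = i -> branch T i (pi e).
  by move=> <-; exact: (coding_branch hpi).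
have [c [ci Ec bc]] := branch_MVT_abs (bi _ a0) (bi _ b0).
have [c' [c'i Ec' bc']] := branch_MVT_abs (bi _ a'0) (bi _ b'0).
rewrite !(coding_step hpi) in Ec bc Ec' bc'.
(* Both image points lie in the hull of the cylinder of [v], so this branch adds one term of the
   geometric series. *)
have cc' : `|T c - T c'| <= C * th ^+ size v.
  apply: (le_trans (hull_dist av bv a'v b'v bc bc')); exact: dth.
have {HK} := HK _ _ _ ci c'i.
set X := dist a b; set X' := dist a' b'.
set Y := dist (fun n => a n.+1) (fun n => b n.+1).
set Y' := dist (fun n => a' n.+1) (fun n => b' n.+1).
set Z := dist (sh _ a) _; set Z' := dist (sh _ a') _.
rewrite -/(dist _ _) -/Y -/(dist _ _) -/X in Ec.
rewrite -/(dist _ _) -/Y' -/(dist _ _) -/X' in Ec'.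
move=> h1 h2.
rewrite big_ord_recr/= mulrDr expRD.
set e2 := expR (K * \sum_(j < size v) _) in h2 *.
set e1 := expR (K * (C * _)).
have h1' : `|derive1 T c| <= e1 * `|derive1 T c'|.
  apply: (le_trans h1); rewrite ler_wpM2r// ler_expR ler_pM2l//.
have e1p : 0 <= e1 by exact: expR_ge0.
have e2p : 0 <= e2 by exact: expR_ge0.
have h3 : Y * X' <= e1 * (X * Y').
  rewrite Ec Ec' (_ : e1 * _ = (e1 * `|derive1 T c'|) * (X * X')); last by ring.
  by rewrite -[leLHS]mulrA ler_wpM2r// mulr_ge0// normr_ge0.
have X0 : 0 <= X by exact: normr_ge0.
have X'0 : 0 <= X' by exact: normr_ge0.
have Z0 : 0 <= Z by exact: normr_ge0.
have Z'0 : 0 <= Z' by exact: normr_ge0.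
have Y0 : 0 <= Y by exact: normr_ge0.
have Y'0 : 0 <= Y' by exact: normr_ge0.
(* The two estimates are multiplied and [Y * Y'] is cancelled, so coincident points are treated
   apart. *)
have [YE|Yn] := eqVneq Y 0.
  have ZE : Z = 0.
    move/eqP: YE; rewrite normr_eq0 subr_eq0 => /eqP/(coding_inj hpi) ab.
    by rewrite /Z -!sh1 ab /dist subrr normr0.
  by rewrite ZE mul0r !mulr_ge0.
have [Y'E|Y'n] := eqVneq Y' 0.
  have -> : X' = 0.
    move: Y'E; rewrite Ec' => /eqP; rewrite mulf_eq0 normr_eq0.
    by rewrite (negbTE (branch_derive_neq0 hT c'i)) => /eqP.
  by rewrite mulr0 !mulr_ge0.
have YYp : 0 < Y * Y' by rewrite mulr_gt0// lt0r ?Yn ?Y'n.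
rewrite -(ler_pM2l YYp).
rewrite (_ : Y * Y' * (Z * X') = (Z * Y') * (Y * X')); last by ring.
rewrite (_ : Y * Y' * _ = (e2 * (Y * Z')) * (e1 * (X * Y'))); last by ring.
by apply: ler_pM => //; rewrite mulr_ge0.
Qed.

(** In [ratio_distortion] one pair consists of two chosen continuations of [u]: the two constant
    sequences, at distance [h], for submultiplicativity, and two points of the cylinder of [v] for
    supermultiplicativity. The constant [M] dominates the three that arise. *)
Lemma coding_geometric : exists C th, geometric_coding pi d C th.
Proof.
have [D D0 ratio] := ratio_distortion.
have [C [th [C1 th01 dth]]] := cyl_diam_decay hT hpi.
pose h := dist (fun=> 0%N) (fun=> 1%N).
have h0 : 0 < h.
  rewrite normr_gt0 subr_eq0; apply/eqP => /(coding_inj hpi).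
  by move=> /(congr1 (fun a => a 0%N)).
have sh_word u a : sh (size u) (word_seq u a) = a by exact: word_seq_shift.
have d0 w : 0 < d w by exact: (cyl_diam_gt0 hT hpi).
have catP u v a : cyl v a -> cyl (u ++ v) (word_seq u a).
  by move=> va; apply/cyl_cat; split; [exact: cyl_word_seq|rewrite word_seq_shift].
have sub u v : d (u ++ v) <= D / h * (d u * d v).
  apply: (cyl_diam_le hT hpi) => a b /cyl_cat[ua va] /cyl_cat[ub vb].
  have := ratio _ _ _ _ _ (cyl_word_seq u (fun=> 0%N)) (cyl_word_seq u (fun=> 1%N)) ua ub.
  rewrite !sh_word -/h => H.
  rewrite mulrAC ler_pdivlMr// mulrC; apply: (le_trans H).
  rewrite ler_pM2l//; apply: ler_pM; rewrite ?normr_ge0//.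
    by apply: (cyl_diam_dist hT hpi); exact: cyl_word_seq.
  exact: (cyl_diam_dist hT hpi).
have super u v : d u * d v <= D * d (u ++ v).
  rewrite mulrC -ler_pdivlMr//; apply: (cyl_diam_le hT hpi) => a b va vb.
  rewrite ler_pdivlMr//.
  have [E|ab0] := eqVneq (dist a b) 0.
    by rewrite [`|_|]E mul0r mulr_ge0// ltW.
  have abp : 0 < dist a b by rewrite lt0r ab0 normr_ge0.
  rewrite mulrC -ler_pdivlMr//; apply: (cyl_diam_le hT hpi) => a' b' ua' ub'.
  rewrite ler_pdivlMr// mulrC.
  have := ratio _ _ _ _ _ (cyl_word_seq u a) (cyl_word_seq u b) ua' ub'.
  rewrite !sh_word => H; apply: (le_trans H); rewrite ler_pM2l//.
  rewrite -[leRHS]mulr1; apply: ler_pM; rewrite ?normr_ge0//.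
    by apply: (cyl_diam_dist hT hpi); exact: catP.
  exact: (coding_dist1 hT hpi).
pose M := C + D + D / h.
have Dh : 0 < D / h by rewrite divr_gt0.
exists M, th; split => //.
- exact: (coding_inj hpi).
- by rewrite /M; lra.
- exact: (cyl_diam_dist hT hpi).
- exact: (cyl_diam_le hT hpi).
- exact: (coding_convex hT hpi).
- move=> u v; apply: (le_trans (sub u v)); rewrite ler_wpM2r//.
    by rewrite mulr_ge0 ?(ltW (d0 _)).
  by rewrite /M; lra.
- move=> u v; apply: (le_trans (super u v)); rewrite ler_wpM2r ?(ltW (d0 _))//.
  by rewrite /M; lra.
- move=> w; apply: (le_trans (dth w)); rewrite ler_wpM2r//.
    by rewrite exprn_ge0//; case/andP: th01 => /ltW.
  by rewrite /M; lra.
Qed.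

Lemma coding_step_word i a : T (pi (word_seq [:: i] a)) = pi a.
Proof. by rewrite (coding_step hpi); congr pi; exact: (word_seq_shift [:: i]). Qed.

Lemma coding_branch_word i a : branch T i (pi (word_seq [:: i] a)).
Proof. exact: (coding_branch hpi (word_seq [:: i] a)). Qed.

Definition itv_length i : R := rend T i - lend T i.

Lemma itv_length_gt0 i : 0 < itv_length i.
Proof. by rewrite subr_gt0; have [_ []] := emr_itv hT i. Qed.

(** Every branch takes two fixed values at distance [h] and stays within [[0, 1]]. The mean value
    theorem thus pinches the derivative at one point, and bounded distortion spreads the bounds over
    the branch. *)
Lemma itv_length_derive : exists2 M : R, 1 <= M & forall i x, branch T i x ->
  M^-1 <= itv_length i * `|derive1 T x| <= M.
Proof.
have [K K0 HK] := branch_distortion hT.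
pose h := dist (fun=> 0%N) (fun=> 1%N).
have h0 : 0 < h.
  rewrite normr_gt0 subr_eq0; apply/eqP => /(coding_inj hpi).
  by move=> /(congr1 (fun a => a 0%N)).
have E0 : 0 < expR K by exact: expR_gt0.
have comp i x y : branch T i x -> branch T i y ->
    `|derive1 T x| <= expR K * `|derive1 T y|.
  move=> xi yi; apply: (le_trans (HK _ _ _ xi yi)); rewrite ler_wpM2r// ler_expR.
  rewrite -[leRHS]mulr1 ler_pM2l//.
  have /andP[x0 x1] := branch_range hT xi; have /andP[y0 y1] := branch_range hT yi.
  by rewrite ler_norml; apply/andP; split; lra.
have E1 : 1 <= expR K by rewrite -expR0 ler_expR ltW.
have hE : 0 < expR K / h by rewrite divr_gt0.
exists (2 * expR K + expR K / h); first by lra.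
move=> i x xi; have L0 := itv_length_gt0 i; apply/andP; split.
  apply: (@le_trans _ _ (expR K / h)^-1).
    by rewrite lef_pV2 ?posrE; lra.
  rewrite invf_div ler_pdivrMr// mulrAC.
  have bi a := coding_branch_word i a.
  have [c [ci E _]] := branch_MVT_abs (bi (fun=> 0%N)) (bi (fun=> 1%N)).
  move: E; rewrite !coding_step_word -/(dist _ _) -/h => ->.
  rewrite -mulrA [X in _ <= X]mulrC; apply: ler_pM => //.
    exact: (comp _ _ _ ci xi).
  have := bi (fun=> 0%N); have := bi (fun=> 1%N).
  rewrite /branch/= !in_itv/= /itv_length => /andP[u1 u2] /andP[v1 v2].
  by rewrite ler_norml; apply/andP; split; lra.
have [_ [lr _]] := emr_itv hT i.
(* The endpoints may behave badly, so interior points at half the length are used; hence the factor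
   2 in the constant. *)
pose p := lend T i + itv_length i / 4.
pose q := rend T i - itv_length i / 4.
have pi' : branch T i p.
  by rewrite /branch/= in_itv/= /p /itv_length; apply/andP; split; lra.
have qi : branch T i q.
  by rewrite /branch/= in_itv/= /q /itv_length; apply/andP; split; lra.
have [c [ci E _]] := branch_MVT_abs pi' qi.
have : `|T p - T q| <= 1.
  have /andP[x0 x1] := branch_range hT pi'; have /andP[y0 y1] := branch_range hT qi.
  by rewrite ler_norml; apply/andP; split; lra.
rewrite E (_ : `|p - q| = itv_length i / 2); last first.
  by rewrite distrC ger0_norm /p /q /itv_length; lra.
move=> H; have := comp _ _ _ xi ci.
move=> /(ler_wpM2l (ltW L0)) /le_trans; apply.
apply: (@le_trans _ _ (2 * expR K)); last by lra.
rewrite mulrCA [2 * _]mulrC ler_pM2l//; lra.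
Qed.

(** The coded points may leave gaps near the ends of the interval. But the cylinder contains two
    points whose images are at distance [h], so its diameter is not much smaller than the
    interval. *)
Lemma itv_length_diam : exists2 M : R, 1 <= M & forall i,
  d [:: i] <= itv_length i /\ itv_length i <= M * d [:: i].
Proof.
have [M M1 HM] := itv_length_derive.
pose h := dist (fun=> 0%N) (fun=> 1%N).
have h0 : 0 < h.
  rewrite normr_gt0 subr_eq0; apply/eqP => /(coding_inj hpi).
  by move=> /(congr1 (fun a => a 0%N)).
have M0 : 0 < M / h by rewrite divr_gt0//; lra.
exists (1 + M / h); first by lra.
move=> i; have L0 := itv_length_gt0 i.
have d0 : 0 < d [:: i] by exact: (cyl_diam_gt0 hT hpi).
split.
  apply: (cyl_diam_le hT hpi) => a b [a0] [b0].
  have := coding_branch hpi a; have := coding_branch hpi b.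
  rewrite a0 b0 /branch/= !in_itv/= /itv_length => /andP[u1 u2] /andP[v1 v2].
  by rewrite ler_norml; apply/andP; split; lra.
have bi a := coding_branch_word i a.
have [c [ci E _]] := branch_MVT_abs (bi (fun=> 0%N)) (bi (fun=> 1%N)).
move: E; rewrite !coding_step_word -/(dist _ _) -/h => E.
have h_le : h <= `|derive1 T c| * d [:: i].
  rewrite E ler_wpM2l//; apply: (cyl_diam_dist hT hpi); exact: cyl_word_seq.
have /andP[_ LM] := HM i c ci.
apply: (@le_trans _ _ (M / h * d [:: i])); last by rewrite ler_pM2r//; lra.
rewrite mulrAC ler_pdivlMr//.
apply: (le_trans (ler_wpM2l (ltW L0) h_le)).
by rewrite mulrA ler_pM2r.
Qed.

End coding_geometry.

Lemma countable_setU (U : Type) (A B : set U) :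
  countable A -> countable B -> countable (A `|` B).
Proof.
by move=> cA cB; rewrite -bigcup2E; apply: bigcup_countable => // -[|[|i]] _ //=.
Qed.

(** * Measurability and countability *)

Section emr_measurability.
Context {R : realType}.
Variable T : interval_map R.
Hypothesis hT : is_emr T.

Local Notation mR := (measurableTypeR R).

Lemma countable_endpoints : countable (endpoints T).
Proof.
by apply: countable_setU; apply: sub_countable (card_image_le _ _) _.
Qed.

Lemma countable_measurableR (A : set R) : countable A -> measurable (A : set mR).
Proof. by apply: countable_measurable => x; exact: measurable_set1. Qed.

Lemma domE : dom T = endpoints T `|` \bigcup_i branch T i.
Proof.
apply/seteqP; split => [x [i _]|x [[[i _ <-]|[i _ <-]]|[i _ xi]]].
- rewrite /= in_itv/= !le_eqVlt => /andP[/predU1P[<-|lx]].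
    by move=> _; left; left; exists i.
  move=> /predU1P[->|xr]; first by left; right; exists i.
  by right; exists i => //; rewrite /branch/= in_itv/= lx.
- by have [_ [/ltW lr _]] := emr_itv hT i; exists i => //=; rewrite in_itv/= lexx.
- by have [_ [/ltW lr _]] := emr_itv hT i; exists i => //=; rewrite in_itv/= lr lexx.
- exact: (branch_dom xi).
Qed.

Lemma measurable_branch i : measurable (branch T i : set mR).
Proof. exact: measurable_itv. Qed.

Lemma measurable_dom : measurable (dom T : set mR).
Proof.
rewrite domE; apply: measurableU.
  by apply: countable_measurableR; exact: countable_endpoints.
by apply: bigcupT_measurable => i; exact: measurable_branch.
Qed.

(** Nothing is known of the regularity of [T] at the endpoints, but they are countable; on each open
    interval [T] is continuous. *)
Lemma measurable_fun_dom : measurable_fun (dom T : set mR) (T : mR -> mR).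
Proof.
have mE := countable_measurableR countable_endpoints.
have mB : measurable (\bigcup_i branch T i : set mR).
  by apply: bigcupT_measurable => i; exact: measurable_branch.
rewrite domE; apply/measurable_funU => //; split.
  move=> _ A mA; apply: countable_measurableR.
  exact: sub_countable (subset_card_le (@subIsetl _ _ _)) countable_endpoints.
apply/measurable_fun_bigcup => [|i]; first exact: measurable_branch.
apply: subspace_continuous_measurable_fun; first exact: measurable_branch.
exact: (branch_continuous hT).
Qed.

Lemma measurable_repeller : measurable (repeller T : set mR).
Proof.
pose D n := [set x : mR | dom T (iter n T x)].
pose E n := [set x : mR | forall k, (k <= n)%N -> dom T (iter k T x)].
have mE n : measurable (E n).
  elim: n => [|n IH].
    rewrite (_ : E 0%N = dom T); first exact: measurable_dom.
    by apply/seteqP; split => [x /(_ 0%N (leqnn _))|x dx [|]].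
  rewrite (_ : E n.+1 = dom T `&` T @^-1` (E n)).
    exact: (measurable_fun_dom measurable_dom).
  apply/seteqP; split => [x Ex|x [dx Ex] [|k]//].
    split; first exact: (Ex 0%N).
    by move=> k kn; rewrite -iterSr; exact: Ex.
  by rewrite iterSr; exact: Ex.
rewrite (_ : repeller T = \bigcap_n E n); first exact: bigcapT_measurable.
apply/seteqP; split => [x dx n _ k _|x Ex n]; first exact: dx.
exact: (Ex n I n (leqnn _)).
Qed.

Lemma measurable_fun_repeller :
  measurable_fun (repeller T : set mR) (T : mR -> mR).
Proof.
apply: measurable_funS measurable_fun_dom; first exact: measurable_dom.
by move=> x /(_ 0%N).
Qed.

(** Each of the countably many branches is injective, so pulling back by [T] preserves
    countability. *)
Lemma countable_pre_endpoints : countable (pre_endpoints T).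
Proof.
pose E k := [set x | (forall j, (j < k)%N -> dom T (iter j T x)) /\
                     endpoints T (iter k T x)].
have -> : pre_endpoints T = \bigcup_k E k.
  by apply/seteqP; split => [x [k h]|x [k _ h]]; exists k.
apply: bigcup_countable => // k _; elim: k => [|k IH].
  apply: sub_countable countable_endpoints; apply: subset_card_le.
  by move=> x [_].
apply: (@sub_countable _ _ _ (endpoints T `|` \bigcup_i [set x | branch T i x /\ E k (T x)])).
  apply: subset_card_le => x [dx ex].
  have := dx 0%N (ltn0Sn _); rewrite /= domE => -[|[i _ xi]]; first by left.
  right; exists i => //; split => //; split; last by rewrite -iterSr.
  by move=> j jk; rewrite -iterSr; exact: dx.
apply: countable_setU; first exact: countable_endpoints.
apply: bigcup_countable => // i _.
have /countable_injP[f finj] := IH; apply/countable_injP; exists (f \o T).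
move=> x y; rewrite !inE => -[xi Ex] [yi Ey] /finj; rewrite !inE => /(_ Ex Ey).
exact: (branch_inj hT xi yi).
Qed.

Lemma sum_itv_length : (\esum_(i in [set: nat]) (itv_length T i)%:E <= 1)%E.
Proof.
rewrite -nneseries_esumT; last by move=> i; rewrite lee_fin ltW// itv_length_gt0.
have Lb i : lebesgue_measure (branch T i) = (itv_length T i)%:E.
  rewrite /branch lebesgue_measure_itv/= lte_fin.
  by have [_ [-> _]] := emr_itv hT i; rewrite -EFinB.
have mI : measurable (`[0, 1]%classic : set mR) by exact: measurable_itv.
apply: (@le_trans _ _ (lebesgue_measure (\bigcup_i branch T i))).
  rewrite measure_semi_bigcup//; last 3 first.
  - by move=> i; exact: measurable_branch.
  - exact: (emr_disjoint hT).
  - by apply: bigcupT_measurable => i; exact: measurable_branch.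
  apply: lee_nneseries => i _; first by move=> _; rewrite lee_fin ltW// itv_length_gt0.
  by rewrite -Lb.
apply: (@le_trans _ _ (lebesgue_measure (`[0, 1]%classic : set R))).
  apply: le_measure; rewrite ?inE//.
    by apply: bigcupT_measurable => i; exact: measurable_branch.
  move=> x [i _]; rewrite /branch/= !in_itv/= => /andP[/ltW h1 /ltW h2].
  have [l0 [_ r1]] := emr_itv hT i.
  by rewrite (le_trans l0 h1) (le_trans h2 r1).
by rewrite lebesgue_measure_itv/= lte_fin ltr01 sube0.
Qed.

End emr_measurability.

(** For an EMR map it is finite exactly when the pressure at [t] is, and it depends on the intervals
    only, which is what makes two maps comparable. *)
Definition length_sum (R : realType) (T : interval_map R) (t : R) : \bar R :=
  (\esum_(i in [set: nat]) (itv_length T i `^ t)%:E)%E.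

(** By convexity, the image of a cylinder is the trace of an interval on the range, and the range is
    the repeller minus a countable set. *)
Lemma measurable_coding (R : realType) (T : interval_map R)
    (pi : (nat -> nat) -> R) : is_emr T ->
  full_shift_coding T (pi : full_shift -> R) ->
  forall w, measurable (pi @` cyl w : set (measurableTypeR R)).
Proof.
move=> hT hpi w.
have mr : measurable (range pi : set (measurableTypeR R)).
  rewrite (coding_range hpi); apply: measurableD.
    exact: measurable_repeller.
  by apply: countable_measurableR; exact: countable_pre_endpoints.
pose I := [set x : R | exists a b, [/\ cyl w a, cyl w b & pi a <= x <= pi b]].
rewrite (_ : pi @` cyl w = range pi `&` I).
  apply: measurableI => //; apply: is_interval_measurable.
  move=> x y [a [b [wa wb /andP[ax xb]]]] [a' [b' [wa' wb' /andP[ay yb]]]] z /andP[xz zy].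
  by exists a, b'; split => //; rewrite (le_trans ax xz) (le_trans zy yb).
apply/seteqP; split => [_ [a wa <-]|_ [[c _ <-] [a [b [wa wb acb]]]]].
  by split; [exists a|exists a, a; split => //; rewrite lexx].
by exists c => //; exact: (coding_convex hT hpi wa wb acb).
Qed.

Lemma length_sum_word_sum (R : realType) (T : interval_map R)
    (pi : (nat -> nat) -> R) (t : R) : is_emr T ->
  full_shift_coding T (pi : full_shift -> R) -> 0 <= t ->
  (length_sum T t < +oo)%E <->
  (word_sum (fun w => cyl_diam pi w `^ t)%R 1 < +oo)%E.
Proof.
move=> hT hpi t0; have [M M1 HM] := itv_length_diam hT hpi.
have d0 i : 0 <= cyl_diam pi [:: i] by exact/ltW/(cyl_diam_gt0 hT hpi).
rewrite word_sum1E; split => H.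
  apply: le_lt_trans H; apply: le_esum => i _; rewrite lee_fin.
  by apply: powR_le => //; have [] := HM i.
apply: (@le_lt_trans _ _ ((M `^ t)%:E * \esum_(i in [set: nat]) (cyl_diam pi [:: i] `^ t)%:E)%E).
  rewrite -esumZl ?powR_ge0//; last by move=> i _; rewrite lee_fin powR_ge0.
  apply: le_esum => i _; rewrite -EFinM lee_fin -powRM//; last by lra.
  by apply: powR_le => //; [exact/ltW/itv_length_gt0|have [] := HM i].
by rewrite lte_mul_pinfty// lee_fin powR_ge0.
Qed.

Lemma hausdorff_dim_le (R : realType) (Z : set R) (s : R) : 0 <= s ->
  (forall t, s < t -> hausdorff_measure t Z = 0%E) -> (hausdorff_dim Z <= s%:E)%E.
Proof.
move=> s0 H; apply/lee_addgt0Pr => e e0; apply: ereal_inf_lbound.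
exists (s + e); rewrite ?EFinD//; split; first by rewrite addr_ge0// ltW.
by apply: H; rewrite ltrDl.
Qed.

(** The hypothesis on the length sums is the only place where the pressure enters: it lets the
    exponent be lowered while the sums stay finite. *)
Lemma emr_max_dim_measure (R : realType) (T : interval_map R) : is_emr T ->
  (forall t, 0 <= t -> (length_sum T t < +oo)%E ->
    exists2 t', 0 <= t' < t & (length_sum T t' < +oo)%E) ->
  exists nu : probability (measurableTypeR R) R, max_dim_measure T nu.
Proof.
move=> hT hopen; have [pi hpi] := emr_coding hT.
have [C [th gc]] := coding_geometric hT hpi.
set d := cyl_diam pi in gc.
have mpi := measurable_coding hT hpi.
have C1 := gc_C gc; have d0 := gc_gt0 gc.
have d1 : (word_sum d 1 < +oo)%E.
  rewrite word_sum1E; apply: (@le_lt_trans _ _ 1%E); last exact: ltry.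
  apply: le_trans (sum_itv_length hT); apply: le_esum => i _; rewrite lee_fin.
  by have [M _ HM] := itv_length_diam hT hpi; have [] := HM i.
have dopen t : 0 <= t -> (word_sum (fun w => d w `^ t)%R 1 < +oo)%E ->
    exists2 t', 0 <= t' < t & (word_sum (fun w => d w `^ t')%R 1 < +oo)%E.
  move=> t0 /(length_sum_word_sum hT hpi t0) /(hopen _ t0) [t' t't H].
  exists t' => //; apply/(length_sum_word_sum hT hpi) => //.
  by case/andP: t't.
have [s [s0 [s0s ds0 Z1 ZC]]] := bowen_exponent C1 (gc_th gc) d0 (gc_sub gc)
  (gc_super gc) (gc_decay gc) d1 dopen.
have s_gt0 : 0 < s by case/andP: s0s => /le_lt_trans; apply.
have C0 : 0 < C by lra.
pose L w := (C * d w) `^ s.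
(* [C * d w] is submultiplicative, and supermultiplicative up to [C ^+ 2]; [c] is the inverse [s]-th
   power of the latter and also bounds the word sums. *)
pose c := ((C ^+ 2) `^ s)^-1.
have CC0 : 0 < (C ^+ 2) `^ s by rewrite powR_gt0// exprn_gt0.
have c0 : 0 < c by rewrite invr_gt0.
have e0 w : 0 < C * d w by rewrite mulr_gt0.
have L0 w : 0 < L w by exact: powR_gt0.
have Lsub : forall u v, L (u ++ v) <= L u * L v.
  apply: (@powR_mul_sub _ (fun w => C * d w) s (ltW s_gt0) e0) => u v.
  rewrite (_ : _ * (C * _) = C * (C * (d u * d v))); last by ring.
  by rewrite ler_pM2l//; exact: (gc_sub gc).
have Lsup u v : c * (L u * L v) <= L (u ++ v).
  rewrite /c mulrC ler_pdivrMr// -!powRM ?(ltW (e0 _)) ?exprn_ge0 ?(ltW C0)//.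
  apply: powR_le; [exact: ltW|by rewrite mulr_ge0 ?(ltW (e0 _))|].
  rewrite (_ : C * d u * _ = C ^+ 2 * (d u * d v)); last by ring.
  by rewrite mulrC ler_pM2r ?exprn_gt0//; exact: (gc_super gc).
have ZC' n : (word_sum L n <= c^-1%:E)%E by rewrite /c invrK; exact: ZC.
have [nu [b [b0 nu_nil nu_sum nu_suml nuL]]] := gibbs_function c0 L0 Lsub Lsup Z1 ZC'.
have nu_ge0 w : 0 <= nu w.
  by have /andP[+ _] := nuL w; apply: le_trans; rewrite mulr_ge0 ?ltW.
pose B := b^-1 * C `^ s.
have B0 : 0 < B by rewrite mulr_gt0 ?invr_gt0 ?powR_gt0.
have nu_le w : nu w <= B * d w `^ s.
  have /andP[_ +] := nuL w; rewrite /L powRM ?(ltW C0) ?(ltW (d0 _))//.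
  by rewrite mulrA.
have nu_small (e : R) : 0 < e -> exists n, forall w, size w = n -> nu w < e.
  move=> e_gt0; pose r := (e / (2 * B)) `^ s^-1.
  have eB : 0 < e / (2 * B) by rewrite divr_gt0// pmulr_rgt0.
  have r0 : 0 < r by exact: powR_gt0.
  have [n Hn] := gc_small gc r0; exists n => w wn.
  apply: (le_lt_trans (nu_le w)); apply: (@le_lt_trans _ _ (B * r `^ s)).
    rewrite ler_pM2l//; apply: powR_le; [exact: ltW|exact/ltW/d0|].
    by apply/ltW/Hn; rewrite wn.
  rewrite /r -powRrM mulVf ?gt_eqF// powRr1 ?(ltW eB)//.
  rewrite (_ : B * _ = e / 2); first by lra.
  by field; exact: lt0r_neq0.
have [P [PE Papprox]] := coded_probability (gc_inj gc) (gc_continuous gc) mpi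
  nu_ge0 nu_nil nu_sum nu_small.
have mS := measurable_repeller hT; have mf := measurable_fun_repeller hT.
have piS : range pi `<=` repeller T by rewrite (coding_range hpi) => x [].
(* One factor [b] passes from [nu] to [L] on [u ++ v], [c] splits [L], and [b * b] returns to [nu]
   on [u] and [v]. *)
have nu_quasi u v : b * c * (b * b) * (nu u * nu v) <= nu (u ++ v).
  have /andP[+ _] := nuL (u ++ v); apply: le_trans.
  apply: (@le_trans _ _ (b * (c * (L u * L v)))); last by rewrite ler_pM2l.
  have bnu w : b * nu w <= L w.
    by have /andP[_] := nuL w; rewrite mulrC ler_pdivlMr// mulrC.
  rewrite (_ : _ * _ = b * (c * ((b * nu u) * (b * nu v)))); last by ring.
  by rewrite ler_pM2l// ler_pM2l//; apply: ler_pM => //; rewrite mulr_ge0// ltW.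
have PS : P (repeller T) = 1%E by exact: (prob_domain mpi nu_nil PE mS piS).
have Pr : P (range pi) = 1%E by exact: (prob_range nu_nil PE).
exists P; split.
- split => // A mA.
  exact: (prob_invariant (gc_inj gc) (gc_continuous gc) mpi nu_nil nu_suml PE mS
    mf piS (coding_step hpi) mA).
- move=> A mA _ Ainv.
  apply: (prob_ergodic (gc_inj gc) (gc_continuous gc) mpi nu_ge0 nu_nil nu_suml PE
    Papprox mS mf piS (coding_step hpi) _ nu_quasi mA Ainv).
  by rewrite !mulr_gt0.
(* The repeller itself has mass 1, which gives one inequality; the other one passes through [s]. *)
- apply/eqP; rewrite eq_le; apply/andP; split.
    by apply: ereal_inf_lbound; exists (repeller T).
  apply: (@le_trans _ _ s%:E).
    apply: hausdorff_dim_le => [|t st]; first exact: ltW.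
    rewrite (_ : repeller T = range pi `|` (repeller T `&` pre_endpoints T)); last first.
      by rewrite (coding_range hpi) setUC setUIDK.
    apply: (hausdorff_measure_range (s := s) (B := (C ^+ 2) `^ s) gc).
    + by rewrite ltW.
    + apply: sub_countable (countable_pre_endpoints hT); apply: subset_card_le.
      exact: subIsetr.
    + move=> n; apply: le_trans (ZC n); apply: le_word_sum => w _.
      apply: powR_le; [exact: ltW|exact/ltW/d0|].
      by rewrite ler_peMl// ltW.
  apply: le_ereal_inf_tmp => _ [Z [mZ PZ] <-].
  apply: le_ereal_inf_tmp => _ [t [t0 Ht] <-]; rewrite lee_fin.
  exact: (mass_lower_bound gc s0s ds0 mpi nu_ge0 nu_suml PE Pr B0 nu_le mZ PZ t0 Ht).
Qed.

(** * Pressure *)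

Lemma powR_pinch (R : realType) (M y t : R) : 1 <= M -> M^-1 <= y <= M ->
  M `^ (- `|t|) <= y `^ t <= M `^ `|t|.
Proof.
move=> M1 /andP[My yM]; have M0 : 0 < M by lra.
have y0 : 0 < y by apply: lt_le_trans My; rewrite invr_gt0.
have lM0 : 0 <= ln M by exact: ln_ge0.
have l1 : ln y <= ln M by rewrite ler_ln.
have l2 : - ln M <= ln y by rewrite -lnV// ler_ln// posrE invr_gt0.
have : `|t * ln y| <= `|t| * ln M.
  by rewrite normrM ler_wpM2l// ler_norml l2.
rewrite ler_norml => /andP[h1 h2].
by rewrite /powR !gt_eqF// !ler_expR mulNr h1.
Qed.

Section pressure.
Context {R : realType}.
Variable T : interval_map R.
Hypothesis hT : is_emr T.

(** The lengths are at most 1, so for [t <= 0] all of the infinitely many terms are at least 1. *)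
Lemma length_sum_gt0 t : (length_sum T t < +oo)%E -> 0 < t.
Proof.
apply: contraTT; rewrite -!leNgt => t0.
rewrite leye_eq; apply/eqP/eqyP => A A0.
apply: (@le_trans _ _ (\sum_(i < Num.bound A) (itv_length T i `^ t)%:E)%E).
  rewrite sumEFin lee_fin; apply: (@le_trans _ _ (\sum_(i < Num.bound A) 1)).
    by rewrite sumr_const card_ord; apply/ltW/archi_boundP/ltW.
  apply: ler_sum => i _; rewrite -(powRr0 (itv_length T i)).
  apply: ger_powR => //; rewrite itv_length_gt0//=.
  by have [l0 [_ r1]] := emr_itv hT i; rewrite /itv_length; lra.
rewrite /length_sum -nneseries_esumT; last by move=> i; rewrite lee_fin powR_ge0.
rewrite -(big_mkord xpredT (fun i => (itv_length T i `^ t)%:E)).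
by apply: nneseries_lim_ge => i _ _; rewrite lee_fin powR_ge0.
Qed.

Lemma weight_bounds (pi : (nat -> nat) -> R) (t : R) :
  full_shift_coding T (pi : full_shift -> R) ->
  exists2 M : R, 0 < M & forall n (a : nat -> nat),
  \prod_(k < n) (M^-1 * itv_length T (a k) `^ t) <= weight T t n (pi a) <=
  \prod_(k < n) (M * itv_length T (a k) `^ t).
Proof.
move=> hpi; have [M M1 HM] := itv_length_derive hT hpi.
have M0 : 0 < M by lra.
exists (M `^ `|t|); first by rewrite powR_gt0.
move=> n a.
have bnd k : (M `^ `|t|)^-1 * itv_length T (a k) `^ t <=
    `|derive1 T (iter k T (pi a))| `^ (- t) <=
    M `^ `|t| * itv_length T (a k) `^ t.
  have L0 := itv_length_gt0 hT (a k).
  have bk := coding_branch_iter hpi k a.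
  have := powR_pinch (- t) M1 (HM _ _ bk); rewrite normrN (powRN M).
  rewrite (powRM _ (ltW L0) (normr_ge0 _)) (powRN (itv_length T (a k)) t).
  move=> /andP[h1 h2].
  have Lt0 : 0 < itv_length T (a k) `^ t by exact: powR_gt0.
  move: h1 h2; rewrite [(_ `^ t)^-1 * _]mulrC ler_pdivlMr// ler_pdivrMr//.
  by move=> -> ->.
apply/andP; split; apply: ler_prod => k _; have /andP[h1 h2] := bnd k.
  by rewrite h1 mulr_ge0 ?invr_ge0 ?powR_ge0.
by rewrite powR_ge0 h2.
Qed.

Lemma periodic_coding (pi : (nat -> nat) -> R) n x :
  full_shift_coding T (pi : full_shift -> R) ->
  ((repeller T `\` pre_endpoints T) x /\ iter n T x = x) <->
  exists2 a, x = pi a & forall k, a (n + k)%N = a k.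
Proof.
move=> hpi; rewrite -(coding_range hpi); split => [[[a _ <-]]|[a -> an]].
  rewrite (coding_iter hpi) => /(coding_inj hpi) E; exists a => // k.
  by rewrite -[in RHS]E.
by split; [exists a|rewrite (coding_iter hpi); congr pi; apply/funext].
Qed.

Lemma periodic_mod (a : nat -> nat) n : (forall k, a (n + k)%N = a k) ->
  forall k, a k = a (k %% n)%N.
Proof.
move=> an k; rewrite {1}(divn_eq k n) addnC.
elim: (k %/ n)%N => [|m IH]; first by rewrite mul0n addn0.
by rewrite mulSn addnCA an.
Qed.

(** For each period, the points coded by one free digit followed by zeros already make the periodic
    sum infinite. *)
Lemma pressure_infinite t : length_sum T t = +oo%E -> pressure T t = +oo%E.
Proof.
move=> LS; have [pi hpi] := emr_coding hT.
have [M M0 HM] := @weight_bounds pi t hpi.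
suff ps n : (0 < n)%N -> periodic_sum T t n = +oo%E.
  apply: cvg_lim => //; apply: (@cvg_trans _ ((fun=> +oo%E : \bar R) @ \oo)).
    apply: near_eq_cvg; near=> n.
    have n0 : (0 < n)%N by near: n; exists 1%N.
    rewrite ps// gt0_muley// lte_fin invr_gt0 ltr0n//.
  exact: cvg_cst.
move=> n0; apply/eqP; rewrite -leye_eq.
pose w i : R := M^-1 * itv_length T i `^ t.
have w0 i : 0 < w i.
  by rewrite mulr_gt0 ?invr_gt0 ?powR_gt0// itv_length_gt0.
pose c := w 0%N ^+ n.-1 * M^-1.
have c0 : 0 < c by rewrite mulr_gt0 ?exprn_gt0 ?invr_gt0.
pose a i k := if (k %% n == 0)%N then i else 0%N.
have an i k : a i (n + k)%N = a i k by rewrite /a modnDl.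
apply: (@le_trans _ _ (c%:E * length_sum T t)%E).
  by rewrite LS gt0_muley// lte_fin.
rewrite /length_sum -esumZl ?(ltW c0)//; last by move=> i _; rewrite lee_fin powR_ge0.
apply: (@esum_inj_le _ _ _ _ _ (fun i => pi (a i))).
- by move=> i j _ _ /(coding_inj hpi)/(congr1 (fun f => f 0%N)); rewrite /a mod0n eqxx.
- by move=> i _; apply/(periodic_coding n _ hpi); exists (a i).
- by move=> x; rewrite lee_fin; apply: prodr_ge0 => k _; exact: powR_ge0.
- move=> i _; rewrite -EFinM lee_fin.
  have /andP[+ _] := HM n (a i); apply: le_trans.
  case: n n0 @c c0 @a an => // n _ c _ a _; rewrite big_ord_recl/= /a mod0n eqxx.
  rewrite (eq_bigr (fun=> w 0%N)); last first.
    by move=> k _; rewrite /bump/= add1n modn_small// ltnS.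
  rewrite prodr_const card_ord /c/=.
  by rewrite (_ : _ * _ * _ = M^-1 * itv_length T i `^ t * w 0%N ^+ n) ?lexx//; ring.
Unshelve. all: by end_near. Qed.

(** A point of period [n] is determined by its first [n] digits, so its periodic sum is at most the
    [n]-th power of a constant times the length sum. *)
Lemma pressure_finite t : (length_sum T t < +oo)%E -> (pressure T t < +oo)%E.
Proof.
move=> LS; have [pi hpi] := emr_coding hT.
have [M M0 HM] := @weight_bounds pi t hpi.
pose w i : R := M * itv_length T i `^ t.
have w0 i : 0 < w i by rewrite mulr_gt0 ?powR_gt0// itv_length_gt0.
pose f (v : seq nat) := \prod_(i <- v) w i.
have f0 v : 0 < f v by apply: prodr_gt0 => i _.
have fM u v : f (u ++ v) <= f u * f v by rewrite /f big_cat.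
have f1 : (word_sum f 1 < +oo)%E.
  rewrite word_sum1E.
  under eq_esum do rewrite /f big_seq1 EFinM.
  rewrite esumZl ?(ltW M0)//; last by move=> i _; rewrite lee_fin powR_ge0.
  by rewrite lte_mul_pinfty// lee_fin ltW.
pose A := fine (word_sum f 1) + 1.
have f1fin : word_sum f 1 \is a fin_num.
  by rewrite ge0_fin_numE//; apply: word_sum_ge0 => v; exact: ltW.
have A0 : 0 < A by rewrite ltr_wpDl// fine_ge0//; apply: word_sum_ge0 => v; exact: ltW.
have fA : (word_sum f 1 <= A%:E)%E by rewrite -[leLHS]fineK// lee_fin lerDl.
have ps n : (periodic_sum T t n.+1 <= (A ^+ n.+1)%:E)%E.
  have := word_sum_sub_iter n f0 fM (ltW A0) fA; rewrite muln1.
  apply: le_trans.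
  rewrite /periodic_sum.
  pose g x := xget (fun=> 0%N) [set a : nat -> nat | x = pi a].
  have gP a : g (pi a) = a.
    have := @xgetPex _ (fun=> 0%N) [set b | pi a = pi b] (ex_intro _ a erefl).
    by move=> /(coding_inj hpi).
  apply: (@esum_inj_le _ _ _ _ _ (fun x => mkseq (g x) n.+1)).
  - move=> x y; rewrite !inE => /(periodic_coding _ _ hpi)[a -> an].
    move=> /(periodic_coding _ _ hpi)[b -> bn]; rewrite !gP => ab; congr pi.
    apply/funext => k; rewrite (periodic_mod an) (periodic_mod bn).
    have kn : (k %% n.+1 < n.+1)%N by rewrite ltn_mod.
    by rewrite -(nth_mkseq 0%N a kn) ab nth_mkseq.
  - by move=> x _; exact: size_mkseq.
  - by move=> v; rewrite lee_fin ltW.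
  - move=> x /(periodic_coding _ _ hpi)[a -> _]; rewrite gP lee_fin.
    have /andP[_] := HM n.+1 a; rewrite /f /mkseq big_map -(big_mkord xpredT (fun k => M * itv_length T (a k) `^ t)).
    by rewrite /index_iota subn0.
have un n : (0 < n)%N -> ((n%:R^-1)%:E * lne (periodic_sum T t n) <= (ln A)%:E)%E.
  case: n => // n _.
  have P0 : (0 <= periodic_sum T t n.+1)%E.
    by apply: esum_ge0 => x _; rewrite lee_fin; apply: prodr_ge0 => k _; exact: powR_ge0.
  have : (lne (periodic_sum T t n.+1) <= (ln A *+ n.+1)%:E)%E.
    rewrite -lnXn// -lne_EFin ?exprn_gt0// lee_lne ?in_itv/= ?P0 ?leey//.
    by rewrite lee_fin exprn_ge0// ltW.
  have n0 : 0 < n.+1%:R^-1 :> R by rewrite invr_gt0.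
  move=> H; have := lee_wpmul2l _ H => /(_ (n.+1%:R^-1)%:E); rewrite lee_fin => /(_ (ltW n0)) => /le_trans; apply.
  by rewrite -EFinM lee_fin -[ln A *+ _]mulr_natl mulKf// pnatr_eq0.
rewrite /pressure; set u := (fun n => _).
(* If the sequence diverges, [limn] is a default value, which is finite. *)
have [cu|dvg] := pselect (cvgn u); last by rewrite dvgP// ltry.
apply: (@le_lt_trans _ _ (ln A)%:E); last exact: ltry.
by apply: lime_le => //; near=> n; apply: un; near: n; exists 1%N.
Unshelve. all: by end_near. Qed.

End pressure.

(** * Compact perturbations *)

Section endpoints.
Context {R : realType}.
Variable T : interval_map R.
Hypothesis hT : is_emr T.

Lemma lend_branch i (e : R) : 0 < e -> exists2 x, lend T i < x < lend T i + e &
  branch T i x.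
Proof.
move=> e0; have [_ [lr _]] := emr_itv hT i.
exists (lend T i + Num.min (e / 2) ((rend T i - lend T i) / 2)); last first.
  rewrite /branch/= in_itv/= ltrDl lt_min !divr_gt0 ?subr_gt0//=.
  by rewrite -ltrBrDl gt_min; apply/orP; right; lra.
rewrite ltrDl lt_min !divr_gt0 ?subr_gt0//= ltrD2l gt_min; apply/orP; left; lra.
Qed.

Lemma rend_branch i (e : R) : 0 < e -> exists2 x, rend T i - e < x < rend T i &
  branch T i x.
Proof.
move=> e0; have [_ [lr _]] := emr_itv hT i.
have m0 : 0 < Num.min (e / 2) ((rend T i - lend T i) / 2).
  by rewrite lt_min !divr_gt0// subr_gt0.
have m1 : Num.min (e / 2) ((rend T i - lend T i) / 2) < e.
  by rewrite gt_min; apply/orP; left; lra.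
have m2 : Num.min (e / 2) ((rend T i - lend T i) / 2) < rend T i - lend T i.
  by rewrite gt_min; apply/orP; right; lra.
exists (rend T i - Num.min (e / 2) ((rend T i - lend T i) / 2)).
  by apply/andP; split; lra.
by rewrite /branch/= in_itv/=; apply/andP; split; lra.
Qed.

Lemma endpoint_not_branch i e : endpoints T e -> ~ branch T i e.
Proof.
move=> + ei; move: (ei); rewrite /branch/= in_itv/= => /andP[le er].
have r0 : 0 < rend T i - e by rewrite subr_gt0.
have l0 : 0 < e - lend T i by rewrite subr_gt0.
move=> [[m _ me]|[m _ me]].
  have [x /andP[x1 x2] xm] := lend_branch m r0.
  have xi : branch T i x by rewrite /branch/= in_itv/=; apply/andP; split; lra.
  by move: le; rewrite -me (branch_uniq hT xm xi) ltxx.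
have [x /andP[x1 x2] xm] := rend_branch m l0.
have xi : branch T i x by rewrite /branch/= in_itv/=; apply/andP; split; lra.
by move: er; rewrite -me (branch_uniq hT xm xi) ltxx.
Qed.

Lemma rend_inj i j : rend T i = rend T j -> i = j.
Proof.
move=> ij; have [_ [li _]] := emr_itv hT i; have [_ [lj _]] := emr_itv hT j.
have l0 : 0 < rend T j - lend T j by rewrite subr_gt0.
have [x /andP[x1 x2] xi] := rend_branch i l0.
apply: (branch_uniq hT xi); rewrite /branch/= in_itv/=; apply/andP; split; lra.
Qed.

Lemma endpoint_isolated e : e != 0 -> exists2 r : R, 0 < r &
  forall y, `|y - e| < r -> y != e -> ~ endpoints T y.
Proof.
move=> e0; have : ~ limit_point (endpoints T) e.
  by rewrite (emr_accumulation hT) /=; apply/eqP.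
rewrite /limit_point/= => /existsNP[U /not_implyP[]].
rewrite -nbhs_ballE => -[r /= r0 rU] H; exists r => // y ye yne ey.
apply: H; exists y; split => //; apply: rU.
by rewrite /ball/= distrC.
Qed.

(** Endpoints accumulate at 0, so an interval starting at 0 would contain endpoints in its
    interior. *)
Lemma lend_gt0 i : 0 < lend T i.
Proof.
have [l0 [lr _]] := emr_itv hT i; rewrite lt_neqAle l0 andbT; apply/eqP => l_eq0.
have : limit_point (endpoints T) 0 by rewrite (emr_accumulation hT).
have b0 : 0 < rend T i by rewrite [ltLHS]l_eq0.
move=> /(_ (ball (0 : R) (rend T i)) (nbhsx_ballx _ _ b0))[y [y0 ey]].
rewrite /ball/= sub0r normrN => yb; apply: (@endpoint_not_branch i y) => //.
rewrite /branch/= in_itv/= -l_eq0.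
have y_ge0 : 0 <= y.
  by move: ey => [[m _ <-]|[m _ <-]]; have [? [? ?]] := emr_itv hT m; lra.
by rewrite lt0r y0 y_ge0/= (le_lt_trans (ler_norm _) yb).
Qed.

(** Otherwise infinitely many right endpoints, distinct by [rend_inj], would accumulate at a point
    other than 0. *)
Lemma finite_large_itv (e : R) : 0 < e -> finite_set [set i | e <= rend T i].
Proof.
move=> e0; apply: contrapT => inf.
have infE : infinite_set (rend T @` [set i | e <= rend T i]).
  pose g y := xget 0%N [set i | rend T i = y].
  move=> /(finite_image g);   rewrite (_ : _ @` _ = [set i | e <= rend T i])//.
  have gK i : g (rend T i) = i.
    apply: rend_inj.
    exact: (@xgetPex _ 0%N [set j | rend T j = rend T i] (ex_intro _ i erefl)).
  apply/seteqP; split => [_ [_ [i ei <-] <-]|i ei]; first by rewrite gK.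
  by exists (rend T i); [exists i|rewrite gK].
have [p pE] : limit_point (rend T @` [set i | e <= rend T i]) !=set0.
  apply: infinite_bounded_limit_point_nonempty => //.
  exists 1; split => // M M1 _ [i /= ei <-]; have [_ [_ r1]] := emr_itv hT i.
  by rewrite ger0_norm; lra.
have : limit_point (endpoints T) p.
  move=> U Up; have [y [yp [i _ iy] Uy]] := pE U Up.
  by exists y; split => //; right; exists i.
rewrite (emr_accumulation hT) => /= p0.
have := pE (ball (0 : R) e); rewrite p0 => /(_ (nbhsx_ballx _ _ e0))[y [_ [i /= ei <-]]].
rewrite /ball/= sub0r normrN => /(le_lt_trans (ler_norm _)).
by rewrite ltNge ei.
Qed.

Lemma branch_increasing i p q : branch T i p -> branch T i q -> p < q ->
  T p <= T q -> forall x y, branch T i x -> branch T i y -> x <= y -> T x <= T y.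
Proof.
move=> ip iq pq Tpq x y xi yi xy; have [m|m] := branch_monotone hT i.
  by rewrite m ?inE.
by move: Tpq; rewrite m ?inE// leNgt pq.
Qed.

Lemma branch_decreasing i p q : branch T i p -> branch T i q -> p < q ->
  T q <= T p -> forall x y, branch T i x -> branch T i y -> x <= y -> T y <= T x.
Proof.
move=> ip iq pq Tpq x y xi yi xy; have [m|m] := branch_monotone hT i.
  by move: Tpq; rewrite m ?inE// leNgt pq.
by rewrite m ?inE.
Qed.

End endpoints.

Section perturbation.
Context {R : realType}.
Variables (T1 T2 : interval_map R) (delta : R).
Hypothesis hT1 : is_emr T1.
Hypothesis hT2 : is_emr T2.
Hypothesis agree_dom : forall x, 0 < x < delta -> dom T1 x <-> dom T2 x.
Hypothesis agree_val : forall x, 0 < x < delta -> dom T1 x -> T1 x = T2 x.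

(* Near an endpoint e of T1 inside a branch of T2, T1 = T2 is monotone; but on
   both sides of e there would be full branches of T1. *)
Lemma endpoint_not_branch2 e k : 0 < e < delta -> endpoints T1 e ->
  ~ branch T2 k e.
Proof.
move=> /andP[e0 ed] ee ek.
have [r r0 Hr] := endpoint_isolated hT1 (lt0r_neq0 e0).
move: (ek); rewrite /branch/= in_itv/= => /andP[le er].
(* Within [rho] of [e] there is no other endpoint of [T1], the branch [k] of [T2] is not left, and
   the two maps agree. *)
pose rho := Num.min (Num.min r (Num.min e (delta - e)))
  (Num.min (e - lend T2 k) (rend T2 k - e)).
have rho0 : 0 < rho by rewrite !lt_min r0 e0 !subr_gt0 ed le er.
have : rho <= rho by [].
rewrite {2}/rho !le_min => /andP[/andP[rr /andP[re rd]] /andP[rl rR]].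
have near y : e - rho < y < e + rho -> branch T2 k y /\ 0 < y < delta.
  move=> /andP[y1 y2]; split; last by apply/andP; split; lra.
  by rewrite /branch/= in_itv/=; apply/andP; split; lra.
have nend y : e - rho < y < e + rho -> y != e -> ~ endpoints T1 y.
  by move=> /andP[y1 y2]; apply: Hr; rewrite ltr_norml; apply/andP; split; lra.
have inT1 y : e - rho < y < e + rho -> y != e -> exists i, branch T1 i y.
  move=> ye yne; have [yk y0d] := near _ ye.
  have : dom T1 y by apply/agree_dom => //; exact: branch_dom yk.
  by rewrite (domE hT1) => -[/(nend _ ye yne)//|[i _ yi]]; exists i.
have val i y : e - rho < y < e + rho -> branch T1 i y -> T1 y = T2 y.
  by move=> ye /branch_dom; apply: agree_val; have [] := near _ ye.
have pin : e - rho < e - rho / 2 < e + rho by apply/andP; split; lra.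
have qin : e - rho < e + rho / 2 < e + rho by apply/andP; split; lra.
have pne : e - rho / 2 != e by rewrite lt_eqF; lra.
have qne : e + rho / 2 != e by rewrite gt_eqF; lra.
have [j pj] := inT1 _ pin pne.
have [i qi] := inT1 _ qin qne.
have nj := endpoint_not_branch hT1 ee (i := j).
have ni := endpoint_not_branch hT1 ee (i := i).
move: (pj) (qi); rewrite /branch/= !in_itv/= => /andP[p1 p2] /andP[q1 q2].
(* Branch [j] of [T1] ends at [e], branch [i] begins there, and both reach at least [rho] away. *)
have rj : rend T1 j <= e.
  rewrite leNgt; apply/negP => h; apply: nj; rewrite /branch/= in_itv/= h andbT.
  by apply: lt_trans p1 _; lra.
have lj : lend T1 j <= e - rho.
  rewrite leNgt; apply/negP => h; apply: (@nend (lend T1 j)).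
  - by rewrite h/=; lra.
  - by rewrite lt_eqF//; lra.
  - by left; exists j.
have rj' : e <= rend T1 j.
  rewrite leNgt; apply/negP => h; apply: (@nend (rend T1 j)).
  - by apply/andP; split; lra.
  - by rewrite lt_eqF.
  - by right; exists j.
have li : e <= lend T1 i.
  rewrite leNgt; apply/negP => h; apply: ni; rewrite /branch/= in_itv/= h/=.
  by apply: lt_trans q2; lra.
have li' : lend T1 i <= e.
  rewrite leNgt; apply/negP => h; apply: (@nend (lend T1 i)).
  - by apply/andP; split; lra.
  - by rewrite gt_eqF.
  - by left; exists i.
have ri : e + rho <= rend T1 i.
  rewrite leNgt; apply/negP => h; apply: (@nend (rend T1 i)).
  - by rewrite h andbT; lra.
  - by rewrite gt_eqF//; lra.
  - by right; exists i.
have leftP y : e - rho < y < e -> branch T1 j y.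
  by move=> /andP[y1 y2]; rewrite /branch/= in_itv/=; apply/andP; split; lra.
have rightP y : e < y < e + rho -> branch T1 i y.
  by move=> /andP[y1 y2]; rewrite /branch/= in_itv/=; apply/andP; split; lra.
have [pi hpi] := emr_coding hT1.
(* The images of two coded points are values attained in every branch; their order is arranged. *)
have [u [v [uv full]]] : exists u v, u < v /\ forall m, exists x y,
    [/\ branch T1 m x, branch T1 m y, T1 x = u & T1 y = v].
  have full a b : forall m, exists x y,
      [/\ branch T1 m x, branch T1 m y, T1 x = pi a & T1 y = pi b].
    move=> m; exists (pi (word_seq [:: m] a)), (pi (word_seq [:: m] b)).
    by split; rewrite ?(coding_step_word hpi)//; exact: (coding_branch_word hpi).
  have [h|h|/(coding_inj hpi)] := ltgtP (pi (fun=> 0%N)) (pi (fun=> 1%N)).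
  - by do 2 eexists; split; [exact: h|exact: full].
  - by do 2 eexists; split; [exact: h|exact: full].
  - by move=> /(congr1 (fun a => a 0%N)).
have [xj [yj [xjb yjb Txj Tyj]]] := full j.
have [xi [yi [xib yib Txi Tyi]]] := full i.
have ltj x : branch T1 j x -> x < e.
  by rewrite /branch/= in_itv/= => /andP[_ h]; apply: lt_le_trans rj.
have gti x : branch T1 i x -> e < x.
  by rewrite /branch/= in_itv/= => /andP[h _]; apply: le_lt_trans h.
have left2 x : x < e -> exists y, [/\ e - rho < y < e & x <= y].
  move=> xe; exists (Num.max x (e - rho / 2)).
  by rewrite lt_max gt_max le_max xe lexx; split => //; apply/andP; split; [apply/orP; right|]; lra.
have right2 x : e < x -> exists y, [/\ e < y < e + rho & y <= x].
  move=> ex; exists (Num.min x (e + rho / 2)).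
  by rewrite lt_min gt_min ge_min ex lexx; split => //; apply/andP; split; [|apply/orP; right]; lra.
have near_l y : e - rho < y < e -> e - rho < y < e + rho.
  by move=> /andP[y1 y2]; apply/andP; split; lra.
have near_r y : e < y < e + rho -> e - rho < y < e + rho.
  by move=> /andP[y1 y2]; apply/andP; split; lra.
have p'in : e - rho < e - rho / 3 < e by apply/andP; split; lra.
have p2in : e - rho < e - rho / 2 < e by apply/andP; split; lra.
have q'in : e < e + rho / 3 < e + rho by apply/andP; split; lra.
have q2in : e < e + rho / 2 < e + rho by apply/andP; split; lra.
have pp' : e - rho / 2 < e - rho / 3 by lra.
have q'q : e + rho / 3 < e + rho / 2 by lra.
have vl y : e - rho < y < e -> T1 y = T2 y.
  by move=> h; apply: (val j); [exact: near_l|exact: leftP].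
have vr y : e < y < e + rho -> T1 y = T2 y.
  by move=> h; apply: (val i); [exact: near_r|exact: rightP].
have bl y : e - rho < y < e -> branch T2 k y by move=> /near_l/near[].
have br y : e < y < e + rho -> branch T2 k y by move=> /near_r/near[].
have [m|m] := branch_monotone hT2 k.
(* Both branches are increasing: just left of [e] the values have reached [v], just right of it they
   are still at most [u < v]. The decreasing case is symmetric. *)
- have mj := branch_increasing hT1 (leftP _ p2in) (leftP _ p'in) pp'.
  have mi := branch_increasing hT1 (rightP _ q'in) (rightP _ q2in) q'q.
  have {}mj := mj _; have {}mi := mi _.
  have [y [yin yjy]] := left2 _ (ltj _ yjb).
  have [z [zin zxi]] := right2 _ (gti _ xib).
  have h1 : v <= T1 y.
    rewrite -Tyj; apply: mj => //; last exact: leftP.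
    by rewrite !vl// m ?inE ?ltW//; exact: bl.
  have h2 : T1 z <= u.
    rewrite -Txi; apply: mi => //; last exact: rightP.
    by rewrite !vr// m ?inE ?ltW//; exact: br.
  have h3 : T1 y <= T1 z.
    rewrite (vl _ yin) (vr _ zin) m ?inE; [|exact: bl|exact: br].
    by case/andP: yin => _ y2; case/andP: zin => z1 _; apply/ltW/(lt_trans y2).
  by have := lt_le_trans uv (le_trans h1 (le_trans h3 h2)); rewrite ltxx.
- have mj := branch_decreasing hT1 (leftP _ p2in) (leftP _ p'in) pp'.
  have mi := branch_decreasing hT1 (rightP _ q'in) (rightP _ q2in) q'q.
  have [y [yin xjy]] := left2 _ (ltj _ xjb).
  have [z [zin zyi]] := right2 _ (gti _ yib).
  have h1 : T1 y <= u.
    rewrite -Txj; apply: mj => //; last exact: leftP.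
    by rewrite !vl// m ?inE ?ltW//; exact: bl.
  have h2 : v <= T1 z.
    rewrite -Tyi; apply: mi => //; last exact: rightP.
    by rewrite !vr// m ?inE ?ltW//; exact: br.
  have h3 : T1 z <= T1 y.
    rewrite (vl _ yin) (vr _ zin) m ?inE; [|exact: br|exact: bl].
    by case/andP: yin => _ y2; case/andP: zin => z1 _; apply/ltW/(lt_trans y2).
  by have := lt_le_trans uv (le_trans h2 (le_trans h3 h1)); rewrite ltxx.
Qed.

End perturbation.

Section common_branches.
Context {R : realType}.
Variables (T1 T2 : interval_map R) (delta : R).
Hypothesis hT1 : is_emr T1.
Hypothesis hT2 : is_emr T2.
Hypothesis delta0 : 0 < delta.
Hypothesis agree_dom : forall x, 0 < x < delta -> dom T1 x <-> dom T2 x.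
Hypothesis agree_val : forall x, 0 < x < delta -> dom T1 x -> T1 x = T2 x.

Let agree_dom' x : 0 < x < delta -> dom T2 x <-> dom T1 x.
Proof. by move=> /agree_dom H; apply: iff_sym. Qed.

Let agree_val' x : 0 < x < delta -> dom T2 x -> T2 x = T1 x.
Proof. by move=> xd /(agree_dom' xd) d1; rewrite agree_val. Qed.

(** The midpoint lies in some branch of the other map. Near 0, no endpoint of either map lies inside
    a branch of the other, so the two intervals coincide. *)
Lemma common_branch i : rend T1 i < delta ->
  exists k, lend T2 k = lend T1 i /\ rend T2 k = rend T1 i.
Proof.
move=> rd; have l0 := lend_gt0 hT1 i; have [_ [lr r1]] := emr_itv hT1 i.
pose x := (lend T1 i + rend T1 i) / 2.
have xi : branch T1 i x by rewrite /branch/= in_itv/= /x; apply/andP; split; lra.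
have near y : branch T1 i y -> 0 < y < delta.
  by rewrite /branch/= in_itv/= => /andP[y1 y2]; apply/andP; split; lra.
have nend2 y : branch T1 i y -> ~ endpoints T2 y.
  move=> yi ye; apply: (endpoint_not_branch2 hT2 hT1 agree_dom' agree_val' _ ye yi).
  exact: near.
have nend1 y k : 0 < y < delta -> endpoints T1 y -> ~ branch T2 k y.
  exact: (endpoint_not_branch2 hT1 hT2 agree_dom agree_val).
have : dom T2 x by apply/(agree_dom (near _ xi)); exact: branch_dom xi.
rewrite (domE hT2) => -[/(nend2 _ xi)//|[k _ xk]]; exists k.
have xk' := xk; move: xk'; rewrite /branch/= in_itv/= => /andP[k1 k2].
have lx : lend T1 i < x by rewrite /x; lra.
have xr : x < rend T1 i by rewrite /x; lra.
split; apply/eqP; rewrite eq_le; apply/andP; split; rewrite leNgt; apply/negP => h.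
- apply: (nend2 (lend T2 k)); last by left; exists k.
  by rewrite /branch/= in_itv/= h (lt_trans k1).
- apply: (nend1 (lend T1 i) k); [|by left; exists i|].
    by rewrite l0 (lt_trans lr).
  by rewrite /branch/= in_itv/= h (lt_trans lx).
- apply: (nend1 (rend T1 i) k); [|by right; exists i|].
    by rewrite rd (lt_trans l0).
  by rewrite /branch/= in_itv/= h (lt_trans k1).
- apply: (nend2 (rend T2 k)); last by right; exists k.
  by rewrite /branch/= in_itv/= h (lt_trans lx).
Qed.

(** Only finitely many intervals reach beyond [delta]; the others are among the intervals of
    [T2]. *)
Lemma length_sum_common t :
  (length_sum T2 t < +oo)%E -> (length_sum T1 t < +oo)%E.
Proof.
move=> fin2.
pose S := [set i | delta <= rend T1 i].
rewrite /length_sum (esumID S); last by move=> i _; rewrite lee_fin powR_ge0.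
rewrite lte_add_pinfty//.
  rewrite setTI esum_fset; [|exact: finite_large_itv|by move=> i _; rewrite lee_fin powR_ge0].
  by rewrite fsbig_finite /=; [rewrite sumEFin ltry|exact: finite_large_itv].
apply: le_lt_trans fin2.
have /choice[phi Hphi] : forall i, exists k, rend T1 i < delta ->
    lend T2 k = lend T1 i /\ rend T2 k = rend T1 i.
  move=> i; have [/common_branch[k Hk]|h] := ltP (rend T1 i) delta.
    by exists k.
  by exists 0%N.
have small i : ([set: nat] `&` ~` S) i -> rend T1 i < delta.
  by move=> [_ /= /negP]; rewrite -ltNge.
apply: (@esum_inj_le _ _ _ _ _ phi) => //.
- move=> i j; rewrite !inE => /small/Hphi[_ ri] /small/Hphi[_ rj] ij.
  by apply: (rend_inj hT1); rewrite -ri -rj ij.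
- by move=> k; rewrite lee_fin powR_ge0.
- move=> i /small/Hphi[li ri]; rewrite /itv_length li ri.
  exact: lexx.
Qed.

End common_branches.

Lemma compact_away_from_0 (R : realType) (K : set R) : compact K ->
  K `<=` `]0, 1]%classic -> exists2 e : R, 0 < e & forall x, 0 < x < e -> ~ K x.
Proof.
move=> cK K01; have oK : open (~` K).
  by apply: closed_openC; apply: compact_closed => //; exact: Rhausdorff.
have : nbhs (0 : R) (~` K).
  apply: open_nbhs_nbhs; split => // /K01 /=; rewrite in_itv/= ltxx//.
rewrite -nbhs_ballE => -[e /= e0 eK]; exists e => // x /andP[x0 xe].
apply: eK; rewrite /ball/= sub0r normrN gtr0_norm//.
Qed.

Theorem corollary2p15 (R : realType) (T : interval_map R) (hT : is_emr T)
    (hP : pressure T (critical_value T) = +oo%E)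
    (T' : interval_map R) (hT' : compact_perturbation T T') :
  exists nu : probability (measurableTypeR R) R, max_dim_measure T' nu.
Proof.
have [[K [cK K01 _ domK valK]] emrT'] := hT'.
have [e e0 He] := compact_away_from_0 cK K01.
have agree_dom x : 0 < x < e -> dom T x <-> dom T' x.
  move=> /He nK; split => dx.
    by have [] : (dom T' `\` K) x by rewrite domK.
  by have [] : (dom T `\` K) x by rewrite -domK.
have agree_val x : 0 < x < e -> dom T x -> T x = T' x.
  by move=> /He nK dx; apply: valK.
have agree_dom' x : 0 < x < e -> dom T' x <-> dom T x.
  by move=> xe; apply: iff_sym; exact: agree_dom.
have agree_val' x : 0 < x < e -> dom T' x -> T' x = T x.
  by move=> xe /(agree_dom' _ xe) dx; rewrite agree_val.
apply: (emr_max_dim_measure emrT') => t t0.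
move=> /(length_sum_common hT emrT' e0 agree_dom agree_val) fin_t.
pose S := [set t : R | (pressure T t < +oo)%E].
have SP u : S u <-> (length_sum T u < +oo)%E.
  split; last exact: pressure_finite.
  by move=> Su; rewrite ltNge leye_eq; apply/negP => /eqP /(pressure_infinite hT) E;
    move: Su; rewrite /S/= E.
(* The lower bound ensures that the critical value, defined as [inf S], is a genuine infimum. *)
have S0 : lbound S 0 by move=> u /SP /(length_sum_gt0 hT) /ltW.
have St : S t by apply/SP.
have hS : has_inf S by split; [exists t|exists 0].
(* Infinite pressure at the critical value excludes it from [S], so below any [t] in [S] there is
   another element [u] of [S]. *)
have lt_t : inf S < t.
  rewrite lt_neqAle (ge_inf hS.2 St) andbT; apply/eqP => E.
  by move: St; rewrite -E /S/= hP.
have : 0 < t - inf S by rewrite subr_gt0.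
move=> /inf_adherent /(_ hS) [u Su]; rewrite addrC subrK => ut.
exists u; first by rewrite ut (S0 _ Su).
apply: (length_sum_common emrT' hT e0 agree_dom' agree_val').
exact/SP.
Qed.
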